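(* Let $A\in\Omega_n$. Then the function $l_{\Omega_n}(A,\cdot)$ is continuous on $\Omega_n$ if and only if either $A$ is a scalar matrix, or $n=2$ and $A$ is a cyclic matrix with two equal eigenvalues.
   Context: $\mathcal M_n$ is the space of complex $n\times n$ matrices. The spectral ball is $\Omega_n=\{A\in\mathcal M_n:r(A)<1\}$, where $r(A)$ is the spectral radius of $A$. A matrix $A\in\mathcal M_n$ is cyclic if there is $v\in\mathbb C^n$ with $\mathbb C^n=\mathrm{span}(v,Av,\dots,A^{n-1}v)$. The Lempert function is $l_{\Omega_n}(A,B)=\inf\{|\alpha|:\exists f\in\mathcal O(\mathbb D,\Omega_n),\ f(0)=A,\ f(\alpha)=B\}$, where $\mathbb D$ is the open unit disc. *)

(* Defs.v *)
From HB Require Import structures.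
From mathcomp Require Import all_boot all_order all_algebra.
From mathcomp Require Import all_classical all_reals all_analysis.
From mathcomp Require Import complex.

Set Implicit Arguments.
Unset Strict Implicit.
Unset Printing Implicit Defensive.

Import Order.TTheory GRing.Theory Num.Theory.
Import numFieldNormedType.Exports.

Local Open Scope classical_set_scope.
Local Open Scope ring_scope.
Local Open Scope complex_scope.

(* The topology of C, hence that of the matrix spaces over it, is the one given
   by the modulus. *)
HB.instance Definition _ (R : realType) := NormedModule.copy R[i] R[i]^o.

(* The norm `|z| of R[i] takes its values in R[i] (as a nonnegative real); Re
   brings it back to R, so that suprema and infima can be taken there. *)
Definition cmod (R : realType) (z : R[i]) : R := complex.Re `|z|.

Definition spectral_radius (R : realType) (n : nat) (A : 'M[R[i]]_n) : R :=
  sup [set cmod a | a in [set a : R[i] | eigenvalue A a]].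

Definition spectral_ball (R : realType) (n : nat) : set 'M[R[i]]_n :=
  [set A | spectral_radius A < 1].
Arguments spectral_ball : clear implicits.

Definition unit_disc (R : realType) : set R[i] := [set z | cmod z < 1].
Arguments unit_disc : clear implicits.

(* O(D, Omega): since the disc is open, complex differentiability at each of
   its points does not depend on the values of f outside the disc.  The scalar
   field of the difference quotient is R[i], so this is the complex derivative
   in the normed space of matrices. *)
Definition holomorphic_disc (R : realType) (n : nat) (Omega : set 'M[R[i]]_n)
    (f : R[i] -> 'M[R[i]]_n) : Prop :=
  forall z, unit_disc R z -> derivable f z 1 /\ Omega (f z).

(* The infimum is that of a set of nonnegative reals; any two points of a
   connected domain lie on a common analytic disc, so that this set is not
   empty for A and B in the spectral ball. *)
Definition lempert (R : realType) (n : nat) (Omega : set 'M[R[i]]_n)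
    (A B : 'M[R[i]]_n) : R :=
  inf [set cmod alpha | alpha in
        [set alpha : R[i] | unit_disc R alpha /\
          exists f, [/\ holomorphic_disc Omega f, f 0 = A & f alpha = B]]].

Definition cyclic_mx (R : realType) (n : nat) (A : 'M[R[i]]_n) : Prop :=
  exists v : 'cV[R[i]]_n, (<<[seq A ^+ i *m v | i <- iota 0 n]>> = fullv)%VS.

(* With n = 2: the eigenvalues, counted with algebraic multiplicity (that is, as
   roots of the characteristic polynomial), are a and a. *)
Definition two_equal_eigenvalues (R : realType) (n : nat) (A : 'M[R[i]]_n) :
    Prop :=
  exists a : R[i], char_poly A = ('X - a%:P) ^+ 2.

(* Main.v *)
Require Import Defs.
From mathcomp Require Import all_boot all_order all_algebra.
From mathcomp Require Import all_classical all_reals all_analysis.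
From mathcomp Require Import complex perm ring lra.

Import Order.TTheory GRing.Theory Num.Theory.
Import numFieldNormedType.Exports.

Local Open Scope classical_set_scope.
Local Open Scope ring_scope.
Local Open Scope complex_scope.

Set Implicit Arguments.
Unset Strict Implicit.
Unset Printing Implicit Defensive.

(** Conjugating an analytic disc by an entire curve in the linear group moves one end of
    it within its similarity class and fixes the other ([disc_conj_r]).  Every similarity
    class has the diagonal matrix of its eigenvalues in its closure.  So, if [l(A, .)] is
    continuous and some matrix with eigenvalues [d] lies on a disc with center [A] at the
    parameter [a], then [l(A, diag d) <= |a|] ([lcont_le_diag]).  The converse half of the
    theorem consists in violating this inequality.  Moebius transformations of the disc act
    on the spectral ball and preserve the Lempert function ([lempert_mobius]), so that one
    eigenvalue of [A] may be chosen freely.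

    Continuity.  If [A] is scalar it may be taken to be 0; then [l(0, B)] is the spectral
    radius of [B], by the Schwarz lemma for the spectral radius ([spectral_schwarz]), and the
    eigenvalues depend continuously on the matrix ([lcont_0]).  If [n = 2] and [A] is cyclic
    with a double eigenvalue, [A] may be taken nilpotent and not 0.  The discs from [A] to
    [B] are then governed by the symmetrized bidisc, the set of traces and determinants:
    explicit discs [(geo_s, geo_p)] from the origin through every point, together with
    the test functions [(2 w p - s) / (2 - w s)], show that [l(A, B)] is the maximum of
    [|2 w det B - tr B| / |2 - w tr B|] over [|w| = 1] ([lempert_nilpotent2]), which is
    continuous.

    At least two eigenvalues ([two_eigenvalues_not_lcont]).  After Moebius transformations
    there are eigenvalues [a] and [b] on one ray, [|a| < |b|], such that [b] is strictly the
    farthest from 0 and is not more often an eigenvalue than [a].  With each [b] paired with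
    an [a], the discs in dimension two lead from a nilpotent matrix to [A] at a parameter
    less than [|b|] ([reach_ray]).  Continuity would make [l(A, 0)] less than the spectral
    radius of [A].

    One eigenvalue, [A] not scalar, [n >= 3] ([nilpotent_not_lcont]).  Let [A] be nilpotent
    of order [m].  A perturbation [A + z P U], of rank 1 if [m >= 3] and of rank 2 if
    [m = 2], has a double eigenvalue [mu] at a parameter [alpha] of the order of
    [mu ^ (m - 1)], respectively [mu ^ (3 / 2)] ([chain_update], [square_zero_update]).  On
    the other hand, along a disc from [A] to the diagonal matrix [D] with the same
    eigenvalues, the characteristic polynomial at [mu] has derivative 0 at the end, since
    [mu - D] has corank 2; as the coefficients vanish at the beginning, some of them to
    second order, this forces the parameter to be larger ([critical_value_bound]).  For small
    [mu] this contradicts [l(A, D) <= alpha].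

    The complex analysis rests on Goursat's bisection ([goursat]), from which the maximum
    principle is derived by means of the exponential ([center_le_circle], [max_principle]);
    the surjectivity of the exponential also gives the curves in the linear group
    ([entire_path_in_GL]). *)

(** * Modulus and complex differentiability *)

Section Modulus.
Variable R : realType.
Implicit Types z w : R[i].

Lemma normc_cmod z : `|z| = (cmod z)%:C.
Proof. by rewrite /cmod normc_def. Qed.

Lemma cmod_ge0 z : 0 <= cmod z.
Proof. by rewrite -lecR -normc_cmod normr_ge0. Qed.

Lemma cmodM z w : cmod (z * w) = cmod z * cmod w.
Proof. by apply: complexI; rewrite rmorphM -!normc_cmod normrM. Qed.

Lemma ler_cmodD z w : cmod (z + w) <= cmod z + cmod w.
Proof. by rewrite -lecR rmorphD -!normc_cmod ler_normD. Qed.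

Lemma cmodN z : cmod (- z) = cmod z.
Proof. by rewrite /cmod normrN. Qed.

Lemma cmodBC z w : cmod (z - w) = cmod (w - z).
Proof. by rewrite -cmodN opprB. Qed.

Lemma ler_cmodB z w : cmod (z - w) <= cmod z + cmod w.
Proof. by rewrite -[cmod w]cmodN ler_cmodD. Qed.

Lemma ler_cmod_dist z w : cmod z - cmod w <= cmod (z - w).
Proof. by rewrite lerBlDr -{1}(subrK w z) ler_cmodD. Qed.

Lemma cmod_real (x : R) : cmod x%:C = `|x|.
Proof. by rewrite /cmod normc_def /= expr0n /= addr0 sqrtr_sqr. Qed.

Lemma cmod0 : cmod (0 : R[i]) = 0.
Proof. by rewrite /cmod normr0. Qed.

Lemma cmod1 : cmod (1 : R[i]) = 1.
Proof. by rewrite /cmod normr1. Qed.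

Lemma cmod_eq0 z : (cmod z == 0) = (z == 0).
Proof. by rewrite -(normr_eq0 z) normc_cmod (inj_eq (@complexI _)). Qed.

Lemma cmod_gt0 z : (0 < cmod z) = (z != 0).
Proof. by rewrite lt_neqAle cmod_ge0 andbT eq_sym cmod_eq0. Qed.

Lemma cmodX z k : cmod (z ^+ k) = cmod z ^+ k.
Proof.
by elim: k => [|k IH]; rewrite ?expr0 ?cmod1// !exprS cmodM IH.
Qed.

Lemma cmodV z : cmod z^-1 = (cmod z)^-1.
Proof.
have [->|z0] := eqVneq z 0; first by rewrite invr0 cmod0 invr0.
have cz : cmod z != 0 by rewrite cmod_eq0.
by apply: (mulfI cz); rewrite -cmodM !divff ?cmod1.
Qed.

Lemma cmod_nat k : cmod (k%:R : R[i]) = k%:R.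
Proof. by rewrite -(rmorph_nat (real_complex R)) cmod_real normr_nat. Qed.

Lemma cmod_conj z : cmod z^* = cmod z.
Proof. by rewrite /cmod normcJ. Qed.

Lemma sqr_cmod z : (cmod z ^+ 2)%:C = z * z^*.
Proof. by rewrite rmorphXn /= -normc_cmod sqr_normc. Qed.

Lemma sqr_cmodE z : cmod z ^+ 2 = complex.Re z ^+ 2 + complex.Im z ^+ 2.
Proof. by apply: complexI; rewrite rmorphXn/= -normc_cmod add_Re2_Im2. Qed.

Lemma ler_norm_Re z : `|complex.Re z| <= cmod z.
Proof. by rewrite -lecR -normc_cmod normc_ge_Re. Qed.

Lemma ler_Re_cmod z : complex.Re z <= cmod z.
Proof. exact: le_trans (ler_norm _) (ler_norm_Re z). Qed.

Lemma ler_cmod_sum I r (P : pred I) (F : I -> R[i]) :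
  cmod (\sum_(i <- r | P i) F i) <= \sum_(i <- r | P i) cmod (F i).
Proof.
elim/big_rec2: _ => [|i y1 y2 _ H]; first by rewrite cmod0.
by apply: le_trans (ler_cmodD _ _) _; rewrite lerD2l.
Qed.

Lemma cmod_prod I r (P : pred I) (F : I -> R[i]) :
  cmod (\prod_(i <- r | P i) F i) = \prod_(i <- r | P i) cmod (F i).
Proof.
by elim/big_rec2: _ => [|i y1 y2 _ <-]; rewrite ?cmod1 ?cmodM.
Qed.

End Modulus.

Section Derivative.
Variable R : realType.
Notation C := R[i].
Implicit Types (f g phi : C -> C) (z w l m : C).

Lemma is_deriveP (f : C -> C) (z l : C) : is_derive z 1 f l <->
  forall e : R, 0 < e -> exists2 d : R, 0 < d & forall h : C, cmod h < d ->
    cmod (f (z + h) - f z - l * h) <= e * cmod h.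
Proof.
split=> [[df dl] e e0|H].
  have : h^-1 *: ((f \o shift z) (h *: 1) - f z) @[h --> 0^'] --> l.
    by rewrite -dl; exact: df.
  move/cvgrPdist_le => /(_ e%:C); rewrite ltcR => /(_ e0) [d /= d0 Hd].
  exists (complex.Re d); first by move: d0; rewrite ltcE => /andP[].
  move=> h hd; have [->|h0] := eqVneq h 0.
    by rewrite !addr0 mulr0 subr0 subrr cmod0 mulr0.
  have := Hd h; rewrite /ball_/= sub0r normrN normc_cmod => /(_ _ h0).
  have -> : (cmod h)%:C < d.
    by move: d0; rewrite !ltcE /= => /andP[/eqP-> _]; rewrite eqxx.
  move=> /(_ isT); rewrite normc_cmod lecR => {}Hd.
  rewrite -ler_pdivrMr ?cmod_gt0//; apply: le_trans Hd.
  rewrite -cmodV -cmodM cmodBC (_ : (_ - _ - _) * _ =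
    h^-1 *: (f (h *: 1 + z) - f z) - l)//.
  by rewrite /GRing.scale/= mulr1 [h + z]addrC mulrBl -mulrA divff// mulr1 mulrC.
have cv : h^-1 *: ((f \o shift z) (h *: 1) - f z) @[h --> 0^'] --> l.
  apply/cvgrPdist_le => e e0.
  have e0' : 0 < complex.Re e by move: e0; rewrite ltcE => /andP[].
  have eE : e = (complex.Re e)%:C.
    by move: e0 {e0'}; rewrite ltcE; case: e => a b /= /andP[/eqP-> _].
  have [d d0 Hd] := H _ e0'; exists d%:C => /=; first by rewrite ltcR.
  move=> h; rewrite /ball_/= sub0r normrN normc_cmod ltcR => hd h0.
  rewrite eE normc_cmod lecR cmodBC.
  have := Hd h hd; rewrite -ler_pdivrMr ?cmod_gt0//.
  rewrite -cmodV -cmodM (_ : (_ - _ - _) * _ =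
    h^-1 *: (f (h *: 1 + z) - f z) - l)//.
  by rewrite /GRing.scale/= mulr1 [h + z]addrC mulrBl -mulrA divff// mulr1 mulrC.
apply: DeriveDef; first by apply/cvg_ex; exists l.
exact: (cvg_lim _ cv).
Qed.

(** With [dist] an arbitrary function the rules of limits serve for functions on C as
    well as for functions on matrix spaces. *)
Definition tends T (dist : T -> R) (f : T -> C) l := forall e : R, 0 < e ->
  exists2 d : R, 0 < d & forall x, dist x < d -> cmod (f x - l) <= e.

Section Tends.
Variables (T : Type) (dist : T -> R).
Implicit Types (p q : T -> C).

Lemma tends_cst c : tends dist (fun=> c) c.
Proof. by move=> e e0; exists 1 => // w _; rewrite subrr cmod0 ltW. Qed.

Lemma tendsD p q l m : tends dist p l -> tends dist q m ->
  tends dist (fun x => p x + q x) (l + m).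
Proof.
move=> Hf Hg e e0; have e2 : 0 < e / 2 by rewrite divr_gt0.
have [d1 d10 H1] := Hf _ e2; have [d2 d20 H2] := Hg _ e2.
exists (Num.min d1 d2); first by rewrite lt_min d10.
move=> w; rewrite lt_min => /andP[w1 w2].
rewrite opprD addrACA [leRHS](splitr e); apply: le_trans (ler_cmodD _ _) _.
by rewrite lerD ?H1 ?H2.
Qed.

Lemma tends_bnd p l : tends dist p l ->
  exists2 d : R, 0 < d & forall x, dist x < d -> cmod (p x) <= cmod l + 1.
Proof.
move=> /(_ _ ltr01)[d d0 H]; exists d => // w /H h.
by rewrite -{1}(subrK l (p w)) addrC (le_trans (ler_cmodD _ _))// lerD2l.
Qed.

Lemma tendsM p q l m : tends dist p l -> tends dist q m ->
  tends dist (fun x => p x * q x) (l * m).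
Proof.
move=> Hf Hg e e0.
have [d3 d30 H3] := tends_bnd Hf.
have K0 : 0 < cmod l + 1 + cmod m.
  by rewrite addrAC ltr_wpDl ?addr_ge0 ?cmod_ge0.
have e2 : 0 < e / (cmod l + 1 + cmod m) by rewrite divr_gt0.
have [d1 d10 H1] := Hf _ e2; have [d2 d20 H2] := Hg _ e2.
exists (Num.min d1 (Num.min d2 d3)); first by rewrite !lt_min d10 d20.
move=> w; rewrite !lt_min => /and3P[w1 w2 w3].
have -> : p w * q w - l * m = p w * (q w - m) + (p w - l) * m by ring.
rewrite -[leRHS](divfK (lt0r_neq0 K0)); apply: le_trans (ler_cmodD _ _) _.
rewrite [leRHS]mulrDr !cmodM lerD//.
  by rewrite [leRHS]mulrC ler_pM ?cmod_ge0 ?H2 ?H3.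
by rewrite ler_wpM2r ?cmod_ge0 ?H1.
Qed.

Lemma tendsV p l : l != 0 -> tends dist p l -> tends dist (fun x => (p x)^-1) l^-1.
Proof.
move=> f0 Hf e e0; have c0 : 0 < cmod l by rewrite cmod_gt0.
have c2 : 0 < cmod l / 2 by rewrite divr_gt0.
have e2 : 0 < e * (cmod l / 2 * cmod l) by rewrite !mulr_gt0.
have [d1 d10 H1] := Hf _ c2; have [d2 d20 H2] := Hf _ e2.
exists (Num.min d1 d2); first by rewrite !lt_min d10 d20.
move=> w; rewrite !lt_min => /andP[/H1 w1 /H2 w2].
have fw : cmod l / 2 <= cmod (p w).
  have := ler_cmod_dist l (p w); rewrite cmodBC.
  by move: (cmod _) (cmod (p w)) (cmod (p w - _)) w1 => a b c; lra.
have fw0 : p w != 0 by rewrite -cmod_gt0 (lt_le_trans c2).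
have -> : (p w)^-1 - l^-1 = - (p w - l) / (p w * l) by field; rewrite ?fw0 ?f0.
rewrite cmodM cmodN cmodV ler_pdivrMr ?cmodM ?mulr_gt0 ?cmod_gt0//.
by apply: le_trans w2 _; rewrite ler_pM2l// ler_pM2r.
Qed.

Lemma tends_sum I (r : seq I) (P : pred I) (F : I -> T -> C) (L : I -> C) :
  (forall i, P i -> tends dist (F i) (L i)) ->
  tends dist (fun x => \sum_(i <- r | P i) F i x) (\sum_(i <- r | P i) L i).
Proof.
move=> H; elim: r => [|i r IH].
  rewrite big_nil (_ : (fun x => _) = (fun=> 0)); first exact: tends_cst.
  by rewrite funeqE => x; rewrite big_nil.
rewrite big_cons; case: ifP => Pi.
  rewrite (_ : (fun x => _) = (fun x => F i x + \sum_(i <- r | P i) F i x)).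
    by apply: tendsD => //; exact: H.
  by rewrite funeqE => x; rewrite big_cons Pi.
by rewrite (_ : (fun x => _) = (fun x => \sum_(i <- r | P i) F i x))// funeqE => x; rewrite big_cons Pi.
Qed.

Lemma tends_prod I (r : seq I) (P : pred I) (F : I -> T -> C) (L : I -> C) :
  (forall i, P i -> tends dist (F i) (L i)) ->
  tends dist (fun x => \prod_(i <- r | P i) F i x) (\prod_(i <- r | P i) L i).
Proof.
move=> H; elim: r => [|i r IH].
  rewrite big_nil (_ : (fun x => _) = (fun=> 1)); first exact: tends_cst.
  by rewrite funeqE => x; rewrite big_nil.
rewrite big_cons; case: ifP => Pi.
  rewrite (_ : (fun x => _) = (fun x => F i x * \prod_(i <- r | P i) F i x)).
    by apply: tendsM => //; exact: H.
  by rewrite funeqE => x; rewrite big_cons Pi.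
by rewrite (_ : (fun x => _) = (fun x => \prod_(i <- r | P i) F i x))// funeqE => x; rewrite big_cons Pi.
Qed.

End Tends.

Definition ccont f z := tends (fun w => cmod (w - z)) f (f z).

(** Caratheodory's form of differentiability: the difference quotient extends
    continuously.  It turns the rules of calculus into identities. *)
Definition cderiv f z l := exists phi : C -> C,
  [/\ ccont phi z, phi z = l & forall w : C, f w = f z + phi w * (w - z)].

Lemma ccont_cst c z : ccont (fun=> c) z.
Proof. exact: tends_cst. Qed.

Lemma ccont_id z : ccont id z.
Proof. by move=> e e0; exists e => // w /ltW. Qed.

Lemma ccontD f g z : ccont f z -> ccont g z -> ccont (fun w => f w + g w) z.
Proof. exact: tendsD. Qed.

Lemma ccont_bnd f z : ccont f z ->
  exists2 d : R, 0 < d & forall w : C, cmod (w - z) < d -> cmod (f w) <= cmod (f z) + 1.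
Proof. exact: tends_bnd. Qed.

Lemma ccontM f g z : ccont f z -> ccont g z -> ccont (fun w => f w * g w) z.
Proof. exact: tendsM. Qed.

Lemma ccontV f z : f z != 0 -> ccont f z -> ccont (fun w => (f w)^-1) z.
Proof. exact: tendsV. Qed.

Lemma ccont_comp f g z : ccont f z -> ccont g (f z) -> ccont (fun w => g (f w)) z.
Proof.
move=> Hf Hg e e0; have [d1 d10 H1] := Hg _ e0.
have d2 : 0 < d1 / 2 by rewrite divr_gt0.
have [d d0 H] := Hf _ d2; exists d => // w /H wd; apply: H1.
by apply: le_lt_trans wd _; rewrite ltr_pdivrMr// ltr_pMr// ltr1n.
Qed.

Lemma ccont_ext f g z (d : R) : 0 < d ->
  (forall w : C, cmod (w - z) < d -> f w = g w) -> ccont f z -> ccont g z.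
Proof.
move=> d0 fg Hf e e0; have [d1 d10 H1] := Hf _ e0.
exists (Num.min d d1); first by rewrite !lt_min d0.
move=> w; rewrite !lt_min => /andP[wd wd1].
by rewrite -!fg ?H1// subrr cmod0.
Qed.

Lemma cderiv_cont f z l : cderiv f z l -> ccont f z.
Proof.
move=> [phi [cphi _ fE]].
apply: (@ccont_ext (fun w => f z + phi w * (w - z)) f z 1) => //.
apply: ccontD; first exact: ccont_cst.
by apply: ccontM => //; apply: ccontD; [exact: ccont_id|exact: ccont_cst].
Qed.

Lemma cderiv_ext f g z l (d : R) : 0 < d ->
  (forall w : C, cmod (w - z) < d -> f w = g w) -> cderiv f z l -> cderiv g z l.
Proof.
move=> d0 fg [phi [cphi pz fE]].
exists (fun w => if cmod (w - z) < d then phi w else (g w - g z) / (w - z)); split.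
- by apply: ccont_ext d0 _ cphi => w ->.
- by rewrite subrr cmod0 d0.
move=> w; case: ifPn => wd; first by rewrite -fg// -(fg z) ?subrr ?cmod0.
have wz : w - z != 0 by apply: contraNneq wd => ->; rewrite cmod0.
by rewrite divfK// subrKC.
Qed.

Lemma cderivP f z l : is_derive z 1 f l <-> cderiv f z l.
Proof.
rewrite is_deriveP; split=> [H|[phi [cphi <- fE]] e /cphi[d d0 Hd]].
  exists (fun w => if w == z then l else (f w - f z) / (w - z)); split.
  - move=> e e0; have [d d0 Hd] := H e e0; exists d => // w wd; rewrite eqxx.
    case: eqVneq => [_|wz]; first by rewrite subrr cmod0 ltW.
    have wz' : w - z != 0 by rewrite subr_eq0.
    have := Hd (w - z) wd; rewrite [z + _]addrC subrK.
    rewrite -ler_pdivrMr ?cmod_gt0// -cmodV -cmodM mulrBl -mulrA divff// mulr1.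
    done.
  - by rewrite eqxx.
  move=> w; case: eqVneq => [->|wz]; first by rewrite subrr mulr0 addr0.
  by rewrite divfK ?subr_eq0// subrKC.
exists d => // h hd.
have -> : f (z + h) - f z - phi z * h = (phi (z + h) - phi z) * h.
  by rewrite fE; ring.
by rewrite cmodM ler_wpM2r ?cmod_ge0 ?Hd// addrC addKr.
Qed.

Lemma cderiv_cst c z : cderiv (fun=> c) z 0.
Proof.
by exists (fun=> 0); split=> [||w]; [exact: ccont_cst| |rewrite mul0r addr0].
Qed.

Lemma cderiv_id z : cderiv id z 1.
Proof.
by exists (fun=> 1); split=> [||w]; [exact: ccont_cst| |rewrite mul1r subrKC].
Qed.

Lemma cderivD f g z l m : cderiv f z l -> cderiv g z m ->
  cderiv (fun w => f w + g w) z (l + m).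
Proof.
move=> [p [cp <- fE]] [q [cq <- gE]]; exists (fun w => p w + q w); split=> //.
  exact: ccontD.
by move=> w; rewrite fE gE; ring.
Qed.

Lemma cderivM f g z l m : cderiv f z l -> cderiv g z m ->
  cderiv (fun w => f w * g w) z (l * g z + f z * m).
Proof.
move=> cf cg; have /cderiv_cont ccg := cg.
case: cf cg => [p [cp <- fE]] [q [cq <- gE]].
exists (fun w => p w * g w + f z * q w); split=> //.
  by apply: ccontD; apply: ccontM => //; exact: ccont_cst.
by move=> w; rewrite fE gE; ring.
Qed.

Lemma cderivV f z l : f z != 0 -> cderiv f z l ->
  cderiv (fun w => (f w)^-1) z (- l / f z ^+ 2).
Proof.
move=> f0 cf; have /cderiv_cont ccf := cf; case: cf => [p [cp <- fE]].
have [d d0 Hd] : exists2 d : R, 0 < d & forall w : C, cmod (w - z) < d -> f w != 0.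
  have c2 : 0 < cmod (f z) / 2 by rewrite divr_gt0 ?cmod_gt0.
  have [d d0 Hd] := ccf _ c2; exists d => // w /Hd; apply: contraTneq => ->.
  rewrite sub0r cmodN -ltNge ltr_pdivrMr// ltr_pMr ?cmod_gt0// ltr1n //.
pose g w := if f w == 0 then 0 else (f w)^-1.
apply: (@cderiv_ext g _ _ _ d d0).
  by move=> w /Hd; rewrite /g => /negPf->.
exists (fun w => if cmod (w - z) < d then - p w / (f w * f z) else (g w - g z) / (w - z)).
split.
- apply: (@ccont_ext (fun w => - p w / (f w * f z)) _ _ d) => //.
    by move=> w ->.
  apply: ccontM; first by apply: (@ccont_ext (fun w => -1 * p w) _ _ 1) => // [w _|]; rewrite ?mulN1r//; apply: ccontM => //; exact: ccont_cst.
  by apply: ccontV; [rewrite mulf_neq0|apply: ccontM => //; exact: ccont_cst].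
- by rewrite subrr cmod0 d0 expr2.
move=> w; case: ifPn => wd; rewrite /g (negPf f0).
  have fw := Hd _ wd; rewrite (negPf fw).
  have -> : - p w / (f w * f z) * (w - z) = - (f w - f z) / (f w * f z).
    by rewrite [f w - _](_ : _ = p w * (w - z)) ?(fE w); ring.
  by field; rewrite ?fw ?f0.
have wz : w - z != 0 by apply: contraNneq wd => ->; rewrite cmod0.
by rewrite divfK// subrKC.
Qed.

Lemma cderiv_comp f g z l m : cderiv f z l -> cderiv g (f z) m ->
  cderiv (fun w => g (f w)) z (m * l).
Proof.
move=> cf; have /cderiv_cont ccf := cf; case: cf => [p [cp <- fE]].
move=> [q [cq <- gE]]; exists (fun w => q (f w) * p w); split=> //.
  by apply: ccontM => //; apply: ccont_comp.
by move=> w; rewrite {1}gE -mulrA; congr (_ + _ * _); rewrite {1}fE; ring.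
Qed.

Definition cdiff f z := exists l, cderiv f z l.

Lemma cdiffP f z : derivable f z 1 <-> cdiff f z.
Proof.
split=> [df|[l /cderivP[]//]].
by exists ('D_1 f z); apply/cderivP/derivableP.
Qed.

Lemma cdiff_cont f z : cdiff f z -> ccont f z.
Proof. by move=> [l /cderiv_cont]. Qed.

Lemma cdiff_ext f g z (d : R) : 0 < d ->
  (forall w : C, cmod (w - z) < d -> f w = g w) -> cdiff f z -> cdiff g z.
Proof. by move=> d0 fg [l H]; exists l; apply: cderiv_ext d0 fg H. Qed.

Lemma cdiff_cst c z : cdiff (fun=> c) z.
Proof. by exists 0; exact: cderiv_cst. Qed.

Lemma cdiff_id z : cdiff id z.
Proof. by exists 1; exact: cderiv_id. Qed.

Lemma cdiffD f g z : cdiff f z -> cdiff g z -> cdiff (fun w => f w + g w) z.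
Proof. by move=> [l Hl] [m Hm]; exists (l + m); exact: cderivD. Qed.

Lemma cdiffM f g z : cdiff f z -> cdiff g z -> cdiff (fun w => f w * g w) z.
Proof. by move=> [l Hl] [m Hm]; eexists; apply: cderivM; eassumption. Qed.

Lemma cdiffN f z : cdiff f z -> cdiff (fun w => - f w) z.
Proof.
move=> Hf; apply: (@cdiff_ext (fun w => -1 * f w) _ _ 1) => // [w _|].
  by rewrite mulN1r.
by apply: cdiffM => //; exact: cdiff_cst.
Qed.

Lemma cdiffB f g z : cdiff f z -> cdiff g z -> cdiff (fun w => f w - g w) z.
Proof. by move=> Hf /cdiffN; exact: cdiffD. Qed.

Lemma cdiffV f z : f z != 0 -> cdiff f z -> cdiff (fun w => (f w)^-1) z.
Proof. by move=> f0 [l Hl]; eexists; apply: cderivV; eassumption. Qed.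

Lemma cdiff_comp f g z : cdiff f z -> cdiff g (f z) -> cdiff (fun w => g (f w)) z.
Proof. by move=> [l Hl] [m Hm]; eexists; apply: cderiv_comp; eassumption. Qed.

Lemma cdiff_sum I (r : seq I) (P : pred I) (F : I -> C -> C) z :
  (forall i, P i -> cdiff (F i) z) -> cdiff (fun x => \sum_(i <- r | P i) F i x) z.
Proof.
move=> H; elim: r => [|i r IH].
  by rewrite (_ : (fun x => _) = (fun=> 0)); [exact: cdiff_cst|rewrite funeqE => x; rewrite big_nil].
case Pi : (P i).
  rewrite (_ : (fun x => _) = (fun x => F i x + \sum_(i <- r | P i) F i x)).
    by apply: cdiffD => //; exact: H.
  by rewrite funeqE => x; rewrite big_cons Pi.
by rewrite (_ : (fun x => _) = (fun x => \sum_(i <- r | P i) F i x))// funeqE => x; rewrite big_cons Pi.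
Qed.

Lemma cdiff_prod I (r : seq I) (P : pred I) (F : I -> C -> C) z :
  (forall i, P i -> cdiff (F i) z) -> cdiff (fun x => \prod_(i <- r | P i) F i x) z.
Proof.
move=> H; elim: r => [|i r IH].
  by rewrite (_ : (fun x => _) = (fun=> 1)); [exact: cdiff_cst|rewrite funeqE => x; rewrite big_nil].
case Pi : (P i).
  rewrite (_ : (fun x => _) = (fun x => F i x * \prod_(i <- r | P i) F i x)).
    by apply: cdiffM => //; exact: H.
  by rewrite funeqE => x; rewrite big_cons Pi.
by rewrite (_ : (fun x => _) = (fun x => \prod_(i <- r | P i) F i x))// funeqE => x; rewrite big_cons Pi.
Qed.

Lemma cdiffX f k z : cdiff f z -> cdiff (fun w => f w ^+ k) z.
Proof.
move=> Hf; elim: k => [|k IH]; first exact: cdiff_cst.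
rewrite (_ : (fun w => _) = (fun w => f w * f w ^+ k)); first exact: cdiffM.
by rewrite funeqE => w; rewrite exprS.
Qed.

(** Entrywise, so that everything is reduced to scalar functions; [mdiffP] is the
    comparison with differentiability in the normed space of matrices. *)
Definition mdiff (p q : nat) (F : C -> 'M[C]_(p, q)) (z : C) :=
  forall i j, cdiff (fun x => F x i j) z.

Lemma mdiffP (p q : nat) (F : C -> 'M[C]_(p, q)) (z : C) :
  derivable F z 1 <-> mdiff F z.
Proof.
split=> [/cvg_ex[/= A FA] i j|dF].
  apply/cdiffP/cvg_ex; exists (A i j).
  rewrite (_ : (fun h => _) = (fun M : 'M[C]_(p, q) => M i j) \o
    (fun h => h^-1 *: ((F \o shift z) (h *: 1) - F z))).
    by apply: continuous_cvg => //; exact: coord_continuous.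
  by apply/funext => h; rewrite /= !mxE.
have H i j : exists a : C, h^-1 *: (((fun x => F x i j) \o shift z) (h *: 1) - F z i j)
    @[h --> 0^'] --> a.
  by have /cdiffP/cvg_ex := dF i j.
apply/cvg_ex; exists (\matrix_(i < p, j < q) sval (cid (H i j))).
apply/cvg_ballP => /= e e0; near=> x; split=> // i j; rewrite !mxE.
move: i j; near: x; apply: filter_forall => /= i; apply: filter_forall => /= j.
by have /cvg_ballP/(_ e e0) := svalP (cid (H i j)).
Unshelve. all: by end_near. Qed.

End Derivative.

(** * Goursat's theorem for parallelograms *)

Section Goursat.
Variable R : realType.
Notation C := R[i].
Implicit Types (G : C -> C) (z u v w l : C) (N k : nat).

(** The left Riemann sum, with [2 ^ N] pieces, of the integral of [G] from [z] to
    [z + u].  Dyadic sums are exactly additive when a segment is halved, which makes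
    integrals unnecessary for the bisection argument below. *)
Definition riemann_sum G N z u : C :=
  u / (2 ^ N)%:R * \sum_(k < 2 ^ N) G (z + u * (k%:R / (2 ^ N)%:R)).

Definition boundary_sum G N z u v : C :=
  riemann_sum G N z u + riemann_sum G N (z + u) v
  - riemann_sum G N (z + v) u - riemann_sum G N z v.

Lemma natX2_neq0 N : (2 ^ N)%:R != 0 :> C.
Proof. by rewrite pnatr_eq0 expn_eq0. Qed.

Lemma riemann_sumS G N z u : riemann_sum G N.+1 z u =
  riemann_sum G N z (u / 2) + riemann_sum G N (z + u / 2) (u / 2).
Proof.
rewrite /riemann_sum.
have D : (2 ^ N.+1)%:R = 2 * (2 ^ N)%:R :> C by rewrite expnS natrM.
have D0 := natX2_neq0 N; have D2 : (2 : C) != 0 by rewrite pnatr_eq0.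
have -> : u / (2 ^ N.+1)%:R = u / 2 / (2 ^ N)%:R by rewrite D invfM mulrA.
rewrite -mulrDr D; congr (_ * _).
have -> : (2 ^ N.+1 = 2 ^ N + 2 ^ N)%N by rewrite expnS mul2n addnn.
rewrite big_split_ord /=; congr (_ + _); apply: eq_bigr => k _; congr (G _).
  by field; rewrite ?D0.
by rewrite natrD; field; rewrite ?D0.
Qed.

Lemma boundary_sumS G N z u v : boundary_sum G N.+1 z u v =
  boundary_sum G N z (u / 2) (v / 2)
  + boundary_sum G N (z + u / 2) (u / 2) (v / 2)
  + boundary_sum G N (z + v / 2) (u / 2) (v / 2)
  + boundary_sum G N (z + u / 2 + v / 2) (u / 2) (v / 2).
Proof.
rewrite /boundary_sum !riemann_sumS.
have h (x : C) : x = x / 2 + x / 2.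
  by field.
have -> : z + u + v / 2 = z + u / 2 + v / 2 + u / 2 by field.
have -> : z + v + u / 2 = z + u / 2 + v / 2 + v / 2 by field.
have -> : z + u / 2 + u / 2 = z + u by rewrite -addrA -h.
have -> : z + v / 2 + v / 2 = z + v by rewrite -addrA -h.
have -> : z + v / 2 + u / 2 = z + u / 2 + v / 2 by ring.
ring.
Qed.

Lemma riemann_sum_affine N z u (c l : C) :
  riemann_sum (fun x => c + l * x) N z u = u * c + l * (u * z)
    + l * u ^+ 2 * (\sum_(k < 2 ^ N) k%:R / (2 ^ N)%:R / (2 ^ N)%:R).
Proof.
rewrite /riemann_sum.
under eq_bigr do rewrite mulrDr mulrA addrA.
rewrite big_split/= sumr_const card_ord mulrDr -[(_ + _) *+ _]mulr_natr.
congr (_ + _); first by field; exact: natX2_neq0.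
by rewrite !big_distrr/=; apply: eq_bigr => k _; field; exact: natX2_neq0.
Qed.

Lemma boundary_sum_affine N z u v (c l : C) :
  boundary_sum (fun x => c + l * x) N z u v = 0.
Proof. by rewrite /boundary_sum !riemann_sum_affine; ring. Qed.

Lemma riemann_sumB G F N z u :
  riemann_sum (fun x => G x - F x) N z u = riemann_sum G N z u - riemann_sum F N z u.
Proof. by rewrite /riemann_sum sumrB mulrBr. Qed.

Lemma riemann_sum_bound G N z u (M : R) :
  (forall t : R, 0 <= t <= 1 -> cmod (G (z + u * t%:C)) <= M) ->
  cmod (riemann_sum G N z u) <= cmod u * M.
Proof.
move=> H; rewrite /riemann_sum !cmodM cmodV cmod_nat -mulrA ler_wpM2l ?cmod_ge0//.
have N0 : 0 < (2 ^ N)%:R :> R by rewrite ltr0n expn_gt0.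
rewrite mulrC ler_pdivrMr//; apply: le_trans (ler_cmod_sum _ _ _) _.
apply: (@le_trans _ _ (\sum_(k < 2 ^ N) M)); last first.
  by rewrite sumr_const card_ord mulr_natr.
apply: ler_sum => k _.
have -> : k%:R / (2 ^ N)%:R = (k%:R / (2 ^ N)%:R : R)%:C.
  by rewrite rmorphM fmorphV !rmorph_nat.
apply: H; rewrite divr_ge0 ?ler0n//= ler_pdivrMr// mul1r ler_nat ltnW//.
Qed.

Definition in_pgram z u v w := exists s t : R,
  [/\ 0 <= s <= 1, 0 <= t <= 1 & w = z + u * s%:C + v * t%:C].

(** Boundary sums of affine functions vanish, so that only the distance of [G] from an
    affine function matters. *)
Lemma boundary_sum_bound G N z u v (c l : C) (M : R) :
  (forall w, in_pgram z u v w -> cmod (G w - (c + l * w)) <= M) ->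
  cmod (boundary_sum G N z u v) <= (cmod u + cmod v) * M *+ 2.
Proof.
move=> H; set F := fun w => G w - (c + l * w).
have -> : boundary_sum G N z u v = boundary_sum F N z u v.
  rewrite -[LHS]subr0 -(boundary_sum_affine N z u v c l) /F /boundary_sum.
  rewrite !riemann_sumB; ring.
have i01 : 0 <= (0 : R) <= 1 by rewrite lexx ler01.
have i11 : 0 <= (1 : R) <= 1 by rewrite lexx ler01.
have B1 : cmod (riemann_sum F N z u) <= cmod u * M.
  by apply: riemann_sum_bound => t t01; apply: H; exists t, 0; rewrite mulr0 addr0.
have B2 : cmod (riemann_sum F N (z + u) v) <= cmod v * M.
  by apply: riemann_sum_bound => t t01; apply: H; exists 1, t; rewrite mulr1.
have B3 : cmod (riemann_sum F N (z + v) u) <= cmod u * M.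
  apply: riemann_sum_bound => t t01; apply: H; exists t, 1; split=> //.
  by rewrite mulr1 addrAC.
have B4 : cmod (riemann_sum F N z v) <= cmod v * M.
  by apply: riemann_sum_bound => t t01; apply: H; exists 0, t; rewrite mulr0 addr0.
rewrite /boundary_sum; apply: le_trans (ler_cmodB _ _) _.
rewrite mulr2n mulrDl addrACA addrA lerD//; apply: le_trans (ler_cmodB _ _) _.
by rewrite addrAC lerD//; apply: le_trans (ler_cmodD _ _) _; rewrite lerD.
Qed.

Lemma exists_halving_lt (L d : R) : 0 < d -> exists k : nat, L / 2 ^+ k < d.
Proof.
move=> d0; exists (Num.bound (`|L| / d)).
have := archi_boundP (divr_ge0 (normr_ge0 L) (ltW d0)).
set k := Num.bound _ => Hk; rewrite ltr_pdivrMr ?exprn_gt0// mulrC.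
rewrite -ltr_pdivrMr//; apply: (@le_lt_trans _ _ (`|L| / d)).
  by rewrite ler_pM2r ?invr_gt0// ler_norm.
by apply: lt_trans Hk _; rewrite -natrX ltr_nat ltn_expl.
Qed.

Definition often_large G (c : R) z u v :=
  forall N0, exists2 N, (N0 <= N)%N & c < cmod (boundary_sum G N z u v).

Lemma often_large_quarter G (c : R) z u v : often_large G (c *+ 4) z u v ->
  exists s t : bool, often_large G c (z + u / 2 * s%:R + v / 2 * t%:R) (u / 2) (v / 2).
Proof.
move=> H; apply: contrapT => nH.
have {nH}H' (s t : bool) : exists N0, forall N, (N0 <= N)%N ->
    cmod (boundary_sum G N (z + u / 2 * s%:R + v / 2 * t%:R) (u / 2) (v / 2)) <= c.
  apply: contrapT => nE; apply: nH; exists s, t => N0.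
  apply: contrapT => nE'; apply: nE; exists N0 => N N0N.
  by rewrite leNgt; apply/negP => HN; apply: nE'; exists N.
have [[N1 H1] [N2 H2]] := (H' false false, H' true false).
have [[N3 H3] [N4 H4]] := (H' false true, H' true true).
have [N] := H (maxn (maxn N1 N2) (maxn N3 N4)).+1.
case: N => // N; rewrite ltnS !geq_max => /andP[/andP[n1 n2] /andP[n3 n4]].
rewrite boundary_sumS ltNge => /negP; apply.
have := H1 _ n1; have := H2 _ n2; have := H3 _ n3; have := H4 _ n4.
rewrite !mulr0 !mulr1 !addr0 => h4 h3 h2 h1.
have -> : c *+ 4 = c + c + c + c by ring.
by do 3 (apply: le_trans (ler_cmodD _ _) _; rewrite lerD//).
Qed.

Section Chain.
Variables (G : C -> C) (z u v : C) (e : R).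

Definition subcorner (p : R * R) : C := z + u * p.1%:C + v * p.2%:C.

(** [p] gives the corner, in the coordinates of the sides [u] and [v], of a parallelogram
    of the [k]-th bisection whose boundary sums stay large. *)
Definition chain k (p : R * R) :=
  [/\ 0 <= p.1, p.1 + 2 ^- k <= 1, 0 <= p.2, p.2 + 2 ^- k <= 1 &
      often_large G (e / 4 ^+ k) (subcorner p) (u / 2 ^+ k) (v / 2 ^+ k)].

Definition chain_step k (p q : R * R) :=
  [/\ p.1 <= q.1, q.1 + 2 ^- k.+1 <= p.1 + 2 ^- k,
      p.2 <= q.2 & q.2 + 2 ^- k.+1 <= p.2 + 2 ^- k].

Lemma chain_next k p : chain k p -> exists2 q, chain k.+1 q & chain_step k p q.
Proof.
case=> p10 p11 p20 p21 H.
have D2 : (2 : R) != 0 by rewrite pnatr_eq0.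
have D4 : (4 : R) != 0 by rewrite pnatr_eq0.
have {}H : often_large G (e / 4 ^+ k.+1 *+ 4) (subcorner p) (u / 2 ^+ k) (v / 2 ^+ k).
  rewrite (_ : _ *+ 4 = e / 4 ^+ k)// -mulr_natr exprS; field.
  by rewrite ?expf_neq0.
have h0 : 0 < 2 ^- k.+1 :> R by rewrite invr_gt0 exprn_gt0.
have hE : 2 ^- k = 2 ^- k.+1 + 2 ^- k.+1 :> R.
  by rewrite exprS; field; rewrite ?expf_neq0.
have [s [t Hst]] := often_large_quarter H.
have bnd (b : bool) : 0 <= 2 ^- k.+1 * (b%:R : R) <= 2 ^- k.+1.
  by case: b; rewrite ?mulr1 ?mulr0 lexx ltW.
exists (p.1 + 2 ^- k.+1 * s%:R, p.2 + 2 ^- k.+1 * t%:R).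
  move: (bnd s) (bnd t); rewrite /chain_step /= => /andP[s0 s1] /andP[t0 t1].
  split=> /=; try lra.
  move: Hst; congr (often_large _ _ _ _ _).
  - rewrite /subcorner /= !rmorphD !rmorphM !fmorphV !rmorphXn /= !rmorph_nat.
    by rewrite exprS; field; rewrite ?expf_neq0 // pnatr_eq0.
  - by rewrite exprS; field; rewrite ?expf_neq0 // pnatr_eq0.
  - by rewrite exprS; field; rewrite ?expf_neq0 // pnatr_eq0.
move: (bnd s) (bnd t); rewrite /chain_step /= => /andP[s0 s1] /andP[t0 t1].
by split; lra.
Qed.

End Chain.

(** Bisection.  If the boundary sums exceeded [e] for arbitrarily fine subdivisions, then
    those of one of the four quarters would exceed [e / 4], and so on; but at the common
    point of the nested parallelograms [G] is affine up to a small multiple of the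
    diameter, which contradicts [boundary_sum_bound]. *)
Lemma goursat G z u v : (forall w, in_pgram z u v w -> cdiff G w) ->
  forall e : R, 0 < e ->
  exists N0, forall N, (N0 <= N)%N -> cmod (boundary_sum G N z u v) <= e.
Proof.
move=> dG e e0; apply: contrapT => nH.
have H0 : chain G z u v e 0 (0, 0).
  split; rewrite /= ?lexx// ?add0r ?expr0 ?invr1// /subcorner /=.
  rewrite rmorph0 !mulr1 !mulr0 !addr0 => N0; apply: contrapT => nN; apply: nH.
  exists N0 => N N0N; rewrite leNgt; apply/negP => HN; apply: nN.
  by exists N.
pose T := {kp : nat * (R * R) | chain G z u v e kp.1 kp.2}.
have [f [f0 fS]] : exists f : nat -> T, f 0 = exist _ (0, (0, 0)) H0 :> T /\
    forall n, (sval (f n.+1)).1 = (sval (f n)).1.+1 /\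
      chain_step (sval (f n)).1 (sval (f n)).2 (sval (f n.+1)).2.
  have step (x : T) : {y : T | (sval y).1 = (sval x).1.+1 /\
      chain_step (sval x).1 (sval x).2 (sval y).2}.
    apply: cid; case: x => -[k p] /= /chain_next[q qP pq].
    by exists (exist _ (k.+1, q) qP).
  exists (fun n => iter n (fun x => sval (step x)) (exist _ (0, (0, 0)) H0)).
  by split=> // n /=; case: (step _).
have fk n : (sval (f n)).1 = n by elim: n => [|n IH]; [rewrite f0|rewrite (fS n).1 IH].
pose p n := (sval (f n)).2.
have cp n : chain G z u v e n (p n) by have := svalP (f n); rewrite fk.
have sp n : chain_step n (p n) (p n.+1) by have := (fS n).2; rewrite fk.
have {}nested n m : (n <= m)%N -> [/\ (p n).1 <= (p m).1, (p m).1 + 2 ^- m <= (p n).1 + 2 ^- n,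
      (p n).2 <= (p m).2 & (p m).2 + 2 ^- m <= (p n).2 + 2 ^- n].
  elim: m => [|m IH]; first by rewrite leqn0 => /eqP->.
  rewrite leq_eqVlt => /orP[/eqP->//|]; rewrite ltnS => /IH[a1 a2 a3 a4].
  have [b1 b2 b3 b4] := sp m; split.
  - exact: le_trans b1.
  - exact: le_trans a2.
  - exact: le_trans b3.
  - exact: le_trans a4.
have pos n : 0 < 2 ^- n :> R by rewrite invr_gt0 exprn_gt0.
(* The suprema of the lower corners give a common point of the parallelograms. *)
have common (q : nat -> R) : (forall n m, (n <= m)%N -> q n <= q m /\ q m + 2 ^- m <= q n + 2 ^- n) ->
    exists s, forall n, q n <= s <= q n + 2 ^- n.
  move=> Hq; have Hnm n m : q n <= q m + 2 ^- m.
    case: (leqP n m) => [/Hq[h _]|/ltnW/Hq[_ h]].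
      by apply: le_trans h _; rewrite lerDl ltW.
    by apply: le_trans h; rewrite lerDl ltW.
  exists (sup (range q)) => n; apply/andP; split.
    by apply: ub_le_sup; [exists (q 0 + 2 ^- 0) => _ [m _ <-]|exists n].
  by apply: ge_sup; [exists (q 0%N), 0%N|move=> _ [m _ <-]].
have [s Hs] : exists s, forall n, (p n).1 <= s <= (p n).1 + 2 ^- n.
  by apply: (common (fun n => (p n).1)) => n m /nested[].
have [t Ht] : exists t, forall n, (p n).2 <= t <= (p n).2 + 2 ^- n.
  by apply: (common (fun n => (p n).2)) => n m /nested[].
pose w := z + u * s%:C + v * t%:C.
have [l [phi [cphi _ GE]]] : cdiff G w.
  apply: dG; exists s, t.
  have [a1 a2 a3 a4 _] := cp 0%N; move: (Hs 0%N) (Ht 0%N) => /andP[h1 h2] /andP[h3 h4].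
  split=> //; apply/andP; split; first [exact: le_trans h1|exact: le_trans h2 _|idtac].
    exact: le_trans h3.
  exact: le_trans h4 _.
pose L := cmod u + cmod v.
have L0 : 0 <= L by rewrite addr_ge0 ?cmod_ge0.
have eta0 : 0 < e / (L ^+ 2 *+ 2 + 1).
  by rewrite divr_gt0// ltr_wpDl// mulrn_wge0// exprn_ge0.
set eta := e / _ in eta0; have [d d0 Hd] := cphi _ eta0.
have [k Hk] := exists_halving_lt L d0.
have [_ _ _ _ /(_ 0%N)[N _]] := cp k; rewrite ltNge => /negP; apply.
apply: le_trans (@boundary_sum_bound G N _ _ _ (G w - phi w * w) (phi w)
  (eta * (L / 2 ^+ k)) _) _; last first.
  rewrite -mulr_natl !cmodM !cmodV cmodX cmod_nat -mulrDl -/L.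
  have -> : 4 ^+ k = 2 ^+ k * 2 ^+ k :> R by rewrite -exprMn; congr (_ ^+ _); ring.
  have D2 : 2 ^+ k != 0 :> R by rewrite expf_neq0// pnatr_eq0.
  have -> : 2 * (L / 2 ^+ k * (eta * (L / 2 ^+ k))) = L ^+ 2 *+ 2 * eta / (2 ^+ k * 2 ^+ k).
    by field.
  rewrite ler_pM2r ?invr_gt0 ?mulr_gt0 ?exprn_gt0// /eta.
  have D : 0 < L ^+ 2 *+ 2 + 1 by rewrite ltr_wpDl// mulrn_wge0// exprn_ge0.
  rewrite mulrCA ler_piMr//; first exact: ltW.
  by rewrite ler_pdivrMr// mul1r lerDl.
move=> x [a [b [a01 b01 xE]]].
have xw : cmod (x - w) <= L / 2 ^+ k.
  have -> : x - w = u * ((p k).1 + a / 2 ^+ k - s)%:C + v * ((p k).2 + b / 2 ^+ k - t)%:C.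
    rewrite xE /w /subcorner !rmorphB !rmorphD !rmorphM !fmorphV !rmorphXn /= !rmorph_nat; field.
    by rewrite expf_neq0// pnatr_eq0.
  rewrite /L mulrDl; apply: le_trans (ler_cmodD _ _) _; rewrite !cmodM.
  have key (q s0 a0 : R) : 0 <= a0 <= 1 -> q <= s0 <= q + 2 ^- k -> cmod (q + a0 / 2 ^+ k - s0)%:C <= (2 ^+ k)^-1.
    move=> /andP[a00 a01'] /andP[q1 q2]; rewrite cmod_real ler_norml.
    have h1 : a0 / 2 ^+ k <= 2 ^- k by rewrite ler_piMl// ltW.
    have h0 : 0 <= a0 / 2 ^+ k by rewrite mulr_ge0// ltW.
    by apply/andP; split; lra.
  by rewrite lerD// ler_wpM2l ?cmod_ge0// key.
rewrite GE (_ : _ - _ = (phi x - phi w) * (x - w)); last by ring.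
by rewrite cmodM ler_pM ?cmod_ge0// Hd// (le_lt_trans xw).
Qed.

End Goursat.

(** * The complex exponential *)

Section ComplexExp.
Variable R : realType.
Notation C := R[i].
Implicit Types (z w : C) (x y : R).

Definition cexp z : C :=
  (expR (complex.Re z))%:C * (cos (complex.Im z) +i* sin (complex.Im z)).

Lemma cexpD z w : cexp (z + w) = cexp z * cexp w.
Proof.
rewrite /cexp !raddfD /= expRD cosD sinD rmorphM /=.
rewrite mulrACA; congr (_ * _); apply/eqP; rewrite eq_complex /=; apply/andP; split; apply/eqP; ring.
Qed.

Lemma cexp0 : cexp 0 = 1.
Proof. by rewrite /cexp /= expR0 cos0 sin0 mul1r. Qed.

Lemma cexp_neq0 z : cexp z != 0.
Proof.
apply/negP => /eqP H; have := cexpD z (- z); rewrite subrr cexp0 H mul0r => /eqP.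
by rewrite oner_eq0.
Qed.

Lemma cmod_cexp z : cmod (cexp z) = expR (complex.Re z).
Proof.
rewrite /cexp cmodM cmod_real ger0_norm ?expR_ge0//.
rewrite -[RHS]mulr1; congr (_ * _); rewrite /cmod normc_def /=.
by rewrite cos2Dsin2 sqrtr1.
Qed.

Lemma cexp_period z : cexp (z + 0 +i* (pi *+ 2)) = cexp z.
Proof. by rewrite /cexp !raddfD /= addr0 cosD2pi sinD2pi. Qed.

(** The polar form of [z]. *)
Lemma cexp_surj z : z != 0 -> exists w, cexp w = z.
Proof.
move=> z0; have c0 : 0 < cmod z by rewrite cmod_gt0.
pose a := complex.Re z / cmod z; pose b := complex.Im z / cmod z.
have ab : a ^+ 2 + b ^+ 2 = 1.
  by rewrite /a /b !expr_div_n -mulrDl -sqr_cmodE divff// expf_neq0// lt0r_neq0.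
have a1 : -1 <= a <= 1.
  by rewrite -ler_norml -(@ler_pXn2r _ 2)// ?nnegrE// expr1n real_normK ?num_real// -ab lerDl sqr_ge0.
have [t [ct st]] : exists t, cos t = a /\ sin t = b.
  have s : Num.sqrt (1 - a ^+ 2) = `|b| by rewrite -ab addrAC subrr add0r sqrtr_sqr.
  have ca : cos (acos a) = a by rewrite acosK// itv_boundlr/= !bnd_simp.
  have [b0|b0] := leP 0 b.
    by exists (acos a); rewrite sin_acos// s ger0_norm.
  by exists (- acos a); rewrite cosN sinN sin_acos// s ltr0_norm// opprK.
exists (ln (cmod z) +i* t); rewrite /cexp /= lnK ?posrE// ct st.
rewrite /a /b; case: z z0 c0 {a b ab a1 ct st} => u v z0 c0 /=.
apply/eqP; rewrite eq_complex /= !mul0r subr0 addr0.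
by rewrite !(mulrC (cmod _)) !divfK ?eqxx ?lt0r_neq0.
Qed.

Lemma is_derive_real (f : R -> R) x l : is_derive x 1 f l ->
  forall e : R, 0 < e -> exists2 d : R, 0 < d & forall h, `|h| < d ->
    `|f (x + h) - f x - l * h| <= e * `|h|.
Proof.
move=> [df dl] e e0.
have : h^-1 *: ((f \o shift x) (h *: 1) - f x) @[h --> 0^'] --> l.
  by rewrite -dl; exact: df.
move/cvgrPdist_le => /(_ e e0) [d /= d0 Hd]; exists d => // h hd.
have [->|h0] := eqVneq h 0; first by rewrite !addr0 mulr0 subr0 subrr normr0 mulr0.
have := Hd h; rewrite /ball_/= sub0r normrN => /(_ hd h0).
rewrite -ler_pdivrMr ?normr_gt0// -normfV -normrM distrC; congr (`| _ | <= _).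
by rewrite /GRing.scale/= mulr1 [h + x]addrC mulrBl -mulrA divff// mulr1 mulrC.
Qed.

Lemma cderiv_cexp0 : cderiv cexp 0 1.
Proof.
apply/cderivP/is_deriveP => e e0; pose e' := Num.min 1 (e / 6).
have e'0 : 0 < e' by rewrite lt_min ltr01 divr_gt0.
have [d1 d10 H1] := is_derive_real (is_derive_expR 0) e'0.
have [d2 d20 H2] := is_derive_real (is_derive_cos 0) e'0.
have [d3 d30 H3] := is_derive_real (is_derive_sin 0) e'0.
exists (Num.min (e' / 2) (Num.min d1 (Num.min d2 d3))).
  by rewrite !lt_min d10 d20 d30 divr_gt0.
move=> h; rewrite !lt_min => /and4P[h0 h1 h2 h3].
have hx := ler_norm_Re h.
have hy : `|complex.Im h| <= cmod h.
  rewrite -(@ler_pXn2r _ 2)// ?nnegrE ?cmod_ge0// real_normK ?num_real// sqr_cmodE.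
  by rewrite lerDr sqr_ge0.
rewrite add0r cexp0 mul1r; set x := complex.Re h in hx *; set y := complex.Im h in hy *.
have := H1 _ (le_lt_trans hx h1); rewrite add0r expR0 mul1r => {}H1.
have := H2 _ (le_lt_trans hy h2); rewrite add0r cos0 sin0 oppr0 mul0r subr0 => {}H2.
have := H3 _ (le_lt_trans hy h3); rewrite add0r sin0 cos0 mul1r subr0 => {}H3.
have -> : cexp h - 1 - h = (expR x)%:C * (cos y - 1)%:C
    + 'i%C * (expR x)%:C * (sin y - y)%:C + (expR x - 1 - x)%:C + 'i%C * (expR x - 1)%:C * y%:C.
  rewrite /cexp -/x -/y [X in _ - X](complexE h) -/x -/y (complexE (cos y +i* sin y)) /=.
  by rewrite !rmorphB /= !rmorph1; ring.
have e6 : e' * 6 <= e by rewrite -ler_pdivlMr// ge_min lexx orbT.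
have e1 : e' <= 1 by rewrite ge_min lexx.
have ex1 : `|expR x - 1| <= e'.
  rewrite -[expR x - 1](subrK x); apply: le_trans (ler_normD _ _) _.
  have : e' * `|x| <= `|x| by rewrite ler_piMl.
  by move: H1 hx h0; lra.
have ex2 : `|expR x| <= 2.
  by rewrite -[expR x](subrK 1); apply: le_trans (ler_normD _ _) _; rewrite normr1; lra.
have ci : cmod ('i%C : C) = 1 by rewrite /cmod normc_def /= expr0n expr1n add0r sqrtr1.
have c0 := cmod_ge0 h.
have b1 : e' * `|y| <= e' * cmod h by rewrite ler_pM2l.
have b2 : e' * `|x| <= e' * cmod h by rewrite ler_pM2l.
have t1 : cmod ((expR x)%:C * (cos y - 1)%:C) <= 2 * (e' * cmod h).
  by rewrite cmodM !cmod_real ler_pM// (le_trans H2).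
have t2 : cmod ('i%C * (expR x)%:C * (sin y - y)%:C) <= 2 * (e' * cmod h).
  by rewrite !cmodM ci mul1r !cmod_real ler_pM// (le_trans H3).
have t3 : cmod (expR x - 1 - x)%:C <= e' * cmod h.
  by rewrite cmod_real (le_trans H1).
have t4 : cmod ('i%C * (expR x - 1)%:C * y%:C) <= e' * cmod h.
  by rewrite !cmodM ci mul1r !cmod_real ler_pM.
apply: (@le_trans _ _ (e' * 6 * cmod h)); last by rewrite ler_wpM2r.
have -> : e' * 6 * cmod h = 2 * (e' * cmod h) + 2 * (e' * cmod h) + e' * cmod h + e' * cmod h by ring.
by do 3 (apply: le_trans (ler_cmodD _ _) _; rewrite lerD//).
Qed.

(** By the addition formula, from the derivative at 0. *)
Lemma cdiff_cexp z : cdiff cexp z.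
Proof.
exists (cexp z); have [phi [cphi p0 E]] := cderiv_cexp0.
exists (fun w => cexp z * phi (w - z)); split.
- apply: ccontM; first exact: ccont_cst.
  apply: (@ccont_comp _ (fun w => w - z)); last by rewrite subrr.
  by apply: ccontD; [exact: ccont_id|exact: ccont_cst].
- by rewrite subrr p0 mulr1.
move=> w; rewrite -{1}(subrKC z w) cexpD [cexp (w - z)]E cexp0 subr0; ring.
Qed.

End ComplexExp.

(** * The maximum principle *)

Section MaximumPrinciple.
Variable R : realType.
Notation C := R[i].
Implicit Types (f : C -> C) (z w a : C).

(** The mean-value inequality.  In the coordinate [w], with [z = exp w], an annulus
    around 0 becomes a rectangle; the boundary sums along its two horizontal sides
    cancel by periodicity, so that the mean of [f] over the outer circle is that over
    the inner one, which is nearly [f 0]. *)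
Lemma center_le_circle f (rho M : R) : 0 < rho ->
  (forall z, cmod z <= rho -> cdiff f z) ->
  (forall z, cmod z = rho -> cmod (f z) <= M) -> cmod (f 0) <= M.
Proof.
move=> rho0 df fM; apply/ler_addgt0Pr => e e0.
have e2 : 0 < e / 2 by rewrite divr_gt0.
have [d d0 Hd] := cdiff_cont (df 0 (eq_ind_r (fun x => x <= rho) (ltW rho0) (cmod0 R))) e2.
pose r := Num.min rho (d / 2).
have r0 : 0 < r by rewrite lt_min rho0 divr_gt0.
have rd : r < d.
  by rewrite gt_min ltr_pdivrMr// ltr_pMr// ltr1n orbT.
have rrho : r <= rho by rewrite ge_min lexx.
pose x1 := ln r; pose x2 := ln rho.
have x12 : x1 <= x2 by rewrite ler_ln ?posrE.
pose v : C := 0 +i* (pi *+ 2); pose u : C := (x2 - x1)%:C; pose z : C := x1%:C.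
pose G w := f (cexp w).
have Rez (s t : R) : complex.Re (z + u * s%:C + v * t%:C) = x1 + (x2 - x1) * s.
  by rewrite !raddfD /= !mul0r mulr0 !subr0 addr0.
have piP : 0 < pi :> R := pi_gt0 R.
have cv : cmod v = pi *+ 2.
  by rewrite /v /cmod normc_def /= expr0n add0r sqrtr_sqr ger0_norm// mulrn_wge0// ltW.
have dG w : in_pgram z u v w -> cdiff G w.
  move=> [s [t [/andP[s0 s1] _ ->]]]; apply: cdiff_comp; first exact: cdiff_cexp.
  apply: df; rewrite cmod_cexp Rez -[leRHS](@lnK _ rho) ?posrE// ler_expR -/x2.
  by rewrite -lerBrDl ler_piMr// subr_ge0.
have pe : 0 < pi * e by rewrite mulr_gt0.
have [N /(_ N (leqnn N))] := goursat dG pe.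
have -> : boundary_sum G N z u v = riemann_sum G N (z + u) v - riemann_sum G N z v.
  rewrite /boundary_sum (_ : riemann_sum G N (z + v) u = riemann_sum G N z u); first by ring.
  rewrite /riemann_sum; congr (_ * _); apply: eq_bigr => k _; congr f.
  by rewrite addrAC cexp_period.
have B2 : cmod (riemann_sum G N (z + u) v) <= cmod v * M.
  apply: riemann_sum_bound => t _; apply: fM; rewrite cmod_cexp.
  have := Rez 1 t; rewrite rmorph1 !mulr1 => ->.
  by rewrite subrKC lnK.
have B1 : cmod (riemann_sum (fun w => G w - f 0) N z v) <= cmod v * (e / 2).
  apply: riemann_sum_bound => t _; apply: Hd; rewrite subr0 cmod_cexp.
  by have := Rez 0 t; rewrite rmorph0 !mulr0 !addr0 => ->; rewrite lnK.
move: B1; rewrite riemann_sumB.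
have -> : riemann_sum (fun=> f 0) N z v = v * f 0.
  have := riemann_sum_affine N z v (f 0) 0; rewrite !mul0r !addr0 => <-.
  by rewrite /riemann_sum; congr (_ * _); apply: eq_bigr => k _; rewrite mul0r addr0.
set S2 := riemann_sum _ _ (z + u) _ in B2 *; set S1 := riemann_sum _ _ _ _.
move=> B1 B3; have : cmod (v * f 0) <= cmod v * M + cmod v * (e / 2) + pi * e.
  have -> : v * f 0 = S2 - (S1 - v * f 0) - (S2 - S1) by ring.
  apply: le_trans (ler_cmodB _ _) _; rewrite lerD//.
  by apply: le_trans (ler_cmodB _ _) _; rewrite lerD.
rewrite cmodM cv.
have -> : pi *+ 2 * M + pi *+ 2 * (e / 2) + pi * e = pi *+ 2 * (M + e) by field.
by rewrite ler_pM2l// mulrn_wgt0.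
Qed.

(** Otherwise [(x / y) ^ N] would be unbounded, by Bernoulli's inequality. *)
Lemma ler_of_power_bound (c K x y : R) : 0 < c -> 0 <= x -> 0 <= y ->
  (forall N, c * x ^+ N.+1 <= K * y ^+ N.+1) -> x <= y.
Proof.
move=> c0 x0 y0 H; rewrite leNgt; apply/negP => yx.
have [y0'|yN0] := eqVneq y 0.
  have := H 0%N; rewrite y0' !expr1 mulr0 leNgt => /negP; apply.
  by rewrite mulr_gt0// (le_lt_trans y0).
have yp : 0 < y by rewrite lt_neqAle eq_sym yN0.
pose t := x / y - 1; have t0 : 0 < t by rewrite subr_gt0 ltr_pdivlMr// mul1r.
have bern N : 1 + t *+ N <= (x / y) ^+ N.
  have -> : x / y = 1 + t by rewrite /t subrKC.
  elim: N => [|N IH]; first by rewrite mulr0n addr0 expr0.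
  rewrite exprS; apply: le_trans (_ : (1 + t) * (1 + t *+ N) <= _); last first.
    by rewrite ler_pM2l// ltr_wpDl.
  rewrite mulrDl mul1r mulrDr mulr1 -addrA mulrS lerD2l addrC lerD2l lerDl.
  by rewrite mulr_ge0 ?mulrn_wge0 ?ltW.
have HK N : 1 + t *+ N.+1 <= K / c.
  apply: le_trans (bern _) _; rewrite expr_div_n ler_pdivrMr ?exprn_gt0//.
  by rewrite mulrAC ler_pdivlMr// mulrC.
have K0 : 0 <= K / c by apply: le_trans (HK 0%N); rewrite addr_ge0// mulrn_wge0// ltW.
have := archi_boundP (divr_ge0 K0 (ltW t0)); rewrite ltr_pdivrMr//.
move: (Num.bound _) => k h; have := HK k; rewrite leNgt => /negP; apply.
apply: lt_le_trans h _; rewrite mulr_natl mulrSr addrCA lerDl.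
by rewrite addr_ge0// ltW.
Qed.

(** This automorphism of the disc, which takes 0 to [a], is used up to the boundary. *)
Lemma cmod_mobius_le1 a w : cmod a < 1 -> cmod w <= 1 ->
  1 + a^* * w != 0 /\ cmod ((w + a) / (1 + a^* * w)) <= 1.
Proof.
move=> a1 w1; have D : 1 + a^* * w != 0.
  rewrite -cmod_gt0; have := ler_cmod_dist 1 (- (a^* * w)).
  rewrite opprK cmod1 cmodN cmodM cmod_conj; apply: lt_le_trans.
  by rewrite subr_gt0; apply: le_lt_trans a1; rewrite ler_piMr ?cmod_ge0.
split=> //; rewrite cmodM cmodV ler_pdivrMr ?cmod_gt0// mul1r.
rewrite -(@ler_pXn2r _ 2)// ?nnegrE ?cmod_ge0// -lecR !sqr_cmod -subr_ge0.
rewrite !rmorphD !rmorphM rmorph1 /= conjCK.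
have -> : (1 + a^* * w) * (1 + a * w^*) - (w + a) * (w^* + a^*) =
  (1 - a * a^*) * (1 - w * w^*) by ring.
rewrite -!sqr_cmod -(rmorph1 (real_complex R)) -!rmorphB /= -rmorphM ler0c.
by rewrite mulr_ge0// subr_ge0 expr_le1 ?cmod_ge0// ltW.
Qed.

Lemma cmod_mobius_eq1 a w : cmod a < 1 -> cmod w = 1 ->
  cmod ((w + a) / (1 + a^* * w)) = 1.
Proof.
move=> a1 w1; have w1' : cmod w <= 1 by rewrite w1.
have [D _] := cmod_mobius_le1 a1 w1'.
rewrite cmodM cmodV; apply/eqP; rewrite -(inj_eq (mulIf (_ : cmod (1 + a^* * w) != 0))) ?cmod_eq0//.
rewrite divfK ?cmod_eq0// mul1r -(@eqrXn2 _ 2)// ?cmod_ge0// -(inj_eq (@complexI _)).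
rewrite !sqr_cmod -subr_eq0 !rmorphD !rmorphM rmorph1 /= conjCK.
have -> : (w + a) * (w^* + a^*) - (1 + a^* * w) * (1 + a * w^*)  =
  (1 - a * a^*) * (w * w^* - 1) by ring.
by rewrite -!sqr_cmod w1 expr1n rmorph1 subrr mulr0.
Qed.

(** The product [q] of the [(z - s) ^ 2] for [s] in [S] makes [q f ^ N] differentiable
    on the whole disc.  The mean-value inequality for it, recentred at [a], is a bound for
    [|q a| |f a| ^ N]; letting [N] tend to infinity removes [q]. *)
Lemma max_principle f (S : seq C) (rho M : R) a : 0 < rho -> 0 <= M ->
  (forall s, s \in S -> exists d K : R, 0 < d /\
     forall w, cmod (w - s) < d -> w \notin S -> cmod (f w) <= K) ->
  (forall z, cmod z <= rho -> z \notin S -> cdiff f z) ->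
  (forall z, cmod z = rho -> z \notin S -> cmod (f z) <= M) ->
  cmod a < rho -> a \notin S -> cmod (f a) <= M.
Proof.
move=> rho0 M0 bS df fM arho aS.
pose q z := \prod_(s <- S) (z - s) ^+ 2.
have q0 z : (q z == 0) = (z \in S).
  rewrite /q prodf_seq_eq0; apply/hasP/idP => [[s sS]|zS]; last by exists z; rewrite //= subrr expr0n.
  by rewrite /= expf_eq0 /= subr_eq0 => /eqP->.
have dq z : cdiff q z.
  apply: (@cdiff_prod _ _ S xpredT (fun s z => (z - s) ^+ 2)) => s _; apply: cdiffX.
  by apply: cdiffB; [exact: cdiff_id|exact: cdiff_cst].
pose B := \prod_(s <- S) (rho + cmod s) ^+ 2.
have qB z : cmod z <= rho -> cmod (q z) <= B.
  move=> zrho; rewrite /q /B; elim: (S) => [|s S' IH]; first by rewrite !big_nil cmod1.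
  rewrite !big_cons cmodM cmodX; apply: ler_pM; rewrite ?cmod_ge0 ?exprn_ge0 ?cmod_ge0//.
  rewrite lerXn2r ?nnegrE ?cmod_ge0 ?addr_ge0 ?cmod_ge0 ?(ltW rho0)//.
  by apply: le_trans (ler_cmodB _ _) _; rewrite lerD2r.
apply: (@ler_of_power_bound (cmod (q a)) B) => //; rewrite ?cmod_ge0 ?cmod_gt0 ?q0// => N.
pose F z := q z * f z ^+ N.+1.
have dF z : cmod z <= rho -> cdiff F z.
  move=> zrho; have [zS|zS] := boolP (z \in S); last first.
    by apply: cdiffM; [exact: dq|apply: cdiffX; exact: df].
  have [d [K [d0 HK]]] := bS _ zS.
  pose p w := \prod_(s <- rem z S) (w - s) ^+ 2.
  have qE w : q w = (w - z) ^+ 2 * p w by rewrite /q (perm_big _ (perm_to_rem zS)) big_cons.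
  have [dp dp0 Hp] : exists2 d : R, 0 < d & forall w, cmod (w - z) < d -> cmod (p w) <= cmod (p z) + 1.
    apply: ccont_bnd; apply: cdiff_cont.
    apply: (@cdiff_prod _ _ (rem z S) xpredT (fun s z => (z - s) ^+ 2)) => s _; apply: cdiffX.
    by apply: cdiffB; [exact: cdiff_id|exact: cdiff_cst].
  exists 0; exists (fun w => (w - z) * p w * f w ^+ N.+1 * (w \notin S)%:R); split; last first.
  - move=> w; rewrite /F qE.
    have -> : q z = 0 by apply/eqP; rewrite q0.
    have [wS|wS] := boolP (w \in S); last by rewrite /= mulr1; ring.
    by rewrite -qE (_ : q w = 0) ?mul0r ?mulr0 ?mul0r ?addr0//; apply/eqP; rewrite q0.
  - by rewrite subrr !mul0r.
  move=> e e0; pose L := (cmod (p z) + 1) * (`|K| + 1) ^+ N.+1.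
  have L0 : 0 < L by rewrite mulr_gt0 ?exprn_gt0 ?ltr_wpDl ?cmod_ge0.
  exists (Num.min d (Num.min dp (e / L))); first by rewrite !lt_min d0 dp0 divr_gt0.
  move=> w; rewrite !lt_min => /and3P[wd wp we].
  rewrite subrr !mul0r subr0.
  have [wS|wS] := boolP (w \in S); first by rewrite mulr0 cmod0 ltW.
  rewrite mulr1 -mulrA cmodM; move: we; rewrite ltr_pdivlMr// => /ltW; apply: le_trans.
  rewrite ler_wpM2l ?cmod_ge0// cmodM cmodX ler_pM ?exprn_ge0 ?cmod_ge0 ?Hp//.
  rewrite lerXn2r ?nnegrE ?cmod_ge0 ?addr_ge0 ?cmod_ge0//.
  by apply: le_trans (HK _ wd wS) _; apply: le_trans (ler_norm _) _; rewrite lerDl.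
have FM z : cmod z = rho -> cmod (F z) <= B * M ^+ N.+1.
  move=> zrho; rewrite /F cmodM cmodX.
  have [zS|zS] := boolP (z \in S).
    have /eqP-> : q z == 0 by rewrite q0.
    rewrite cmod0 mul0r mulr_ge0 ?exprn_ge0//.
    by apply: le_trans (qB z _); rewrite ?cmod_ge0 ?zrho.
  by rewrite ler_pM ?exprn_ge0 ?cmod_ge0 ?qB ?zrho// lerXn2r ?nnegrE ?cmod_ge0// fM.
(* The automorphism phi of the disc of radius rho takes 0 to a. *)
pose b := a / rho%:C.
have b1 : cmod b < 1 by rewrite /b cmodM cmodV cmod_real gtr0_norm// ltr_pdivrMr// mul1r.
pose phi w := rho%:C * ((w + b) / (1 + b^* * w)).
have phib w : cmod w <= 1 -> cmod (phi w) <= rho.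
  move=> w1; rewrite /phi cmodM cmod_real gtr0_norm// ler_piMr ?(ltW rho0)//.
  by have [] := cmod_mobius_le1 b1 w1.
have := @center_le_circle (fun w => F (phi w)) 1 (B * M ^+ N.+1) ltr01.
rewrite /phi add0r mulr0 addr0 divr1 /b [rho%:C * _]mulrC divfK; last first.
  by rewrite (inj_eq (@complexI _) _ 0) lt0r_neq0.
rewrite -/b /F cmodM cmodX; apply.
  move=> w w1; have [D _] := cmod_mobius_le1 b1 w1.
  apply: (@cdiff_comp _ phi F); last exact/dF/phib.
  apply: cdiffM; first exact: cdiff_cst.
  apply: cdiffM; first by apply: cdiffD; [exact: cdiff_id|exact: cdiff_cst].
  apply: cdiffV => //; apply: cdiffD; first exact: cdiff_cst.
  by apply: cdiffM; [exact: cdiff_cst|exact: cdiff_id].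
move=> w w1; apply: FM; rewrite cmodM cmod_real gtr0_norm// cmod_mobius_eq1// mulr1.
done.
Qed.

End MaximumPrinciple.

(** * The Schwarz lemma and Cauchy estimates *)

Section Schwarz.
Variable R : realType.
Notation C := R[i].
Implicit Types (f h : C -> C) (z w a l : C) (M : R).

Lemma bernoulli (t : R) k : 0 <= t <= 1 -> 1 - t *+ k <= (1 - t) ^+ k.
Proof.
move=> /andP[t0 t1]; elim: k => [|k IH]; first by rewrite mulr0n subr0 expr0.
have t1' : 0 <= 1 - t by rewrite subr_ge0.
rewrite exprS; apply: le_trans (ler_wpM2l t1' IH).
rewrite mulrSr mulrBl mul1r mulrBr mulr1 opprD addrA opprB lerD2l lerDr.
by rewrite mulr_ge0// mulrn_wge0.
Qed.

(** Let [rho] tend to 1. *)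
Lemma ler_of_radius_bound (x y r : R) k : 0 <= y -> r < 1 ->
  (forall rho, r < rho -> 0 < rho -> rho < 1 -> rho ^+ k * x <= y) -> x <= y.
Proof.
move=> y0 r1 H; have [x0|x0] := leP x 0; first exact: le_trans y0.
rewrite leNgt; apply/negP => yx.
have yx1 : 0 < 1 - y / x by rewrite subr_gt0 ltr_pdivrMr// mul1r.
pose t := Num.min (1 / 2) (Num.min ((1 - r) / 2) ((1 - y / x) / k.+1%:R)).
have t0 : 0 < t by rewrite !lt_min !divr_gt0// subr_gt0.
have t1 : t < 1 by rewrite gt_min; apply/orP; left; lra.
have := H (1 - t); rewrite !subr_gt0 ltrBlDr ltrDl => /(_ _ t1 t0).
have -> : r < 1 - t.
  rewrite ltrBrDr addrC -ltrBrDr gt_min; apply/orP; right.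
  by rewrite gt_min; apply/orP; left; lra.
move=> /(_ isT) h.
have b : 1 - t *+ k <= (1 - t) ^+ k by apply: bernoulli; rewrite !ltW.
have tk : t *+ k < 1 - y / x.
  have : t * k.+1%:R <= 1 - y / x.
    rewrite -ler_pdivlMr// ge_min; apply/orP; right.
    by rewrite ge_min lexx orbT.
  by apply: lt_le_trans; rewrite mulr_natr mulrSr ltrDl.
have : y / x < (1 - t) ^+ k by move: b tk; lra.
by rewrite ltr_pdivrMr// ltNge h.
Qed.

(** The maximum principle on the discs of radius [rho < 1] gives the bound
    [M / rho ^ k]; the power of [|z|] in the hypothesis disappears as [rho] tends to 1. *)
Lemma max_principle_punctured h k M a : 0 <= M ->
  (forall z, cmod z < 1 -> z != 0 -> cdiff h z) ->
  (exists d K : R, 0 < d /\ forall z, cmod z < d -> z != 0 -> cmod (h z) <= K) ->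
  (forall z, cmod z < 1 -> z != 0 -> cmod z ^+ k * cmod (h z) <= M) ->
  cmod a < 1 -> a != 0 -> cmod (h a) <= M.
Proof.
move=> M0 dh [d [K [d0 HK]]] hM a1 a0.
apply: (@ler_of_radius_bound _ _ (cmod a) k) => // rho arho rho0 rho1.
rewrite mulrC -ler_pdivlMr ?exprn_gt0//.
apply: (@max_principle _ h [:: 0] rho) => //.
- by rewrite divr_ge0// exprn_ge0// ltW.
- move=> s; rewrite inE => /eqP->; exists d, K; split=> // w.
  by rewrite subr0 inE; exact: HK.
- by move=> z zrho; rewrite inE; apply: dh; apply: le_lt_trans rho1.
- move=> z zrho; rewrite inE => z0; rewrite ler_pdivlMr ?exprn_gt0// mulrC -zrho.
  by apply: hM => //; rewrite zrho.
- by rewrite inE.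
Qed.

Lemma cdiff_div_id f k z : z != 0 -> cdiff f z -> cdiff (fun w => f w / w ^+ k) z.
Proof.
move=> z0 df; apply: cdiffM => //; apply: cdiffV; first by rewrite expf_neq0.
by apply: cdiffX; exact: cdiff_id.
Qed.

Lemma div_id_bounded f : cdiff f 0 -> f 0 = 0 ->
  exists d K : R, 0 < d /\ forall z, cmod z < d -> z != 0 -> cmod (f z / z) <= K.
Proof.
move=> [l [phi [cphi _ fE]]] f0; have [d d0 Hd] := ccont_bnd cphi.
exists d, (cmod (phi 0) + 1); split=> // z zd z0.
by rewrite fE f0 add0r subr0 mulfK// Hd// subr0.
Qed.

Lemma schwarz f M a : 0 <= M -> (forall z, cmod z < 1 -> cdiff f z) -> f 0 = 0 ->
  (forall z, cmod z < 1 -> cmod (f z) <= M) ->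
  cmod a < 1 -> cmod (f a) <= M * cmod a.
Proof.
move=> M0 df f0 fM a1; have [->|a0] := eqVneq a 0; first by rewrite f0 cmod0 mulr0.
rewrite -ler_pdivrMr ?cmod_gt0// -cmodV -cmodM.
apply: (@max_principle_punctured (fun z => f z / z) 1) => //.
- by move=> z z1 z0; apply: (@cdiff_div_id _ 1) => //; exact: df.
- by apply: div_id_bounded => //; apply: df; rewrite cmod0.
- by move=> z z1 z0; rewrite expr1 -cmodM mulrCA divff// mulr1 fM.
Qed.

(** The maximum principle for [(h z - h a) / (z - a)] on the disc of radius 3 / 4: on
    its boundary the denominator has modulus at least 1 / 4. *)
Lemma lipschitz_half_disc h M a w : 0 <= M ->
  (forall z, cmod z < 1 -> z != 0 -> cdiff h z) ->
  (forall z, cmod z < 1 -> z != 0 -> cmod (h z) <= M) ->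
  a != 0 -> w != 0 -> cmod a <= 1 / 2 -> cmod w <= 1 / 2 ->
  cmod (h w - h a) <= 8 * M * cmod (w - a).
Proof.
move=> M0 dh hM a0 w0 a2 w2.
have [->|wa] := eqVneq w a; first by rewrite !subrr cmod0 mulr0.
have wa' : w - a != 0 by rewrite subr_eq0.
rewrite -ler_pdivrMr ?cmod_gt0// -cmodV -cmodM.
apply: (@max_principle _ (fun z => (h z - h a) / (z - a)) [:: 0; a] (3 / 4)) => //.
- by rewrite mulr_ge0.
- move=> s; rewrite !inE => /orP[/eqP->|/eqP->].
    have a4 : 0 < cmod a / 2 by rewrite divr_gt0// cmod_gt0.
    exists (cmod a / 2), ((M + M) / (cmod a / 2)); split=> //.
    move=> z; rewrite subr0 !inE negb_or => za /andP[z0 zna].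
    rewrite cmodM cmodV ler_pM ?invr_ge0 ?cmod_ge0//.
      apply: le_trans (ler_cmodB _ _) _; rewrite lerD// hM//; first by apply: lt_le_trans za _; lra.
      by apply: le_lt_trans a2 _; lra.
    rewrite lef_pV2 ?posrE ?cmod_gt0 ?subr_eq0// cmodBC.
    by have := ler_cmod_dist a z; move: za; lra.
  have [l [phi [cphi _ hE]]] : cdiff h a by apply: dh => //; lra.
  have [d d0 Hd] := ccont_bnd cphi; exists d, (cmod (phi a) + 1); split=> // z zd.
  rewrite !inE negb_or => /andP[z0 za].
  by rewrite hE addrAC subrr add0r mulfK ?subr_eq0// Hd.
- move=> z z34; rewrite !inE negb_or => /andP[z0 za].
  apply: cdiffM; first by apply: cdiffB; [apply: dh => //; lra|exact: cdiff_cst].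
  by apply: cdiffV; rewrite ?subr_eq0//; apply: cdiffB; [exact: cdiff_id|exact: cdiff_cst].
- move=> z z34; rewrite !inE negb_or => /andP[z0 za].
  rewrite cmodM cmodV ler_pdivrMr ?cmod_gt0 ?subr_eq0//.
  have h1 : cmod (h z - h a) <= M + M.
    by apply: le_trans (ler_cmodB _ _) _; rewrite lerD// hM//; lra.
  have := ler_cmod_dist z a; rewrite z34 => h2.
  have h3 : 1 / 4 <= cmod (z - a) by lra.
  by have := ler_wpM2l M0 h3; lra.
- by lra.
- by rewrite !inE negb_or w0.
Qed.

Lemma cderiv_le_lipschitz h a l (K d : R) : 0 < d ->
  (forall w, cmod (w - a) < d -> cmod (h w - h a) <= K * cmod (w - a)) ->
  cderiv h a l -> cmod l <= K.
Proof.
move=> d0 H [phi [cphi <- hE]]; apply/ler_addgt0Pr => e e0.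
have [d' d'0 Hd'] := cphi e e0.
pose t := Num.min d d' / 2; have t0 : 0 < t by rewrite divr_gt0// lt_min d0.
have [td td'] : t < d /\ t < d'.
  have m0 : 0 < Num.min d d' by rewrite lt_min d0.
  have : t < Num.min d d' by rewrite ltr_pdivrMr// ltr_pMr// ltr1n.
  by rewrite lt_min => /andP[].
pose w := a + t%:C; have wa : cmod (w - a) = t.
  by rewrite /w addrC addKr cmod_real gtr0_norm.
have := H w; have := Hd' w; rewrite wa => /(_ td') h1 /(_ td).
rewrite hE addrAC subrr add0r cmodM wa ler_pM2r// => h2.
by have := ler_cmod_dist (phi a) (phi w); rewrite cmodBC; lra.
Qed.

Lemma deriv_bound_half_disc h M a l : 0 <= M ->
  (forall z, cmod z < 1 -> z != 0 -> cdiff h z) ->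
  (forall z, cmod z < 1 -> z != 0 -> cmod (h z) <= M) ->
  a != 0 -> cmod a < 1 / 2 -> cderiv h a l -> cmod l <= 8 * M.
Proof.
move=> M0 dh hM a0 a2.
apply: (@cderiv_le_lipschitz _ _ _ _ (Num.min (cmod a) (1 / 2 - cmod a))).
  by rewrite lt_min cmod_gt0 a0/= subr_gt0.
move=> w; rewrite lt_min => /andP[w1 w2].
have := ler_cmod_dist a w; have := ler_cmod_dist w a; rewrite [cmod (a - w)]cmodBC => h1 h2.
apply: lipschitz_half_disc => //; first by rewrite -cmod_gt0; lra.
  exact: ltW.
lra.
Qed.

Lemma cderiv_div_id f a l : a != 0 -> cderiv f a l ->
  cderiv (fun w => f w / w) a ((a * l - f a) / a ^+ 2).
Proof.
move=> a0 df; have := cderivM df (cderivV a0 (cderiv_id a)).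
by rewrite (_ : _ + _ = (a * l - f a) / a ^+ 2)//; field.
Qed.

Lemma holo_div_id f M : 0 <= M -> (forall z, cmod z < 1 -> cdiff f z) -> f 0 = 0 ->
  (forall z, cmod z < 1 -> cmod (f z) <= M) ->
  (forall z, cmod z < 1 -> z != 0 -> cdiff (fun w => f w / w) z) /\
  (forall z, cmod z < 1 -> z != 0 -> cmod (f z / z) <= M).
Proof.
move=> M0 df f0 fM; split=> z z1 z0; first by apply: (@cdiff_div_id _ 1) => //; exact: df.
by rewrite cmodM cmodV ler_pdivrMr ?cmod_gt0//; exact: schwarz.
Qed.

(** [a l - f a] is [a ^ 2] times the derivative at [a] of [f z / z], which is bounded by
    [M] like [f]. *)
Lemma deriv_at_simple_zero f M a l : 0 <= M ->
  (forall z, cmod z < 1 -> cdiff f z) -> f 0 = 0 ->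
  (forall z, cmod z < 1 -> cmod (f z) <= M) ->
  a != 0 -> cmod a < 1 / 2 -> cderiv f a l ->
  cmod (a * l - f a) <= 8 * M * cmod a ^+ 2.
Proof.
move=> M0 df f0 fM a0 a2 /(cderiv_div_id a0) dh.
have [dh1 hM] := holo_div_id M0 df f0 fM.
have := deriv_bound_half_disc M0 dh1 hM a0 a2 dh.
by rewrite cmodM cmodV cmodX ler_pdivrMr// exprn_gt0// cmod_gt0.
Qed.

(** [a l - 2 f a] is [a ^ 3] times the derivative at [a] of [f z / z ^ 2]; the bound for
    this function comes from the Lipschitz estimate for [f z / z]. *)
Lemma deriv_at_double_zero f M a l : 0 <= M ->
  (forall z, cmod z < 1 -> cdiff f z) -> f 0 = 0 -> cderiv f 0 0 ->
  (forall z, cmod z < 1 -> cmod (f z) <= M) ->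
  a != 0 -> cmod a < 1 / 4 -> cderiv f a l ->
  cmod (a * l - 2 * f a) <= 128 * M * cmod a ^+ 3.
Proof.
move=> M0 df f0 f0' fM a0 a4 dfa.
have [dh1 hM] := holo_div_id M0 df f0 fM.
(* f z / z tends to f'(0) = 0, so the Lipschitz bound gives |f z / z| <= 8 M |z|. *)
have f2 z : cmod z <= 1 / 2 -> z != 0 -> cmod (f z / z) <= 8 * M * cmod z.
  move=> z2 z0; apply/ler_addgt0Pr => e e0.
  case: f0' => phi [cphi p0 fE].
  have e2 : 0 < e / (8 * M + 1) by rewrite divr_gt0// ltr_wpDl// mulr_ge0.
  have [d d0 Hd] := cphi _ e2.
  pose t := Num.min (1 / 4) (Num.min (d / 2) (e / (8 * M + 1))).
  have t0 : 0 < t by rewrite !lt_min e2 !divr_gt0.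
  have td : t < d.
    by rewrite gt_min gt_min; apply/orP; right; apply/orP; left; rewrite ltr_pdivrMr// ltr_pMr// ltr1n.
  have te : t <= e / (8 * M + 1) by rewrite !ge_min lexx !orbT.
  have t4 : t <= 1 / 4 by rewrite ge_min lexx.
  have ct : cmod t%:C = t by rewrite cmod_real gtr0_norm.
  have tC0 : t%:C != 0 :> C by rewrite -cmod_gt0 ct.
  have ht : cmod (f t%:C / t%:C) <= e / (8 * M + 1).
    have := Hd t%:C; rewrite fE f0 add0r !subr0 ct mulfK// p0 subr0; exact.
  have ht2 : cmod t%:C <= 1 / 2 by rewrite ct; lra.
  have := @lipschitz_half_disc _ _ z t%:C M0 dh1 hM z0 tC0 z2 ht2; rewrite cmodBC => hL.
  have := ler_cmod_dist (f z / z) (f t%:C / t%:C).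
  have : 8 * M * cmod (t%:C - z) <= 8 * M * (cmod z + t).
    by rewrite ler_wpM2l ?mulr_ge0// (le_trans (ler_cmodB _ _))// ct addrC.
  have : (8 * M + 1) * (e / (8 * M + 1)) = e by rewrite mulrC divfK// lt0r_neq0// ltr_wpDl// mulr_ge0.
  have : 8 * M * t <= 8 * M * (e / (8 * M + 1)) by rewrite ler_wpM2l// mulr_ge0.
  by lra.
pose g w := f (w / 2) / (w / 2) / (w / 2).
have c2 : cmod (2 : C) = 2 by rewrite cmod_nat.
have two0 : (2 : C) != 0 by rewrite pnatr_eq0.
have half0 (w : C) : w != 0 -> w / 2 != 0 by move=> w0; rewrite mulf_neq0// invr_neq0.
have dg z : cmod z < 1 -> z != 0 -> cdiff g z.
  move=> z1 z0; apply: (@cdiff_comp _ (fun w => w / 2) (fun w => f w / w / w)).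
    by apply: cdiffM; [exact: cdiff_id|exact: cdiff_cst].
  apply: (@cdiff_div_id _ 1); first exact: half0.
  by apply: dh1; rewrite ?half0// cmodM cmodV c2; lra.
have gM z : cmod z < 1 -> z != 0 -> cmod (g z) <= 8 * M.
  move=> z1 z0; rewrite /g cmodM [cmod (_ / 2)^-1]cmodV ler_pdivrMr ?cmod_gt0 ?half0//.
  by apply: f2; rewrite ?half0// cmodM cmodV c2; lra.
have dga : cderiv g (a * 2) ((a * l - 2 * f a) / a ^+ 3 / 2).
  have dhalf : cderiv (fun w => w / 2) (a * 2) 2^-1.
    have := cderivM (cderiv_id (a * 2)) (cderiv_cst 2^-1 (a * 2)).
    by rewrite mulr0 addr0 mul1r.
  have := cderiv_comp (g := fun w => f w / w / w) dhalf.
  rewrite mulfK// => /(_ _ (cderiv_div_id a0 (cderiv_div_id a0 dfa))).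
  rewrite (_ : _ / 2 = (a * l - 2 * f a) / a ^+ 3 / 2)//.
  by field.
have a20 : a * 2 != 0 by rewrite mulf_neq0.
have := deriv_bound_half_disc (mulr_ge0 (ler0n _ 8) M0) dg gM a20 _ dga.
rewrite cmodM c2 => /(_ ltac:(lra)).
rewrite !cmodM !cmodV cmodX c2 ler_pdivrMr// ler_pdivrMr ?exprn_gt0 ?cmod_gt0//.
by rewrite (_ : 8 * (8 * M) * 2 = 128 * M)//; ring.
Qed.

End Schwarz.

(** * Triangular form *)

Section Triangular.
Variable F : fieldType.
Implicit Types (n : nat).

Lemma char_poly_conj n (P A : 'M[F]_n) : P \in unitmx ->
  char_poly (P *m A *m invmx P) = char_poly A.
Proof.
move=> uP; rewrite /char_poly.
have E : char_poly_mx (P *m A *m invmx P) =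
    map_mx polyC P *m char_poly_mx A *m map_mx polyC (invmx P).
  rewrite /char_poly_mx mulmxBr mulmxBl !map_mxM; congr (_ - _).
  by rewrite scalar_mxC -mulmxA -map_mxM mulmxV// map_mx1 mulmx1.
rewrite E !det_mulmx mulrC mulrA -det_mulmx -map_mxM mulVmx// map_mx1.
by rewrite det1 mul1r.
Qed.

Lemma invmx_mul n (P Q : 'M[F]_n) : P \in unitmx -> Q \in unitmx ->
  invmx (P *m Q) = invmx Q *m invmx P.
Proof.
move=> uP uQ; have uPQ : P *m Q \in unitmx by rewrite unitmx_mul uP.
have E : P *m Q *m (invmx Q *m invmx P) = 1%:M by rewrite mulmxA (mulmxK uQ) mulmxV.
by rewrite -[RHS](mulKmx uPQ) E mulmx1.
Qed.

Lemma char_poly_block n1 n2 (A1 : 'M[F]_n1)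
    (D : 'M[F]_(n2, n1)) (A2 : 'M[F]_n2) :
  char_poly (block_mx A1 0 D A2) = char_poly A1 * char_poly A2.
Proof.
rewrite /char_poly /char_poly_mx map_block_mx map_mx0.
by rewrite [X in \det (X - _)]scalar_mx_block opp_block_mx add_block_mx subrr det_lblock.
Qed.

Lemma row0_completion n (v : 'rV[F]_n.+1) : v != 0 ->
  exists P : 'M[F]_n.+1, P \in unitmx /\ exists2 c, c != 0 & row 0 P = c *: v.
Proof.
move=> v0; exists (row_ebase v); split; first exact: row_ebase_unit.
have E := mulmx_ebase v; rewrite rank_rV v0 in E.
have cu : col_ebase v \in unitmx := col_ebase_unit v.
rewrite [col_ebase v]mx11_scalar in E cu.
set k := col_ebase v 0 0 in E cu.
have k0 : k != 0.
  by apply: contraTneq cu => ->; rewrite unitmxE det_scalar1 unitr0.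
exists k^-1; first by rewrite invr_neq0.
rewrite -[X in _ = _ *: X]E mul_scalar_mx -scalemxAl scalerA mulVf// scale1r rowE.
congr (_ *m _); apply/matrixP => i j; rewrite !mxE ord1 eqxx /=.
by rewrite andbT eq_sym.
Qed.

(** An eigenvector for the root wanted first on the diagonal is made the first row of a
    basis, and the rest follows by induction; hence the order of the roots is free. *)
Lemma triangularize n (A : 'M[F]_n) (d : 'I_n -> F) :
  char_poly A = \prod_i ('X - (d i)%:P) ->
  exists P : 'M[F]_n, [/\ P \in unitmx, is_trig_mx (P *m A *m invmx P) &
    forall i, (P *m A *m invmx P) i i = d i].
Proof.
elim: n A d => [|n IH] A d cA.
  exists 1%:M; split; first exact: unitmx1.
    by apply/is_trig_mxP => -[].
  by case.
have ev : eigenvalue A (d ord0).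
  rewrite eigenvalue_root_char cA big_ord_recl rootM root_XsubC eqxx//.
have /eigenvalueP [v vA v0] := ev.
have [P [uP [c c0 rP]]] := row0_completion v0.
have [B BE0] : exists B : 'M[F]_(1 + n), B = P *m A *m invmx P by eexists.
have B0 k : B 0 k = d ord0 * (k == 0)%:R.
  have : row 0 B = d ord0 *: delta_mx 0 0.
    rewrite BE0 !row_mul rP -scalemxAl vA scalerA mulrC -scalerA -rP -scalemxAl.
    by rewrite -row_mul mulmxV// row1.
  by move=> /(congr1 (fun M : 'rV_(1 + n) => M 0 k)); rewrite !mxE.
have BE : B = block_mx (d ord0)%:M 0 (dlsubmx B) (drsubmx B).
  rewrite -[LHS]submxK; congr block_mx; apply/matrixP => i j; rewrite !mxE !ord1.
    by rewrite (_ : lshift n 0 = 0) ?B0 ?eqxx ?mulr1//; apply: val_inj.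
  by rewrite (_ : lshift n 0 = 0) ?B0 ?mulr0//; apply: val_inj.
have cB : char_poly (drsubmx B) = \prod_i ('X - (d (lift ord0 i))%:P).
  have X0 : 'X - (d ord0)%:P != 0 by rewrite polyXsubC_eq0.
  apply: (mulfI X0); 
  have c1 : char_poly ((d ord0)%:M : 'M[F]_1) = 'X - (d ord0)%:P.
    by rewrite /char_poly det_mx11 !mxE.
  rewrite -{1}c1 -(char_poly_block _ (dlsubmx B)) -BE.
  by rewrite -(big_ord_recl _ (fun i => 'X - (d i)%:P)) -cA BE0 char_poly_conj.
have [Q [uQ tQ dQ]] := IH _ _ cB.
pose Q1 : 'M[F]_(1 + n) := block_mx 1%:M 0 0 Q.
have uQ1 : Q1 \in unitmx by rewrite unitmxE det_lblock det1 mul1r -unitmxE.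
have iQ1 : invmx Q1 = block_mx 1%:M 0 0 (invmx Q).
  rewrite -[RHS](mulKmx uQ1) mulmx_block !mulmx0 !mul0mx !addr0 !add0r mulmx1.
  by rewrite mulmxV// -scalar_mx_block mulmx1.
have TE : Q1 *m P *m A *m invmx (Q1 *m P) =
    block_mx (d ord0)%:M 0 (Q *m dlsubmx B) (Q *m drsubmx B *m invmx Q).
  rewrite invmx_mul//.
  have -> : Q1 *m P *m A *m (invmx P *m invmx Q1) = Q1 *m B *m invmx Q1.
    by rewrite BE0 !mulmxA.
  rewrite {1}BE iQ1.
  by rewrite !mulmx_block !(mulmx0, mul0mx, addr0, add0r, mul1mx, mulmx1).
exists (Q1 *m P); split; first by rewrite unitmx_mul uQ1.
  by rewrite TE (@is_trig_block_mx _ 1 n 1 n)// eqxx mx11_is_trig.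
rewrite TE => i; case: (@split_ordP 1 n i) => j ->.
  rewrite (@block_mxEul _ 1 n 1 n) ord1 mxE eqxx mulr1n; congr d; exact: val_inj.
rewrite (@block_mxEdr _ 1 n 1 n) dQ; congr d; exact: val_inj.
Qed.

Lemma eigenvalue_prod n (A : 'M[F]_n) (d : 'I_n -> F) a :
  char_poly A = \prod_i ('X - (d i)%:P) ->
  reflect (exists i, a = d i) (eigenvalue A a).
Proof.
move=> cA; rewrite eigenvalue_root_char cA /root horner_prod.
apply: (iffP idP) => [|[i ->]].
  rewrite prodf_seq_eq0 => /hasP[i _]; rewrite hornerXsubC subr_eq0 => /eqP ->.
  by exists i.
by apply/prodf_eq0; exists i => //; rewrite hornerXsubC subrr.
Qed.

End Triangular.

Lemma char_poly_split (F : closedFieldType) n (A : 'M[F]_n) :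
  exists d : 'I_n -> F, char_poly A = \prod_i ('X - (d i)%:P).
Proof.
have [r Hr] := closed_field_poly_normal (char_poly A).
have m := char_poly_monic A; rewrite monicE in m; rewrite (eqP m) scale1r in Hr.
have sr : size r = n.
  by have := size_char_poly A; rewrite Hr size_prod_XsubC => -[].
exists (fun i => r`_i); rewrite Hr (big_nth 0) big_mkord sr //.
Qed.

(** * Holomorphic matrix functions *)

Section MatrixFunctions.
Variable R : realType.
Notation C := R[i].

Lemma mdiff_cst p q (A : 'M[C]_(p, q)) z : mdiff (fun=> A) z.
Proof. by move=> i j; exact: cdiff_cst. Qed.

Lemma mdiffD p q (F G : C -> 'M[C]_(p, q)) z :
  mdiff F z -> mdiff G z -> mdiff (fun w => F w + G w) z.
Proof.
move=> dF dG i j; apply: (@cdiff_ext _ (fun w => F w i j + G w i j) _ _ 1) => //.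
  by move=> w _; rewrite mxE.
exact: cdiffD.
Qed.

Lemma mdiffZ p q (f : C -> C) (F : C -> 'M[C]_(p, q)) z :
  cdiff f z -> mdiff F z -> mdiff (fun w => f w *: F w) z.
Proof.
move=> df dF i j; apply: (@cdiff_ext _ (fun w => f w * F w i j) _ _ 1) => //.
  by move=> w _; rewrite mxE.
exact: cdiffM.
Qed.

Lemma mdiffM p q r (F : C -> 'M[C]_(p, q)) (G : C -> 'M[C]_(q, r)) z :
  mdiff F z -> mdiff G z -> mdiff (fun w => F w *m G w) z.
Proof.
move=> dF dG i j.
apply: (@cdiff_ext _ (fun w => \sum_k F w i k * G w k j) _ _ 1) => //.
  by move=> w _; rewrite mxE.
by apply: cdiff_sum => k _; exact: cdiffM.
Qed.

Lemma cdiff_det p (F : C -> 'M[C]_p) z : mdiff F z -> cdiff (fun w => \det (F w)) z.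
Proof.
move=> dF; rewrite /determinant.
apply: cdiff_sum => s _; apply: cdiffM; first exact: cdiff_cst.
by apply: cdiff_prod => i _; exact: dF.
Qed.

Lemma mdiff_inv p (F : C -> 'M[C]_p) z (d : R) : 0 < d ->
  (forall w, cmod (w - z) < d -> F w \in unitmx) ->
  mdiff F z -> mdiff (fun w => invmx (F w)) z.
Proof.
move=> d0 uF dF i j.
apply: (@cdiff_ext _ (fun w => (\det (F w))^-1 * cofactor (F w) j i) _ _ d) => //.
  by move=> w wd; rewrite /invmx uF// !mxE.
apply: cdiffM.
  by apply: cdiffV; [rewrite -unitfE -unitmxE uF// subrr cmod0|exact: cdiff_det].
apply: cdiffM; first exact: cdiff_cst.
apply: cdiff_det => k l; apply: (@cdiff_ext _ (fun w => F w (lift j k) (lift i l)) _ _ 1) => //.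
by move=> w _; rewrite !mxE.
Qed.

Definition pdiff (P : C -> {poly C}) z := forall k, cdiff (fun w => (P w)`_k) z.

Lemma pdiffM P Q z : pdiff P z -> pdiff Q z -> pdiff (fun w => P w * Q w) z.
Proof.
move=> dP dQ k.
apply: (@cdiff_ext _ (fun w => \sum_(i < k.+1) (P w)`_i * (Q w)`_(k - i)) _ _ 1) => //.
  by move=> w _; rewrite coefM.
by apply: cdiff_sum => i _; exact: cdiffM.
Qed.

Lemma pdiff_prod I (r : seq I) (F : I -> C -> {poly C}) z :
  (forall i, pdiff (F i) z) -> pdiff (fun w => \prod_(i <- r) F i w) z.
Proof.
move=> H; elim: r => [|i r IH].
  rewrite (_ : (fun w => _) = (fun=> 1)); last by apply/funext => w; rewrite big_nil.
  by move=> k; exact: cdiff_cst.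
rewrite (_ : (fun w => _) = (fun w => F i w * \prod_(i <- r) F i w)); last first.
  by apply/funext => w; rewrite big_cons.
exact: pdiffM.
Qed.

Lemma pdiff_char_poly p (F : C -> 'M[C]_p) z :
  mdiff F z -> pdiff (fun w => char_poly (F w)) z.
Proof.
move=> dF k; pose T (s : 'S_p) w := (-1) ^+ s * \prod_i (char_poly_mx (F w)) i (s i).
apply: (@cdiff_ext _ (fun w => \sum_s (T s w)`_k) _ _ 1) => //.
  by move=> w _; rewrite /char_poly /determinant coef_sum.
apply: cdiff_sum => s _; move: k; apply: pdiffM => [k|]; first exact: cdiff_cst.
apply: pdiff_prod => i k.
apply: (@cdiff_ext _ (fun w => (('X : {poly C}) *+ (i == s i))`_k - ((F w i (s i))%:P)`_k) _ _ 1) => //.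
  by move=> w _; rewrite !mxE coefB.
apply: cdiffB; first exact: cdiff_cst.
apply: (@cdiff_ext _ (fun w => F w i (s i) * (k == 0)%:R) _ _ 1) => //.
  by move=> w _; rewrite coefC; case: eqP; rewrite ?mulr1 ?mulr0.
by apply: cdiffM; [exact: dF|exact: cdiff_cst].
Qed.

(** Since [cexp] is onto the nonzero numbers, an invertible triangular matrix, hence any
    invertible matrix, lies on an entire curve of invertible matrices through 1. *)
Lemma entire_path_in_GL n (D : 'M[C]_n) (a : C) : D \in unitmx -> a != 0 ->
  exists K : C -> 'M[C]_n, [/\ K 0 = 1%:M, K a = D &
    forall z, K z \in unitmx /\ mdiff K z].
Proof.
move=> uD a0; have [d cD] := char_poly_split D.
have [P [uP tP dP]] := triangularize cD.
set T := P *m D *m invmx P in tP dP.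
have d0 i : d i != 0.
  apply/negP => /eqP di; have : \det T = 0.
    by rewrite det_trig//; apply/eqP/prodf_eq0; exists i => //; rewrite dP di.
  apply/eqP; rewrite -unitfE -unitmxE /T !unitmx_mul uP uD unitmx_inv//.
have [w Hw] : exists w : 'I_n -> C, forall i, cexp (w i) = d i.
  exists (fun i => sval (cid (cexp_surj (d0 i)))) => i.
  exact: (svalP (cid (cexp_surj (d0 i)))).
pose S (z : C) : 'M[C]_n := \matrix_(i, j) if i == j then cexp (z / a * w i) else z / a * T i j.
have tS z : is_trig_mx (S z).
  apply/is_trig_mxP => i j ij; rewrite mxE -val_eqE ltn_eqF//.
  by move/is_trig_mxP: tP => ->; rewrite ?mulr0.
have uS z : S z \in unitmx.
  rewrite unitmxE det_trig// unitfE; apply/prodf_neq0 => i _.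
  by rewrite mxE eqxx cexp_neq0.
exists (fun z => invmx P *m S z *m P); split.
- rewrite (_ : S 0 = 1%:M) ?mulmx1 ?mulVmx//.
  by apply/matrixP => i j; rewrite !mxE mul0r !mul0r cexp0; case: eqP.
- rewrite (_ : S a = T); first by rewrite /T !mulmxA mulVmx// mul1mx -mulmxA mulVmx// mulmx1.
  apply/matrixP => i j; rewrite mxE divff// !mul1r.
  by case: eqP => [<-|//]; rewrite Hw dP.
move=> z; split; first by rewrite !unitmx_mul unitmx_inv uP uS.
apply: mdiffM; last exact: mdiff_cst.
apply: mdiffM; first exact: mdiff_cst.
move=> i j.
have dz c : cdiff (fun x : C => x / a * c) z.
  apply: cdiffM; last exact: cdiff_cst.
  by apply: cdiffM; [exact: cdiff_id|exact: cdiff_cst].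
case: (eqVneq i j) => [<-|ij].
  apply: (@cdiff_ext _ (fun x => cexp (x / a * w i)) _ _ 1) => //.
    by move=> x _; rewrite mxE eqxx.
  by apply: (@cdiff_comp _ (fun x : C => x / a * w i) (@cexp R)); [exact: dz|exact: cdiff_cexp].
apply: (@cdiff_ext _ (fun x => x / a * T i j) _ _ 1) => //.
by move=> x _; rewrite [RHS]mxE (negPf ij).
Qed.

End MatrixFunctions.

(** * Discs in the spectral ball and the Lempert function *)

Section SpectralBall.
Variable R : realType.
Notation C := R[i].
Variable n : nat.
Implicit Types (A B D : 'M[C]_n) (d : 'I_n -> C).

Lemma in_ballP A : spectral_ball R n A <-> forall a, eigenvalue A a -> cmod a < 1.
Proof.
have [d cA] := char_poly_split A.
have ub (m : R) : (forall i, cmod (d i) <= m) ->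
    ubound [set cmod a | a in [set a : C | eigenvalue A a]] m.
  by move=> Hm _ [a /= + <-] => /(eigenvalue_prod _ cA)[i ->].
split=> [sA a ea|H].
  apply: le_lt_trans sA; apply: ub_le_sup; last by exists a.
  exists (\big[Num.max/0]_i cmod (d i)); apply: ub => i.
  exact: (@le_bigmax _ _ _ 0 (fun i => cmod (d i)) i).
rewrite /spectral_ball /= /spectral_radius.
have [[x Ax]|/nonemptyPn ->] := pselect ([set cmod a | a in [set a : C | eigenvalue A a]] !=set0); last first.
  by rewrite sup0 ltr01.
apply: (@le_lt_trans _ _ (\big[Num.max/0]_i cmod (d i))).
  apply: ge_sup; first by exists x.
  by apply: ub => i; exact: (@le_bigmax _ _ _ 0 (fun i => cmod (d i)) i).
apply: bigmax_lt => // i _; apply: H; apply/(eigenvalue_prod _ cA).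
by exists i.
Qed.

Lemma in_ball_prod A d : char_poly A = \prod_i ('X - (d i)%:P) ->
  spectral_ball R n A <-> forall i, cmod (d i) < 1.
Proof.
move=> cA; rewrite in_ballP; split=> [H i|H a /(eigenvalue_prod _ cA)[i ->]//].
by apply: H; apply/(eigenvalue_prod _ cA); exists i.
Qed.

Lemma in_ball_char_poly A B : char_poly A = char_poly B ->
  spectral_ball R n A -> spectral_ball R n B.
Proof.
move=> AB; rewrite !in_ballP => H a; rewrite eigenvalue_root_char -AB -eigenvalue_root_char.
exact: H.
Qed.

(** The parameters of which [lempertE] takes the infimum. *)
Definition disc A B (a : C) := cmod a < 1 /\ exists f : C -> 'M[C]_n,
  [/\ forall z, cmod z < 1 -> mdiff f z /\ spectral_ball R n (f z), f 0 = A & f a = B].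

Notation lemp := (lempert (spectral_ball R n)).

Lemma lempertE A B : lemp A B = inf [set cmod a | a in [set a | disc A B a]].
Proof.
rewrite /lempert; congr inf; apply/seteqP; split=> x [a /= [a1 [f [fO f0 fa]]] <-].
  exists a => //; split=> //; exists f; split=> // z z1.
  by have [/mdiffP] := fO z z1.
exists a => //; split=> //; exists f; split=> // z z1.
by have [df fz] := fO z z1; split=> //; apply/mdiffP.
Qed.

Lemma lempert_lb A B : has_lbound [set cmod a | a in [set a | disc A B a]].
Proof. by exists 0 => _ [a _ <-]; exact: cmod_ge0. Qed.

Lemma lempert_ge0 A B : 0 <= lemp A B.
Proof.
rewrite lempertE; have [[x Ex]|/nonemptyPn ->] := pselect
    ([set cmod a | a in [set a | disc A B a]] !=set0); last by rewrite inf0.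
by apply: lb_le_inf; [exists x|move=> _ [a _ <-]; exact: cmod_ge0].
Qed.

Lemma lempert_le A B a : disc A B a -> lemp A B <= cmod a.
Proof. by move=> H; rewrite lempertE; apply: ge_inf; [exact: lempert_lb|exists a]. Qed.

Lemma lempert_ge A B b (r : R) : disc A B b -> (forall a, disc A B a -> r <= cmod a) ->
  r <= lemp A B.
Proof.
move=> H Hr; rewrite lempertE; apply: lb_le_inf; first by exists (cmod b), b.
by move=> _ [a /Hr h <-].
Qed.

Lemma lempert_lt A B b (r : R) : disc A B b -> lemp A B < r ->
  exists2 a, disc A B a & cmod a < r.
Proof.
rewrite lempertE => H Hr; set E := [set _ | _ in _] in Hr.
have e0 : 0 < r - inf E by rewrite subr_gt0.
have hE : has_inf E by split; [exists (cmod b), b|exact: lempert_lb].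
have [_ [a Ha <-]] := inf_adherent e0 hE.
by rewrite addrC subrK => h; exists a.
Qed.

Lemma disc_ball A B a : disc A B a -> spectral_ball R n A /\ spectral_ball R n B.
Proof.
move=> [a1 [f [H <- <-]]]; split; last exact: (H a a1).2.
by have := (H 0); rewrite cmod0 ltr01 => /(_ isT)[].
Qed.

(** Conjugation along an entire curve in the linear group, from 1 at 0 to [D] at [a],
    moves only one end of the disc. *)
Lemma disc_conj_r A B a D : D \in unitmx -> a != 0 ->
  disc A B a -> disc A (D *m B *m invmx D) a.
Proof.
move=> uD a0 [a1 [f [H f0 fa]]]; split=> //.
have [K [K0 Ka HK]] := entire_path_in_GL uD a0.
exists (fun z => K z *m f z *m invmx (K z)); split; last by rewrite Ka fa.
  move=> z z1; have [df fz] := H z z1; split.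
    apply: mdiffM; first by apply: mdiffM => //; exact: (HK z).2.
    by apply: (mdiff_inv ltr01) => [w _|]; [exact: (HK w).1|exact: (HK z).2].
  by apply: in_ball_char_poly fz; rewrite char_poly_conj//; exact: (HK z).1.
by rewrite K0 f0 mul1mx invmx1 mulmx1.
Qed.

Lemma disc_conj A B a D : D \in unitmx ->
  disc A B a -> disc (D *m A *m invmx D) (D *m B *m invmx D) a.
Proof.
move=> uD [a1 [f [H f0 fa]]]; split=> //.
exists (fun z => D *m f z *m invmx D); split=> [z z1||]; [|by rewrite f0|by rewrite fa].
have [df fz] := H z z1; split; last by apply: in_ball_char_poly fz; rewrite char_poly_conj.
apply: mdiffM; last exact: mdiff_cst.
by apply: mdiffM => //; exact: mdiff_cst.
Qed.

Lemma disc_conj_l A B a D : D \in unitmx -> a != 0 ->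
  disc A B a -> disc (D *m A *m invmx D) B a.
Proof.
move=> uD a0 /(disc_conj uD) /(disc_conj_r (_ : invmx D \in unitmx) a0).
rewrite unitmx_inv => /(_ uD); rewrite invmxK.
by rewrite -!mulmxA mulKmx// mulVmx// mulmx1.
Qed.

(** Relative continuity on the ball in its epsilon-delta form, with the entries as
    coordinates; see [lcontP]. *)
Definition lcont A := forall B, spectral_ball R n B -> forall e : R, 0 < e ->
  exists2 dl : R, 0 < dl & forall B', spectral_ball R n B' ->
    (forall i j, cmod (B' i j - B i j) < dl) -> `|lemp A B' - lemp A B| < e.

Lemma nbhs_mxP A (P : set 'M[C]_n) : nbhs A P <->
  exists2 dl : R, 0 < dl & forall B, (forall i j, cmod (B i j - A i j) < dl) -> P B.
Proof.
split=> [/nbhs_ballP[e /= e0 eP]|[dl dl0 H]].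
  exists (complex.Re e); first by move: e0; rewrite ltcE => /andP[].
  move=> B HB; apply: eP; split=> // i j; rewrite /ball /= normc_cmod cmodBC.
  by move: e0; rewrite !ltcE /= => /andP[/eqP-> _]; rewrite eqxx; exact: HB.
apply/nbhs_ballP; exists dl%:C => /=; first by rewrite ltcR.
by move=> B [_ HB]; apply: H => i j; rewrite cmodBC -ltcR -normc_cmod; exact: HB.
Qed.

Lemma lcontP A : {within spectral_ball R n, continuous (lemp A)} <-> lcont A.
Proof.
rewrite subspace_continuousP; split=> H B OB.
  move=> e e0; have /cvgrPdist_lt/(_ e e0)/nbhs_mxP[dl dl0 Hd] := H B OB.
  by exists dl => // B' OB' BB'; rewrite distrC; exact: Hd.
apply/cvgrPdist_lt => e e0; apply/nbhs_mxP.
have [dl dl0 Hd] := H B OB e e0; exists dl => // B' BB' OB'.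
by rewrite distrC; exact: Hd.
Qed.

(** Conjugating by powers of a small number shrinks the part of a triangular
    matrix off the diagonal, so that a continuous Lempert function cannot be
    larger at the diagonal matrix than at B. *)
Lemma lcont_le_diag A B d a : lcont A -> char_poly B = \prod_i ('X - (d i)%:P) ->
  a != 0 -> disc A B a -> lemp A (diag_mx (\row_i d i)) <= cmod a.
Proof.
move=> cA cB a0 dAB; set D := diag_mx _.
have OD : spectral_ball R n D.
  apply: in_ball_char_poly (disc_ball dAB).2; rewrite cB char_poly_trig ?diag_mx_is_trig//.
  by apply: eq_bigr => i _; rewrite !mxE eqxx mulr1n.
apply/ler_addgt0Pr => e e0; have [dl dl0 Hd] := cA D OD e e0.
have [P [uP tP dP]] := triangularize cB; set T := P *m B *m invmx P in tP dP.
pose K := \sum_i \sum_j cmod (T i j).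
have K0 : 0 <= K by apply: sumr_ge0 => i _; apply: sumr_ge0 => j _; exact: cmod_ge0.
have TK i j : cmod (T i j) <= K.
  rewrite /K (bigD1 i)//= (bigD1 j)//= -addrA lerDl addr_ge0//.
    by apply: sumr_ge0 => k _; exact: cmod_ge0.
  by apply: sumr_ge0 => k _; apply: sumr_ge0 => l _; exact: cmod_ge0.
pose t := Num.min 1 (dl / (K + 1) / 2).
have K1 : 0 < K + 1 by rewrite ltr_wpDl.
have t0 : 0 < t by rewrite lt_min ltr01 !divr_gt0.
have t1 : t <= 1 by rewrite ge_min lexx.
have tK : t * K < dl.
  have h : t * (K + 1) <= dl / 2.
    by rewrite -ler_pdivlMr// mulrAC ge_min lexx orbT.
  by move: h t0 K0; lra.
have tC0 : t%:C != 0 :> C by rewrite (inj_eq (@complexI _) _ 0) lt0r_neq0.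
pose S : 'M[C]_n := diag_mx (\row_i t%:C ^+ i).
pose S' : 'M[C]_n := diag_mx (\row_i t%:C ^- i).
have SS' : S *m S' = 1%:M.
  rewrite mulmx_diag -diag_const_mx; congr diag_mx; apply/rowP => i.
  by rewrite !mxE divff// expf_neq0.
have [uS _] := mulmx1_unit SS'.
have iS : invmx S = S' by rewrite -[RHS](mulKmx uS) SS' mulmx1.
pose B' := (S *m P) *m B *m invmx (S *m P).
have uSP : S *m P \in unitmx by rewrite unitmx_mul uS.
have dAB' : disc A B' a by exact: disc_conj_r.
have B'E i j : B' i j = t%:C ^+ i * T i j / t%:C ^+ j.
  have -> : B' = S *m T *m S' by rewrite /B' invmx_mul// iS /T !mulmxA.
  by rewrite mul_diag_mx mul_mx_diag !mxE.
have near i j : cmod (B' i j - D i j) < dl.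
  have -> : D i j = d i *+ (i == j) by rewrite /D !mxE.
  rewrite B'E; case: (ltngtP i j) => ij.
  - move/is_trig_mxP: tP => ->//; rewrite mulr0 mul0r sub0r cmodN.
    by rewrite -val_eqE ltn_eqF// cmod0.
  - rewrite -val_eqE gtn_eqF// subr0 mulrAC -expfB//.
    rewrite cmodM cmodX cmod_real gtr0_norm//; apply: le_lt_trans tK.
    apply: ler_pM; rewrite ?exprn_ge0 ?cmod_ge0 ?(ltW t0)//.
    rewrite -{2}[t]expr1 ler_wiXn2l ?(ltW t0)// subn_gt0//.
  - have -> : i = j by exact: val_inj.
    by rewrite eqxx dP mulrAC divff ?expf_neq0// mul1r mulr1n subrr cmod0.
have := Hd B' (disc_ball dAB').2 near; rewrite distrC ltr_norml => /andP[_].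
rewrite ltrBlDr => /ltW h; apply: le_trans h _; rewrite addrC lerD2r.
exact: lempert_le.
Qed.

End SpectralBall.

(** * Moebius transformations of the spectral ball *)

Section DetLinear.
Variables (F : fieldType) (S : comNzRingType) (phi : {rmorphism F -> S}).

(** Stated over any ring receiving [F], in order to apply to [s - t A] with numbers as
    well as with polynomials. *)
Lemma det_pencil n (A : 'M[F]_n) (d : 'I_n -> F) (s t : S) :
  char_poly A = \prod_i ('X - (d i)%:P) ->
  \det (s%:M - t *: map_mx phi A) = \prod_i (s - t * phi (d i)).
Proof.
move=> cA; have [P [uP tP dP]] := triangularize cA.
move: tP dP; move TE : (P *m A *m invmx P) => T tP dP.
have PP : map_mx phi P *m map_mx phi (invmx P) = 1%:M.
  by rewrite -map_mxM mulmxV// map_mx1.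
have E : map_mx phi P *m (s%:M - t *: map_mx phi A) *m map_mx phi (invmx P) =
    s%:M - t *: map_mx phi T.
  rewrite mulmxBr mulmxBl scalar_mxC -(mulmxA s%:M) PP mulmx1; congr (_ - _).
  by rewrite -scalemxAr -scalemxAl -TE !map_mxM.
have : \det (s%:M - t *: map_mx phi T) = \prod_i (s - t * phi (d i)).
  rewrite det_trig.
    by apply: eq_bigr => i _; rewrite !mxE eqxx mulr1n dP.
  apply/is_trig_mxP => i j ij; rewrite !mxE -val_eqE ltn_eqF// mulr0n.
  by move/is_trig_mxP: tP => /(_ i j ij); move=> ->; rewrite rmorph0 mulr0 subr0.
rewrite -E !det_mulmx mulrAC -det_mulmx PP det1 mul1r => ->//.
Qed.

End DetLinear.

Section Mobius.
Variable R : realType.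
Notation C := R[i].
Implicit Types (t z : C).

Definition mobius t (x : C) := (x - t) / (1 - t^* * x).

Lemma mobius_identity t (x : C) :
  cmod (1 - t^* * x) ^+ 2 - cmod (x - t) ^+ 2 = (1 - cmod t ^+ 2) * (1 - cmod x ^+ 2).
Proof.
apply: complexI; rewrite rmorphB [in RHS]rmorphM /= !rmorphB /= !rmorph1 !sqr_cmod.
by rewrite !rmorphB !rmorphM rmorph1 /= conjCK; ring.
Qed.

Lemma mobius_den_neq0 t (x : C) : cmod t < 1 -> cmod x < 1 -> 1 - t^* * x != 0.
Proof.
move=> t1 x1; rewrite -cmod_gt0; have := ler_cmod_dist 1 (t^* * x).
rewrite cmod1 cmodM cmod_conj; apply: lt_le_trans.
rewrite subr_gt0; apply: le_lt_trans x1; rewrite ler_piMl ?cmod_ge0//.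
exact: ltW.
Qed.

Lemma cmod_mobius_lt1 t (x : C) : cmod t < 1 -> cmod x < 1 -> cmod (mobius t x) < 1.
Proof.
move=> t1 x1; have D := mobius_den_neq0 t1 x1.
rewrite /mobius cmodM cmodV ltr_pdivrMr ?cmod_gt0// mul1r.
rewrite -(@ltr_pXn2r _ 2)// ?nnegrE ?cmod_ge0// -subr_gt0 mobius_identity.
by rewrite mulr_gt0// subr_gt0 expr_lt1 ?cmod_ge0.
Qed.

Variable n : nat.
Implicit Types (A B X : 'M[C]_n) (d : 'I_n -> C).
Notation ball := (spectral_ball R n).
Notation lemp := (lempert ball).

(** The automorphism of the spectral ball that acts on the eigenvalues by [mobius t]; see
    [char_poly_mobius]. *)
Definition mobius_mx t X := (X - t%:M) *m invmx (1%:M - t^* *: X).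

Lemma mobius_mx_unit t X : cmod t < 1 -> ball X -> 1%:M - t^* *: X \in unitmx.
Proof.
move=> t1; have [d cX] := char_poly_split X; rewrite (in_ball_prod cX) => OX.
have := @det_pencil _ _ idfun n X d 1 t^* cX; rewrite map_mx_id// => E.
rewrite unitmxE E unitfE; apply/prodf_neq0 => i _; exact: (mobius_den_neq0 t1 (OX i)).
Qed.

Lemma char_poly_mobius t X d : cmod t < 1 -> ball X ->
  char_poly X = \prod_i ('X - (d i)%:P) ->
  char_poly (mobius_mx t X) = \prod_i ('X - (mobius t (d i))%:P).
Proof.
move=> t1 OX cX; have U := mobius_mx_unit t1 OX.
have D i : 1 - t^* * d i != 0.
  by apply: mobius_den_neq0 => //; exact: (in_ball_prod cX).1 OX i.
set M := 1%:M - t^* *: X in U.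
have dM : \det (map_mx polyC M) = \prod_i (1 - t^* * d i)%:P.
  rewrite det_map_mx -rmorph_prod /=; congr _%:P.
  by have := @det_pencil _ _ idfun n X d 1 t^* cX; rewrite map_mx_id.
have dM0 : \prod_i (1 - t^* * d i)%:P != 0 :> {poly C}.
  by apply/prodf_neq0 => i _; rewrite polyC_eq0.
apply: (mulIf dM0); rewrite -{1}dM /char_poly -det_mulmx -big_split /=.
have -> : char_poly_mx (mobius_mx t X) *m map_mx polyC M =
    ('X + t%:P)%:M - (1 + 'X * t^*%:P) *: map_mx polyC X.
  rewrite /char_poly_mx mulmxBl -map_mxM /mobius_mx mulmxKV//.
  rewrite mul_scalar_mx; apply/matrixP => i j; rewrite !mxE.
  by case: (i == j); rewrite ?mulr1n ?mulr0n !polyCB !polyCM ?polyC1 ?polyC0; ring.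
have := @det_pencil _ _ (@polyC C) n X d ('X + t%:P) (1 + 'X * t^*%:P) cX.
move=> ->; apply: eq_bigr => i _.
have kE : mobius t (d i) * (1 - t^* * d i) = d i - t by rewrite /mobius divfK.
have -> : 'X + t%:P - (1 + 'X * t^*%:P) * (d i)%:P =
    'X * (1 - t^* * d i)%:P - (d i - t)%:P by rewrite !polyCB !polyCM polyC1; ring.
by rewrite -kE polyCM; ring.
Qed.

Lemma mobius_mx_in_ball t X : cmod t < 1 -> ball X -> ball (mobius_mx t X).
Proof.
move=> t1 OX; have [d cX] := char_poly_split X.
apply/(in_ball_prod (char_poly_mobius t1 OX cX)) => i.
by apply: cmod_mobius_lt1 => //; exact: (in_ball_prod cX).1 OX i.
Qed.

Lemma mobius_mxK t X : cmod t < 1 -> ball X -> mobius_mx (- t) (mobius_mx t X) = X.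
Proof.
move=> t1 OX; have U := mobius_mx_unit t1 OX.
set M := 1%:M - t^* *: X in U; pose k := 1 - t^* * t.
have k0 : k != 0 by exact: mobius_den_neq0.
have E1 : mobius_mx t X - (- t)%:M = k *: (X *m invmx M).
  rewrite -[LHS](mulmxK U) [RHS]scalemxAl; congr (_ *m _).
  rewrite mulmxBl /mobius_mx -/M mulmxKV// mul_scalar_mx.
  by apply/matrixP => i j; rewrite !mxE /k; case: (i == j); rewrite ?mulr1n ?mulr0n; ring.
have E2 : 1%:M - (- t)^* *: mobius_mx t X = k *: invmx M.
  rewrite -[LHS](mulmxK U) -[X in _ = k *: X]mul1mx [RHS]scalemxAl; congr (_ *m _).
  rewrite mulmxBl mul1mx -scalemxAl /mobius_mx -/M mulmxKV// rmorphN /=.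
  by apply/matrixP => i j; rewrite !mxE /k; case: (i == j); rewrite ?mulr1n ?mulr0n; ring.
rewrite /mobius_mx -/(mobius_mx t X) E1 E2 invmxZ.
  rewrite invmxK -scalemxAl -scalemxAr scalerA divff// scale1r -mulmxA mulVmx//.
  by rewrite mulmx1.
by rewrite unitmxZ ?unitfE// unitmx_inv.
Qed.

Lemma mdiff_mobius t (f : C -> 'M[C]_n) z (dl : R) : cmod t < 1 -> 0 < dl ->
  (forall w, cmod (w - z) < dl -> ball (f w)) -> mdiff f z ->
  mdiff (fun w => mobius_mx t (f w)) z.
Proof.
move=> t1 dl0 Of df; rewrite /mobius_mx; apply: mdiffM.
  by apply: mdiffD => //; exact: mdiff_cst.
apply: (mdiff_inv dl0) => [w /Of|]; first exact: mobius_mx_unit.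
apply: (@mdiffD _ _ _ (fun=> 1%:M) (fun w => - (t^* *: f w))); first exact: mdiff_cst.
rewrite (_ : (fun w => _) = (fun w => (- t^*) *: f w)); last first.
  by apply/funext => w; rewrite scaleNr.
by apply: mdiffZ => //; exact: cdiff_cst.
Qed.

Lemma disc_mobius t A B a : cmod t < 1 ->
  disc A B a -> disc (mobius_mx t A) (mobius_mx t B) a.
Proof.
move=> t1 [a1 [f [Hf f0 fa]]]; split=> //.
exists (fun w => mobius_mx t (f w)); split; [|by rewrite f0|by rewrite fa].
move=> z z1; have [df fz] := Hf z z1; split; last exact: mobius_mx_in_ball.
apply: (@mdiff_mobius t f z (1 - cmod z) t1 _ _ df); first by rewrite subr_gt0.
move=> w wz; have := ler_cmod_dist w z => wz'.
by apply: (Hf w _).2; move: wz wz'; lra.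
Qed.

Lemma disc_mobiusE t A B a : cmod t < 1 -> ball A -> ball B ->
  disc (mobius_mx t A) (mobius_mx t B) a <-> disc A B a.
Proof.
move=> t1 OA OB; split; last exact: disc_mobius.
have t1' : cmod (- t) < 1 by rewrite cmodN.
by move=> /(disc_mobius t1'); rewrite !mobius_mxK.
Qed.

Lemma lempert_mobius t A B : cmod t < 1 -> ball A -> ball B ->
  lemp (mobius_mx t A) (mobius_mx t B) = lemp A B.
Proof.
move=> t1 OA OB; rewrite !lempertE; congr inf; apply/seteqP.
by split=> _ [a /= H <-]; exists a => //=; move: H; rewrite disc_mobiusE.
Qed.

Definition entry_dist B B' : R := \sum_i \sum_j cmod (B' i j - B i j).

Lemma entry_dist_ge B B' i j : cmod (B' i j - B i j) <= entry_dist B B'.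
Proof.
rewrite /entry_dist (bigD1 i)//= (bigD1 j)//= -addrA lerDl addr_ge0//.
  by apply: sumr_ge0 => k _; exact: cmod_ge0.
by apply: sumr_ge0 => k _; apply: sumr_ge0 => l _; exact: cmod_ge0.
Qed.

Lemma entry_dist_lt B (dl : R) : 0 < dl -> exists2 dl' : R, 0 < dl' &
  forall B', (forall i j, cmod (B' i j - B i j) < dl') -> entry_dist B B' < dl.
Proof.
move=> dl0; exists (dl / (n * n).+1%:R); first by rewrite divr_gt0.
move=> B' H; apply: (@le_lt_trans _ _ (\sum_(i < n) \sum_(j < n) dl / (n * n).+1%:R)).
  by apply: ler_sum => i _; apply: ler_sum => j _; exact: ltW.
rewrite !sumr_const !card_ord -mulrnA -[ltLHS]mulr_natr -mulrA gtr_pMr//.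
by rewrite mulrC ltr_pdivrMr// mul1r ltr_nat.
Qed.

Lemma tends_entry B i j : tends (entry_dist B) (fun B' => B' i j) (B i j).
Proof.
by move=> e e0; exists e => // B' /ltW; apply: le_trans; exact: entry_dist_ge.
Qed.

Lemma tends_det m T (dist : T -> R) (F : T -> 'M[C]_m) (L : 'M[C]_m) :
  (forall i j, tends dist (fun x => F x i j) (L i j)) ->
  tends dist (fun x => \det (F x)) (\det L).
Proof.
move=> H; rewrite /determinant.
apply: tends_sum => s _; apply: tendsM; first exact: tends_cst.
by apply: tends_prod => i _.
Qed.

Lemma tends_inv m T (dist : T -> R) (F : T -> 'M[C]_m) (L : 'M[C]_m) :
  L \in unitmx ->
  (forall i j, tends dist (fun x => F x i j) (L i j)) ->
  forall i j, tends dist (fun x => invmx (F x) i j) (invmx L i j).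
Proof.
move=> uL H i j; have := uL; rewrite unitmxE unitfE => L0.
have tdet := tends_det H.
have invE (M : 'M[C]_m) : M \in unitmx ->
    invmx M i j = (\det M)^-1 * cofactor M j i.
  by move=> uM; rewrite /invmx uM !mxE.
have [d d0 Hd] : exists2 d : R, 0 < d & forall x, dist x < d -> F x \in unitmx.
  have c2 : 0 < cmod (\det L) / 2 by rewrite divr_gt0// cmod_gt0.
  have [d d0 Hd] := tdet _ c2; exists d => // x /Hd h.
  rewrite unitmxE unitfE; apply: contraTneq h => ->.
  by rewrite sub0r cmodN -ltNge ltr_pdivrMr// ltr_pMr ?cmod_gt0// ltr1n.
have key : tends dist (fun x => (\det (F x))^-1 * cofactor (F x) j i)
    ((\det L)^-1 * cofactor L j i).
  apply: tendsM; first exact: tendsV.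
  apply: tendsM; first exact: tends_cst.
  apply: tends_det => k l.
  rewrite !mxE (_ : (fun x => _) = (fun x => F x (lift j k) (lift i l))); first exact: H.
  by apply/funext => x; rewrite !mxE.
move=> e e0; have [d' d'0 Hd'] := key e e0.
exists (Num.min d d'); first by rewrite lt_min d0.
move=> x; rewrite lt_min => /andP[/Hd ux /Hd'].
by rewrite !invE.
Qed.

Lemma tends_mobius t B i j : cmod t < 1 -> ball B ->
  tends (entry_dist B) (fun B' => mobius_mx t B' i j) (mobius_mx t B i j).
Proof.
move=> t1 OB; rewrite /mobius_mx mxE.
under eq_fun do rewrite mxE.
apply: tends_sum => k _; apply: tendsM.
  rewrite !mxE; under eq_fun do rewrite !mxE.
  by apply: tendsD; [exact: tends_entry|exact: tends_cst].
apply: tends_inv; first exact: mobius_mx_unit.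
move=> p q; rewrite !mxE; under eq_fun do rewrite !mxE.
apply: tendsD; first exact: tends_cst.
under eq_fun do rewrite -mulNr; rewrite -mulNr.
by apply: tendsM; [exact: tends_cst|exact: tends_entry].
Qed.

(** By [lempert_mobius] and the continuity of the transformation. *)
Lemma lcont_mobius t A : cmod t < 1 -> ball A -> lcont (mobius_mx t A) -> lcont A.
Proof.
move=> t1 OA cA B OB e e0; have OmB := mobius_mx_in_ball t1 OB.
have [dl dl0 Hd] := cA _ OmB e e0.
have dl2 : 0 < dl / 2 by rewrite divr_gt0.
pose d' i j := sval (cid2 (tends_mobius i j t1 OB dl2)).
have d'0 i j : 0 < d' i j by rewrite /d'; case: cid2.
pose m := \big[Num.min/1]_i \big[Num.min/1]_j d' i j.
have m0 : 0 < m.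
  by apply: lt_bigmin => // i _; apply: lt_bigmin.
have [dl' dl'0 Hd'] := entry_dist_lt B m0; exists dl' => // B' OB' /Hd' h.
rewrite -(lempert_mobius t1 OA OB) -(lempert_mobius t1 OA OB').
apply: Hd; first exact: mobius_mx_in_ball.
move=> i j; apply: (@le_lt_trans _ _ (dl / 2)); last by rewrite ltr_pdivrMr// ltr_pMr// ltr1n.
have hd : entry_dist B B' < d' i j.
  apply: lt_le_trans h _; apply: le_trans (bigmin_le_cond _ _ (isT : xpredT i)) _.
  exact: (bigmin_le_cond _ _ (isT : xpredT j)).
by move: hd; rewrite /d'; case: cid2 => /= x x0 Hx /Hx.
Qed.

Lemma lcont_mobiusE t A : cmod t < 1 -> ball A -> lcont (mobius_mx t A) <-> lcont A.
Proof.
move=> t1 OA; split; first exact: lcont_mobius.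
move=> cA; have t1' : cmod (- t) < 1 by rewrite cmodN.
by apply: (lcont_mobius t1'); [exact: mobius_mx_in_ball|rewrite mobius_mxK].
Qed.

End Mobius.

(** * Powers of matrices and bounds on roots *)

Section MatrixPowers.
Variable F : fieldType.

Lemma eigenvalue_diag n (A : 'M[F]_n) (d : 'I_n -> F) i :
  char_poly A = \prod_i ('X - (d i)%:P) -> eigenvalue A (d i).
Proof. by move=> cA; apply/(eigenvalue_prod _ cA); exists i. Qed.

Lemma trig_mul n (A B : 'M[F]_n) : is_trig_mx A -> is_trig_mx B ->
  is_trig_mx (A *m B) /\ forall i, (A *m B) i i = A i i * B i i.
Proof.
move=> /is_trig_mxP tA /is_trig_mxP tB; split.
  apply/is_trig_mxP => i j ij; rewrite mxE big1// => k _.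
  have [ik|ki] := ltnP i k; first by rewrite tA ?mul0r.
  by rewrite tB ?mulr0// (leq_ltn_trans ki).
move=> i; rewrite mxE (bigD1 i)//= big1 ?addr0// => k ki.
have [ik|ik|/val_inj ik] := ltngtP i k; first by rewrite tA ?mul0r.
  by rewrite tB ?mulr0.
by rewrite ik eqxx in ki.
Qed.

Lemma char_poly_exp n (A : 'M[F]_n) (d : 'I_n -> F) N :
  char_poly A = \prod_i ('X - (d i)%:P) ->
  char_poly (A ^+ N) = \prod_i ('X - (d i ^+ N)%:P).
Proof.
move=> cA; have [P [uP]] := triangularize cA.
move TE : (P *m A *m invmx P) => T tT dT.
have tTN : is_trig_mx (T ^+ N) /\ forall i, (T ^+ N) i i = d i ^+ N.
  elim: N => [|N [IH1 IH2]].
    rewrite expr0; split; first exact: scalar_mx_is_trig.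
    by move=> i; rewrite mxE eqxx expr0.
  rewrite exprSr; have [t1 t2] := trig_mul IH1 tT; split=> // i.
  by rewrite t2 IH2 dT exprSr.
have TN : P *m A ^+ N *m invmx P = T ^+ N.
  elim: N {tTN} => [|N IH]; first by rewrite !expr0 mulmx1 mulmxV.
  rewrite !exprSr -[A ^+ N * A]/(A ^+ N *m A) -[T ^+ N * T]/(T ^+ N *m T) -IH -TE.
  by rewrite !mulmxA mulmxKV.
rewrite -(char_poly_conj (A ^+ N) uP) TN char_poly_trig ?tTN.1//.
by apply: eq_bigr => i _; rewrite tTN.2.
Qed.

End MatrixPowers.

Section PolyBounds.
Variable R : realType.
Notation C := R[i].

Lemma coef_prod_bound n (d : 'I_n -> C) (r : R) k : 0 <= r ->
  (forall i, cmod (d i) <= r) ->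
  cmod (\prod_i ('X - (d i)%:P))`_k <= (1 + r) ^+ n.
Proof.
move=> r0 dr; elim: n d dr k => [|n IH] d dr k.
  by rewrite big_ord0 coef1 expr0; case: eqP; rewrite ?cmod1 ?cmod0.
rewrite big_ord_recl mulrC mulrBr coefB coefMX coefMC exprSr mulrDr mulr1.
apply: le_trans (ler_cmodB _ _) _; rewrite lerD//.
  by case: k => [|k] /=; rewrite ?cmod0 ?exprn_ge0 ?addr_ge0// IH.
by rewrite cmodM ler_pM ?cmod_ge0// IH.
Qed.

Lemma monic_root_bound (p : {poly C}) n x (B : R) : p \is monic -> size p = n.+1 ->
  (forall k, cmod p`_k <= B) -> root p x -> cmod x <= 1 + B *+ n.
Proof.
move=> mp sp pB rx; have B0 : 0 <= B := le_trans (cmod_ge0 _) (pB 0%N).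
have [x1|x1] := leP (cmod x) 1; first by rewrite (le_trans x1)// lerDl mulrn_wge0.
case: n sp => [|n] sp.
  move: rx mp; rewrite (size1_polyC (eq_leq sp)) /root hornerC => /eqP->.
  by rewrite monicE lead_coefC eq_sym oner_eq0.
have E : x ^+ n.+1 = - \sum_(i < n.+1) p`_i * x ^+ i.
  move: rx mp; rewrite monicE /lead_coef sp /root horner_coef sp big_ord_recr /=.
  by move=> h /eqP l1; move: h; rewrite l1 mul1r addrC addr_eq0 => /eqP.
have x0 : 0 < cmod x by apply: lt_trans x1.
have : cmod x ^+ n.+1 <= (B *+ n.+1) * cmod x ^+ n.
  rewrite -cmodX E cmodN; apply: le_trans (ler_cmod_sum _ _ _) _.
  apply: (@le_trans _ _ (\sum_(i < n.+1) B * cmod x ^+ n)); last first.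
    by rewrite sumr_const card_ord mulrnAl.
  apply: ler_sum => i _; rewrite cmodM cmodX ler_pM ?cmod_ge0 ?exprn_ge0 ?cmod_ge0//.
  by rewrite ler_weXn2l ?(ltW x1)// -ltnS.
rewrite exprS ler_pM2r ?exprn_gt0// => h; apply: le_trans h _.
by rewrite lerDr.
Qed.

Lemma eigenvalue_entries n (A : 'M[C]_n) a : eigenvalue A a ->
  cmod a <= \sum_i \sum_j cmod (A i j).
Proof.
move=> /eigenvalueP[v vA v0].
have [j0 vj0] : exists j, v 0 j != 0.
  apply/existsP; move: v0; apply: contraNT; rewrite negb_exists => /forallP H.
  by apply/eqP/rowP => j; rewrite mxE; have := H j; rewrite negbK => /eqP.
have [j _ Hj] := @arg_maxP _ _ _ j0 xpredT (fun j => cmod (v 0 j)) isT.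
have vj : 0 < cmod (v 0 j) by apply: lt_le_trans (Hj j0 isT); rewrite cmod_gt0.
rewrite -(ler_pM2r vj) -cmodM.
have -> : a * v 0 j = \sum_i v 0 i * A i j.
  by have := congr1 (fun M : 'rV_n => M 0 j) vA; rewrite !mxE => ->.
apply: le_trans (ler_cmod_sum _ _ _) _; rewrite mulr_suml.
apply: ler_sum => i _; rewrite cmodM mulrC ler_pM ?cmod_ge0//; last exact: Hj.
rewrite (bigD1 j)//= lerDl; apply: sumr_ge0 => k _; exact: cmod_ge0.
Qed.

End PolyBounds.

(** * Scalar base points *)

Section SpectralSchwarz.
Variable R : realType.
Notation C := R[i].
Variable n : nat.
Implicit Types (A B : 'M[C]_n).
Notation ball := (spectral_ball R n).
Notation lemp := (lempert ball).

Lemma mdiff_exp (F : C -> 'M[C]_n) N z : mdiff F z -> mdiff (fun w => F w ^+ N) z.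
Proof.
move=> dF; elim: N => [|N IH]; first exact: mdiff_cst.
rewrite (_ : (fun w => _) = (fun w => F w *m F w ^+ N)); first exact: mdiffM.
by apply/funext => w; rewrite exprS.
Qed.

(** The Schwarz lemma for the spectral radius, due to Vesentini.  The coefficients of the
    characteristic polynomial of [(f z / z) ^ N] are bounded by [2 ^ n], independently
    of [N]; so the N-th powers of the eigenvalues of [f z / z] are bounded. *)
Lemma spectral_schwarz (f : C -> 'M[C]_n) (a l : C) :
  (forall z, cmod z < 1 -> mdiff f z /\ ball (f z)) -> f 0 = 0 ->
  cmod a < 1 -> eigenvalue (f a) l -> cmod l <= cmod a.
Proof.
move=> Hf f0 a1 el; have [a0|a0] := eqVneq a 0.
  move: el; rewrite a0 f0 cmod0 => /eigenvalue_entries.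
  by under eq_bigr do (under eq_bigr do rewrite mxE cmod0); rewrite !(big1, big1_eq).
pose g (z : C) : 'M[C]_n := z^-1 *: f z.
have eg (z x : C) : z != 0 -> eigenvalue (g z) x = eigenvalue (f z) (z * x).
    move=> z0; apply/eigenvalueP/eigenvalueP => -[v vE v0]; exists v => //.
    have -> : f z = z *: g z by rewrite /g scalerA divff// scale1r.
    by rewrite -scalemxAr vE scalerA.
  by rewrite /g -scalemxAr vE scalerA mulKf.
have gspec z x : cmod z < 1 -> z != 0 -> eigenvalue (g z) x -> cmod x <= (cmod z)^-1.
  move=> z1 z0; rewrite eg// => ex; have := (in_ballP (f z)).1 (Hf z z1).2 _ ex.
  by rewrite cmodM -ltr_pdivlMl ?cmod_gt0// mulr1 => /ltW.
have [K K0 [d [d0 gK]]] : exists2 K : R, 0 <= K & exists d : R, 0 < d /\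
    forall z, cmod z < d -> z != 0 -> forall i j, cmod (g z i j) <= K.
  have q i j : exists d K : R, 0 < d /\ forall z, cmod z < d -> z != 0 -> cmod (f z i j / z) <= K.
    by apply: div_id_bounded; [have := (Hf 0); rewrite cmod0 ltr01 => /(_ isT)[]|rewrite f0 mxE].
  pose d i j := sval (cid (q i j)); pose K i j := sval (cid (svalP (cid (q i j)))).
  have H i j : 0 < d i j /\ forall z, cmod z < d i j -> z != 0 -> cmod (f z i j / z) <= K i j.
    exact: (svalP (cid (svalP (cid (q i j))))).
  exists (\big[Num.max/0]_i \big[Num.max/0]_j K i j).
    exact: bigmax_ge_id.
  exists (\big[Num.min/1]_i \big[Num.min/1]_j d i j); split.
    by apply: lt_bigmin => // i _; apply: lt_bigmin => // j _; exact: (H i j).1.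
  move=> z zd z0 i j; rewrite mxE mulrC.
  apply: (@le_trans _ _ (K i j)); last first.
    apply: le_trans (le_bigmax _ (fun j => K i j) j) _.
    exact: (le_bigmax _ (fun i => \big[Num.max/0]_j K i j) i).
  apply: (H i j).2 => //; apply: lt_le_trans zd _.
  by apply: le_trans (bigmin_le_cond _ _ (isT : xpredT i)) (bigmin_le_cond _ _ (isT : xpredT j)).
have cB N k : cmod (char_poly (g a ^+ N))`_k <= 2 ^+ n.
  apply: (@max_principle_punctured _ (fun z => (char_poly (g z ^+ N))`_k) (N * n)) => //.
  - move=> z z1 z0; apply: (@pdiff_char_poly R n (fun w => g w ^+ N)); apply: mdiff_exp.
    apply: mdiffZ; last exact: (Hf z z1).1.
    by apply: cdiffV => //; exact: cdiff_id.
  - pose K' := K *+ n *+ n; have K'0 : 0 <= K' by rewrite !mulrn_wge0.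
    exists d, ((1 + K' ^+ N) ^+ n); split=> // z zd z0.
    have [e ce] := char_poly_split (g z); rewrite (char_poly_exp N ce).
    apply: coef_prod_bound => [|i]; first exact: exprn_ge0.
    rewrite cmodX lerXn2r ?nnegrE ?cmod_ge0//.
    have /eigenvalue_entries h := eigenvalue_diag i ce.
    apply: le_trans h _; apply: (@le_trans _ _ (\sum_(i < n) \sum_(j < n) K)).
      by apply: ler_sum => p _; apply: ler_sum => r _; exact: gK.
    by rewrite !sumr_const !card_ord.
  - move=> z z1 z0; have c0 : 0 < cmod z by rewrite cmod_gt0.
    have [e ce] := char_poly_split (g z); rewrite (char_poly_exp N ce).
    apply: (@le_trans _ _ (cmod z ^+ (N * n) * (1 + (cmod z ^- N)) ^+ n)).
      rewrite ler_pM2l ?exprn_gt0//; apply: coef_prod_bound => [|i].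
        by rewrite invr_ge0 exprn_ge0// ltW.
      rewrite cmodX -exprVn lerXn2r ?nnegrE ?invr_ge0 ?cmod_ge0//.
      exact: (gspec z (e i) z1 z0 (eigenvalue_diag i ce)).
    rewrite exprM -exprMn mulrDr mulr1 divff ?expf_neq0 ?lt0r_neq0//.
    rewrite lerXn2r ?nnegrE ?addr_ge0 ?exprn_ge0 ?cmod_ge0//.
    by rewrite -[leRHS]/(1 + 1) lerD2r exprn_ile1 ?cmod_ge0// ltW.
have lE : a * (l / a) = l by rewrite mulrCA divff// mulr1.
have el' : eigenvalue (g a) (l / a) by rewrite (eg _ _ a0) lE.
suff : cmod (l / a) <= 1 by rewrite cmodM cmodV ler_pdivrMr ?cmod_gt0// mul1r.
apply: (@ler_of_power_bound _ 1 (1 + (2 ^+ n) *+ n)) => //; first exact: cmod_ge0.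
move=> N; rewrite mul1r expr1n mulr1 -cmodX.
have [e ce] := char_poly_split (g a).
apply: (monic_root_bound (char_poly_monic _) (size_char_poly _) (cB N.+1)).
have /(eigenvalue_prod _ ce)[i ->] := el'.
rewrite -eigenvalue_root_char; exact: (eigenvalue_diag i (char_poly_exp N.+1 ce)).
Qed.

Lemma disc_from_0 B (r : R) : 0 < r -> r < 1 ->
  (forall x, eigenvalue B x -> cmod x <= r) -> disc 0 B r%:C.
Proof.
move=> r0 r1 H; have rC0 : r%:C != 0 :> C by rewrite (inj_eq (@complexI _) _ 0) lt0r_neq0.
split; first by rewrite cmod_real gtr0_norm.
exists (fun z => (z / r%:C) *: B); split; last 2 first.
- by rewrite mul0r scale0r.
- by rewrite divff// scale1r.
move=> z z1; split.
  apply: mdiffZ; last exact: mdiff_cst.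
  by apply: cdiffM; [exact: cdiff_id|exact: cdiff_cst].
have [e ce] := char_poly_split B.
have ce' : char_poly ((z / r%:C) *: B) = \prod_i ('X - (z / r%:C * e i)%:P).
  have := @det_pencil _ _ (@polyC C) n B e 'X (z / r%:C)%:P ce.
  rewrite /char_poly /char_poly_mx map_mxZ => ->.
  by apply: eq_bigr => i _; rewrite (polyCM (z / r%:C)).
apply/(in_ball_prod ce') => i.
have ei : cmod (e i) <= r := H _ (eigenvalue_diag i ce).
rewrite !cmodM cmodV cmod_real gtr0_norm// -mulrA; apply: le_lt_trans z1.
by rewrite ler_piMr ?cmod_ge0// ler_pdivrMl// mulr1.
Qed.

Lemma lempert_lt1 A B a : disc A B a -> lemp A B < 1.
Proof. by move=> H; apply: le_lt_trans (lempert_le H) H.1. Qed.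

Lemma disc_from_0_ex B : ball B -> exists a, disc 0 B a.
Proof.
move=> OB; have [e ce] := char_poly_split B.
have He := (in_ball_prod ce).1 OB.
pose m := \big[Num.max/0]_i cmod (e i).
have m1 : m < 1 by apply: bigmax_lt => // i _.
have m0 : 0 <= m by exact: bigmax_ge_id.
exists (((m + 1) / 2)%:C); apply: disc_from_0; [lra|lra|].
move=> x /(eigenvalue_prod _ ce)[i ->].
have : cmod (e i) <= m by exact: (le_bigmax _ (fun i => cmod (e i)) i).
lra.
Qed.

Lemma lempert0_ge B x : ball B -> eigenvalue B x -> cmod x <= lemp 0 B.
Proof.
move=> OB ex; have [b Hb] := disc_from_0_ex OB.
apply: lempert_ge Hb _ => a [a1 [f [Hf f0 fa]]].
by apply: (spectral_schwarz Hf f0 a1); rewrite fa.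
Qed.

Lemma lempert0_le B (r : R) : ball B -> 0 < r ->
  (forall x, eigenvalue B x -> cmod x <= r) -> lemp 0 B <= r.
Proof.
move=> OB r0 H; have [r1|r1] := ltP r 1.
  by have := lempert_le (disc_from_0 r0 r1 H); rewrite cmod_real gtr0_norm.
by have [b /lempert_lt1 /ltW h] := disc_from_0_ex OB; exact: le_trans r1.
Qed.

Lemma tends_char_poly B k :
  tends (entry_dist B) (fun B' => (char_poly B')`_k) (char_poly B)`_k.
Proof.
have prodP (I : Type) (r : seq I) (F : I -> 'M[C]_n -> {poly C}) :
    (forall i k, tends (entry_dist B) (fun B' => (F i B')`_k) (F i B)`_k) ->
    forall k, tends (entry_dist B) (fun B' => (\prod_(i <- r) F i B')`_k) (\prod_(i <- r) F i B)`_k.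
  move=> HF; elim: r => [|i r IH] j.
    rewrite big_nil (_ : (fun B' => _) = (fun=> (1 : {poly C})`_j)); first exact: tends_cst.
    by apply/funext => B'; rewrite big_nil.
  rewrite big_cons coefM (_ : (fun B' => _) = (fun B' =>
    \sum_(l < j.+1) (F i B')`_l * (\prod_(i <- r) F i B')`_(j - l))).
    by apply: tends_sum => l _; exact: tendsM.
  by apply/funext => B'; rewrite big_cons coefM.
pose T (s : 'S_n) B' := \prod_i (char_poly_mx B') i (s i).
rewrite /char_poly /determinant coef_sum.
rewrite (_ : (fun B' => _) = (fun B' => \sum_(s : 'S_n) (((-1) ^+ s * T s B' : {poly C}))`_k)); last first.
  by apply/funext => B'; rewrite coef_sum.
apply: tends_sum => s _.
have sg (p : {poly C}) : ((-1) ^+ s * p)`_k = (-1) ^+ s * p`_k.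
  by case: (odd_perm s); rewrite ?expr0 ?expr1 ?mul1r// !mulN1r coefN.
rewrite sg (_ : (fun B' => _) = (fun B' => (-1) ^+ s * (T s B')`_k)); last first.
  by apply/funext => B'; rewrite sg.
apply: tendsM; first exact: tends_cst.
apply: prodP => i j; rewrite !mxE coefB coefC.
rewrite (_ : (fun B' => _) = (fun B' => ('X *+ (i == s i) : {poly C})`_j +
  (- (j == 0%N)%:R) * B' i (s i))); last first.
  by apply/funext => B'; rewrite !mxE coefB coefC; case: (j == 0%N); rewrite ?mulr1n ?mulr0n ?mulN1r ?oppr0 ?mul0r.
rewrite (_ : _ - _ = ('X *+ (i == s i) : {poly C})`_j + (- (j == 0%N)%:R) * B i (s i)); last first.
  by case: (j == 0%N); rewrite ?mulr1n ?mulr0n ?mulN1r ?oppr0 ?mul0r.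
apply: tendsD; first exact: tends_cst.
by apply: tendsM; [exact: tends_cst|exact: tends_entry].
Qed.

(** The value at [x] of the characteristic polynomial of [B], which the hypotheses bound
    by [eta ^ n], is the product of the differences of [x] and the eigenvalues of [B];
    one of these is therefore at most [eta]. *)
Lemma near_eigenvalue B B' x (eta : R) : (0 < n)%N -> 0 <= eta ->
  (forall k, (k < n.+1)%N ->
    cmod ((char_poly B')`_k - (char_poly B)`_k) <= eta ^+ n / n.+1%:R) ->
  cmod x <= 1 -> eigenvalue B' x -> exists2 y, eigenvalue B y & cmod (x - y) <= eta.
Proof.
move=> n0 eta0 H x1 ex; have [d cB] := char_poly_split B.
have [/existsP[i Hi]|/existsPn Hn] := boolP [exists i, cmod (x - d i) <= eta].
  exists (d i); [exact: (eigenvalue_diag i cB)|exact: Hi].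
have sB (A : 'M[C]_n) : (char_poly A).[x] = \sum_(k < n.+1) (char_poly A)`_k * x ^+ k.
  by rewrite horner_coef size_char_poly.
have e0 : (char_poly B').[x] = 0 by apply/eqP; rewrite -[_ == 0]/(root _ _) -eigenvalue_root_char.
have : cmod (char_poly B).[x] <= eta ^+ n.
  rewrite -cmodN -[- _]add0r -e0 !sB -sumrB; apply: le_trans (ler_cmod_sum _ _ _) _.
  apply: (@le_trans _ _ (\sum_(k < n.+1) eta ^+ n / n.+1%:R)); last first.
    by rewrite sumr_const card_ord -[leLHS]mulr_natr divfK// pnatr_eq0.
  apply: ler_sum => k _; rewrite -mulrBl cmodM cmodX.
  apply: le_trans (H k (ltn_ord k)); rewrite ler_piMr ?cmod_ge0//.
  by rewrite exprn_ile1 ?cmod_ge0.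
rewrite leNgt => /negP[]; rewrite cB horner_prod cmod_prod.
rewrite -[X in _ ^+ X]card_ord -prodr_const; apply: ltr_prod.
  by apply/hasP; exists (Ordinal n0); rewrite ?mem_index_enum.
move=> i _; rewrite eta0 hornerXsubC /=; have := Hn i; by rewrite -ltNge.
Qed.

(** By [lempert0_ge] and [lempert0_le] the Lempert function at 0 is the spectral radius,
    which is continuous because the eigenvalues are. *)
Lemma lcont_0 : (0 < n)%N -> lcont (0 : 'M[C]_n).
Proof.
move=> n0 B OB e e0; pose eta := e / 2.
have eta0 : 0 < eta by rewrite divr_gt0.
have ep : 0 < eta ^+ n / n.+1%:R by rewrite divr_gt0// exprn_gt0.
pose dk k := sval (cid2 (tends_char_poly B k ep)).
have dk0 k : 0 < dk k by rewrite /dk; case: cid2.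
pose m := \big[Num.min/1]_(k < n.+1) dk k.
have m0 : 0 < m by apply: lt_bigmin.
have [dl dl0 Hd] := entry_dist_lt B m0; exists dl => // B' OB' /Hd BB'.
have cc k : (k < n.+1)%N -> cmod ((char_poly B')`_k - (char_poly B)`_k) <= eta ^+ n / n.+1%:R.
  move=> kn; have : entry_dist B B' < dk k.
    by apply: lt_le_trans BB' _; exact: (bigmin_le_cond _ _ (isT : xpredT (Ordinal kn))).
  by rewrite /dk; case: cid2 => /= y y0 Hy /Hy.
have half (A A' : 'M[C]_n) : ball A -> ball A' ->
    (forall k, (k < n.+1)%N -> cmod ((char_poly A')`_k - (char_poly A)`_k) <= eta ^+ n / n.+1%:R) ->
    lemp 0 A' < lemp 0 A + e.
  move=> OA OA' H; apply: (@le_lt_trans _ _ (lemp 0 A + eta)); last first.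
    by rewrite ltrD2l ltr_pdivrMr// ltr_pMr// ltr1n.
  have l0 : 0 <= lemp 0 A by exact: lempert_ge0.
  apply: lempert0_le => //; first by rewrite ltr_wpDl.
  move=> x ex; have x1 : cmod x <= 1 by apply/ltW/(in_ballP A').1.
  have [y ey xy] := near_eigenvalue n0 (ltW eta0) H x1 ex.
  rewrite -(subrK y x); apply: le_trans (ler_cmodD _ _) _; rewrite addrC lerD//.
  exact: lempert0_ge.
have h1 := half _ _ OB OB' cc.
have h2 : lemp 0 B < lemp 0 B' + e.
  by apply: (half _ _ OB' OB) => k kn; rewrite cmodBC; exact: cc.
by rewrite ltr_norml; apply/andP; split; move: h1 h2; lra.
Qed.

(** Scalar base points are moved to 0 by a Moebius transformation. *)
Lemma lcont_scalar (t : C) : (0 < n)%N -> ball (t%:M : 'M[C]_n) -> lcont (t%:M : 'M[C]_n).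
Proof.
move=> n0 Ot; have t1 : cmod t < 1.
  apply: (in_ballP _).1 Ot _ _; apply/eigenvalueP.
  exists (delta_mx 0 (Ordinal n0)); first by rewrite mul_mx_scalar.
  by apply/eqP => /matrixP/(_ 0 (Ordinal n0)); rewrite !mxE !eqxx => /eqP; rewrite oner_eq0.
apply: (lcont_mobius t1 Ot); rewrite /mobius_mx subrr mul0mx; exact: lcont_0.
Qed.

End SpectralSchwarz.

(** * Extremal discs of the symmetrized bidisc *)

Section SymmetrizedBidisc.
Variable R : realType.
Notation C := R[i].
Implicit Types (a b c s p z w u v o : C).

Lemma unimodular_align c : exists u : C, cmod u = 1 /\ u * c = (cmod c)%:C.
Proof.
have [->|c0] := eqVneq c 0; first by exists 1; rewrite cmod1 mul1r cmod0.
have cc : cmod c != 0 by rewrite cmod_eq0.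
exists (c^* / (cmod c)%:C); split.
  by rewrite cmodM cmod_conj cmodV cmod_real ger0_norm ?cmod_ge0// divff.
rewrite mulrAC mulrC [c^* * c]mulrC -sqr_cmod -fmorphV -rmorphM /= expr2 mulKf//.
Qed.

Lemma unimodular_conj u : cmod u = 1 -> u * u^* = 1.
Proof. by move=> u1; rewrite -sqr_cmod u1 expr1n. Qed.

(** The points [(a + b, a b)] form the symmetrized bidisc.  After the triangle inequality
    the difference of the two sides is [(1 - |a|) (1 - |b|) (1 - |a| |b|)]. *)
Lemma sym_bidisc a b : cmod a < 1 -> cmod b < 1 ->
  cmod (a + b - (a + b)^* * (a * b)) < 1 - cmod (a * b) ^+ 2.
Proof.
move=> a1 b1; have -> : a + b - (a + b)^* * (a * b) =
    a * (1 - (cmod b ^+ 2)%:C) + b * (1 - (cmod a ^+ 2)%:C).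
  by rewrite !sqr_cmod rmorphD /=; ring.
have a0 := cmod_ge0 a; have b0 := cmod_ge0 b.
apply: le_lt_trans (ler_cmodD _ _) _; rewrite !cmodM.
rewrite -!(rmorph1 (real_complex R)) -!rmorphB /= !cmod_real.
rewrite !ger0_norm ?subr_ge0 ?exprn_ile1 ?(ltW a1) ?(ltW b1)// -subr_gt0.
have -> : 1 - (cmod a * cmod b) ^+ 2 - (cmod a * (1 - cmod b ^+ 2) + cmod b * (1 - cmod a ^+ 2))
  = (1 - cmod a) * (1 - cmod b) * (1 - cmod a * cmod b) by ring.
rewrite !mulr_gt0 ?subr_gt0//; apply: le_lt_trans b1.
by rewrite ler_piMl// ltW.
Qed.

(** So [(2 w p - s) / (2 - w s)], a function of the sum and the product, maps the
    symmetrized bidisc to the disc.  For [w = 1] the difference of the squares of the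
    two sides is 4 times that of the sides of [sym_bidisc], with a real part in place of
    the modulus. *)
Lemma sym_bidisc_test w a b : cmod w = 1 -> cmod a < 1 -> cmod b < 1 ->
  cmod (2 * w * (a * b) - (a + b)) <= cmod (2 - w * (a + b)).
Proof.
move=> w1 a1 b1; have wa : cmod (w * a) < 1 by rewrite cmodM w1 mul1r.
have wb : cmod (w * b) < 1 by rewrite cmodM w1 mul1r.
have -> : cmod (2 * w * (a * b) - (a + b)) =
    cmod (2 * (w * a * (w * b)) - (w * a + w * b)).
  rewrite -[LHS]mul1r -w1 -cmodM; congr cmod; ring.
rewrite mulrDr; move: (w * a) (w * b) wa wb => {w1 a1 b1}x y x1 y1.
have H := sym_bidisc x1 y1; set s := x + y in H *; set p := x * y in H *.
rewrite -(@ler_pXn2r _ 2)// ?nnegrE ?cmod_ge0// -subr_ge0.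
have -> : cmod (2 - s) ^+ 2 - cmod (2 * p - s) ^+ 2 =
    4 * (1 - cmod p ^+ 2 - complex.Re (s - s^* * p)).
  rewrite !sqr_cmodE; case: (s) (p) => s1 s2 [p1 p2] /=; ring.
rewrite mulr_ge0// subr_ge0; apply: le_trans (ler_Re_cmod _) _; exact: ltW.
Qed.

(** The extremal discs through (0, 0).  In terms of square roots [w] of [z] and [g] of [c]
    the two points with sum [geo_s o c z] and product [geo_p o c z] are
    [o w (w - g) / (1 - g^* w)] and its value at [- w]. *)
Definition geo_s (o c z : C) := 2 * o * (1 - (cmod c)%:C) * z / (1 - c^* * z).
Definition geo_p (o c z : C) := o ^+ 2 * z * (z - c) / (1 - c^* * z).

Lemma geo_den c z : cmod c <= 1 -> cmod z < 1 -> 1 - c^* * z != 0.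
Proof.
move=> c1 z1; rewrite -cmod_gt0; have := ler_cmod_dist 1 (c^* * z).
rewrite cmod1 cmodM cmod_conj; apply: lt_le_trans.
by rewrite subr_gt0; apply: le_lt_trans z1; rewrite ler_piMl ?cmod_ge0.
Qed.

Lemma geo_cdiff o c z : cmod c <= 1 -> cmod z < 1 ->
  cdiff (geo_s o c) z /\ cdiff (geo_p o c) z.
Proof.
move=> c1 z1; have D : cdiff (fun z => (1 - c^* * z)^-1) z.
  apply: cdiffV; first exact: geo_den.
  apply: cdiffB; first exact: cdiff_cst.
  by apply: cdiffM; [exact: cdiff_cst|exact: cdiff_id].
split; apply: cdiffM => //.
  by apply: cdiffM; [exact: cdiff_cst|exact: cdiff_id].
apply: cdiffM; first by apply: cdiffM; [exact: cdiff_cst|exact: cdiff_id].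
by apply: cdiffB; [exact: cdiff_id|exact: cdiff_cst].
Qed.

Lemma geo_in_bidisc o c z : cmod o = 1 -> cmod c <= 1 -> cmod z < 1 ->
  exists x y, [/\ cmod x < 1, cmod y < 1, geo_s o c z = x + y & geo_p o c z = x * y].
Proof.
move=> o1 c1 z1; have [g gc] : exists g : C, g ^+ 2 = c by exists (sqrtc c); rewrite sqr_sqrtc.
have [w wz] : exists w : C, w ^+ 2 = z by exists (sqrtc z); rewrite sqr_sqrtc.
have w1 : cmod w < 1 by rewrite -(@expr_lt1 _ 2) ?cmod_ge0// -cmodX wz.
have g1 : cmod g <= 1 by rewrite -(@expr_le1 _ 2) ?cmod_ge0// -cmodX gc.
have D v : cmod v < 1 -> 1 - g^* * v != 0 by exact: geo_den.
have small v : cmod v < 1 -> cmod (o * v * (v - g) / (1 - g^* * v)) < 1.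
  move=> v1; rewrite !cmodM o1 mul1r cmodV -mulrA; apply: le_lt_trans (v1).
  rewrite ler_piMr ?cmod_ge0// ler_pdivrMr ?mul1r; last by rewrite cmod_gt0 D.
  rewrite -(@ler_pXn2r _ 2)// ?nnegrE ?cmod_ge0// -subr_ge0 mobius_identity.
  by rewrite mulr_ge0// subr_ge0 exprn_ile1 ?cmod_ge0// ltW.
have Nw1 : cmod (- w) < 1 by rewrite cmodN.
exists (o * w * (w - g) / (1 - g^* * w)), (o * (- w) * (- w - g) / (1 - g^* * (- w))).
have D1 := D w w1; have D2 := D _ Nw1.
have cg : (cmod c)%:C = g * g^* by rewrite -sqr_cmod -gc cmodX.
have Dz : 1 - c^* * z = (1 - g^* * w) * (1 - g^* * - w).
  by rewrite -gc -wz rmorphXn /=; ring.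
split; [exact: small|exact: small| |].
  rewrite /geo_s Dz cg -wz; field.
  by rewrite D1 D2.
rewrite /geo_p Dz -gc -wz; field.
by rewrite D1 D2.
Qed.

(** With [u c = |c|] and [w = u o^*], for which [2 w p - s = - o z (2 - w s)]: along the
    disc the test function of [sym_bidisc_test] is a rotation. *)
Lemma geo_extremal o c z : cmod o = 1 -> cmod c <= 1 -> cmod z < 1 ->
  exists2 w, cmod w = 1 &
    cmod (2 * w * geo_p o c z - geo_s o c z) = cmod z * cmod (2 - w * geo_s o c z).
Proof.
move=> o1 c1 z1; have [u [u1 uc]] := unimodular_align c.
have D := geo_den c1 z1.
have oo := unimodular_conj o1; have uu := unimodular_conj u1.
exists (u * o^*); first by rewrite cmodM cmod_conj o1 u1 mulr1.
have cE : c^*%R = u * (cmod c)%:C.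
  rewrite -[LHS]mul1r -uu -mulrA; congr (_ * _).
  by rewrite -rmorphM /= uc; congr (_ +i* _); rewrite oppr0.
have wo : u * o^* * o = u by rewrite -mulrA (mulrC _ o) oo mulr1.
have -> : 2 * (u * o^*) * geo_p o c z - geo_s o c z =
    (- o * z) * (2 - u * o^* * geo_s o c z).
  have -> : 2 * (u * o^*) * geo_p o c z =
     2 * (u * o^* * o) * o * z * (z - c) / (1 - c^* * z).
    by rewrite /geo_p expr2; ring.
  have -> : u * o^* * geo_s o c z =
     2 * (u * o^* * o) * (1 - (cmod c)%:C) * z / (1 - c^* * z).
    by rewrite /geo_s; ring.
  rewrite wo /geo_s.
  rewrite cE -uc in D.
  rewrite cE -uc.
  by field.
by rewrite !cmodM cmodN o1 mul1r.
Qed.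

Lemma quadratic_ivt (k l m x y : R) : x <= y ->
  k * x ^+ 2 + l * x + m <= 0 -> 0 <= k * y ^+ 2 + l * y + m ->
  exists2 z, x <= z <= y & k * z ^+ 2 + l * z + m = 0.
Proof.
move=> xy hx hy; pose P : {poly R} := k *: 'X^2 + l *: 'X + m%:P.
have PE (z : R) : P.[z] = k * z ^+ 2 + l * z + m by rewrite !hornerE.
have [|z] := @poly_ivt _ P x y xy; first by rewrite !PE hx.
by move=> hz /eqP; rewrite PE => h; exists z.
Qed.

(** The squared equation has the factor [1 - x ^ 2].  The other factor [phi] is quadratic;
    it changes sign between the zero [x0] of the right-hand side [eta] and 1, where the
    third hypothesis makes it positive. *)
Lemma geo_parameter (t : R) p : 0 <= t -> cmod p < 1 ->
  t * cmod (1 - p) < 1 - cmod p ^+ 2 -> (t != 0) || (p != 0) ->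
  exists2 x : R, 0 < x < 1 & 2 * cmod (x%:C ^+ 2 - p) = 2 * x * cmod (1 - p) - t * (1 - x ^+ 2).
Proof.
move=> t0 p1 h tp; set d := cmod (1 - p) in h *; set r := cmod p in p1 h *.
pose eta (x : R) := 2 * x * d - t * (1 - x ^+ 2).
pose phi (x : R) := (4 - t ^+ 2) * x ^+ 2 + (- (4 * d * t)) * x + (t ^+ 2 - 4 * r ^+ 2).
have d0 : 0 < d.
  rewrite cmod_gt0 subr_eq0; apply/eqP => p1E.
  by move: p1; rewrite /r -p1E cmod1 ltxx.
have key x : eta x ^+ 2 - (2 * cmod (x%:C ^+ 2 - p)) ^+ 2 = (1 - x ^+ 2) * phi x.
  rewrite /eta /phi exprMn sqr_cmodE.
  have -> : r ^+ 2 = complex.Re p ^+ 2 + complex.Im p ^+ 2 by exact: sqr_cmodE.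
  have dE : d ^+ 2 = (1 - complex.Re p) ^+ 2 + complex.Im p ^+ 2.
    by rewrite /d sqr_cmodE; case: (p) => p1' p2' /=; ring.
  have -> : (2 * x * d - t * (1 - x ^+ 2)) ^+ 2 =
     4 * x ^+ 2 * d ^+ 2 - 4 * d * t * x * (1 - x ^+ 2) + t ^+ 2 * (1 - x ^+ 2) ^+ 2 by ring.
  rewrite dE; case: (p) => p1' p2' /=; ring.
have [x0 /andP[x00 x01] ex0] : exists2 x0, 0 <= x0 <= 1 & eta x0 = 0.
  have [||z hz ez] := @quadratic_ivt t (2 * d) (- t) 0 1 ler01.
  - by rewrite expr0n /= !mulr0 !add0r oppr_le0.
  - by rewrite expr1n; move: d0; lra.
  by exists z => //; rewrite -ez /eta; ring.
have x0lt : x0 < 1.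
  rewrite lt_neqAle x01 andbT; apply/eqP => x0E; move: ex0.
  by rewrite x0E /eta expr1n; move: d0; lra.
have phi0 : phi x0 <= 0.
  have : (1 - x0 ^+ 2) * phi x0 <= 0.
    by rewrite -key ex0 expr0n /= sub0r oppr_le0 sqr_ge0.
  by rewrite pmulr_rle0// subr_gt0 expr_lt1.
have phi1 : 0 < phi 1 by rewrite /phi; move: h; lra.
have [x /andP[xx0 xx1] phix] := quadratic_ivt x01 phi0 (ltW phi1).
have etax : 0 <= eta x.
  rewrite -ex0 /eta -subr_ge0.
  have -> : 2 * x * d - t * (1 - x ^+ 2) - (2 * x0 * d - t * (1 - x0 ^+ 2)) =
    (x - x0) * (2 * d + t * (x + x0)) by ring.
  rewrite mulr_ge0 ?subr_ge0// addr_ge0 ?mulr_ge0 ?(ltW d0)// addr_ge0//.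
  exact: le_trans xx0.
have xpos : 0 < x.
  rewrite lt_neqAle (le_trans x00 xx0) andbT eq_sym; apply/eqP => xE.
  have x0E : x0 = 0 by apply/eqP; rewrite eq_le x00 -xE xx0.
  have tE : t = 0 by move: ex0; rewrite x0E /eta; lra.
  have r2 : r ^+ 2 = 0 by move: phix; rewrite xE tE; lra.
  move/eqP: r2; rewrite expf_eq0 /= cmod_eq0 => p0.
  by move: tp; rewrite tE p0 eqxx.
exists x.
  rewrite xpos lt_neqAle xx1 andbT; apply/eqP => xE.
  have : phi x = 0 by exact: phix.
  by rewrite xE => phi10; move: phi1; rewrite phi10 ltxx.
apply/esym/eqP; rewrite -(@eqrXn2 _ 2)// ?mulr_ge0 ?cmod_ge0//.
by rewrite -subr_eq0 [X in X == _]key [phi x]phix mulr0.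
Qed.

(** The formulas for [c] and [o] solve [geo_p o c x = p] for a given [x]; that the sum is
    [t] is then the equation of [geo_parameter]. *)
Lemma geo_solve_aligned (t : R) p : 0 <= t -> cmod p < 1 ->
  t * cmod (1 - p) < 1 - cmod p ^+ 2 ->
  exists o c (x : R), [/\ cmod o = 1, cmod c <= 1, 0 <= x < 1,
    geo_s o c x%:C = t%:C & geo_p o c x%:C = p].
Proof.
move=> t0 p1 h; have [tp|] := boolP ((t != 0) || (p != 0)); last first.
  rewrite negb_or !negbK => /andP[/eqP-> /eqP->].
  exists 1, 0, 0; rewrite cmod1 cmod0 ler01 lexx ltr01; split=> //.
    by rewrite /geo_s mulr0 mul0r.
  by rewrite /geo_p mulr0 !mul0r.
have [x /andP[x0 x1] E] := geo_parameter t0 p1 h tp.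
have xC0 : x%:C != 0 :> C by rewrite -cmod_gt0 cmod_real gtr0_norm.
have d0 : 1 - p != 0.
  by rewrite subr_eq0; apply: contraTneq p1 => <-; rewrite cmod1 ltxx.
have x2 : 0 < 1 - x ^+ 2 by rewrite subr_gt0 expr_lt1// ltW.
have xC2 : 1 - x%:C ^+ 2 != 0 :> C.
  by rewrite -rmorphXn -(rmorph1 (real_complex R)) -rmorphB /= -cmod_gt0 cmod_real gtr0_norm.
pose c : C := (x%:C ^+ 2 - p) / (x%:C * (1 - p)).
have cc : cmod c = cmod (x%:C ^+ 2 - p) / (x * cmod (1 - p)).
  by rewrite /c cmodM cmodV cmodM cmod_real gtr0_norm.
have dd : 0 < cmod (1 - p) by rewrite cmod_gt0.
have cE : cmod c = 1 - t * (1 - x ^+ 2) / (2 * x * cmod (1 - p)).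
  rewrite cc; have -> : cmod (x%:C ^+ 2 - p) = (2 * x * cmod (1 - p) - t * (1 - x ^+ 2)) / 2.
    by rewrite -E; field.
  by field; rewrite !lt0r_neq0.
have c1 : cmod c <= 1.
  by rewrite cE gerBl divr_ge0 ?mulr_ge0 ?(ltW x0) ?(ltW x2)// ltW.
have DE : 1 - c * x%:C = (1 - x%:C ^+ 2) / (1 - p) by rewrite /c; field; rewrite d0.
have D0 : 1 - c * x%:C != 0 by rewrite DE mulf_neq0 ?invr_neq0.
have DD : cmod (1 - c * x%:C) = (1 - x ^+ 2) / cmod (1 - p).
  rewrite DE cmodM cmodV -rmorphXn -(rmorph1 (real_complex R)) -rmorphB /= cmod_real.
  by rewrite gtr0_norm.
have xconj : (x%:C : C)^*%R = x%:C by congr (_ +i* _); rewrite oppr0.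
have DC : 1 - c^* * x%:C = (1 - c * x%:C)^*%R.
  rewrite [RHS]rmorphB [in RHS]rmorphM; congr (_ - _ * _); last exact/esym/xconj.
  exact/esym/rmorph1.
have D0' : 1 - c^* * x%:C != 0 by rewrite DC -cmod_gt0 cmod_conj cmod_gt0.
pose m : C := (cmod (1 - c * x%:C))%:C.
have m0 : m != 0 by rewrite -cmod_gt0 cmod_real gtr0_norm cmod_gt0.
have mm : m ^+ 2 = (1 - c * x%:C) * (1 - c^* * x%:C) by rewrite DC -sqr_cmod rmorphXn.
exists ((1 - c^* * x%:C) / m), c, x; rewrite (ltW x0) x1; split=> //.
- rewrite cmodM DC cmod_conj cmodV /m cmod_real gtr0_norm ?cmod_gt0// divff//.
  by rewrite cmod_eq0.
- have -> : geo_s ((1 - c^* * x%:C) / m) c x%:C = 2 * (1 - (cmod c)%:C) * x%:C / m.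
    by rewrite /geo_s; field; rewrite D0' m0.
  have -> : 2 * (1 - (cmod c)%:C) * x%:C / m =
     (2 * (1 - cmod c) * x / cmod (1 - c * x%:C))%:C.
    by rewrite /m !rmorphM fmorphV rmorphB rmorph1 rmorph_nat.
  congr (_%:C); rewrite DD cE; field.
  by rewrite !lt0r_neq0.
have -> : geo_p ((1 - c^* * x%:C) / m) c x%:C =
    (1 - c^* * x%:C) * x%:C * (x%:C - c) / m ^+ 2.
  by rewrite /geo_p; field; rewrite D0' m0.
rewrite mm; have -> : (1 - c^* * x%:C) * x%:C * (x%:C - c) / ((1 - c * x%:C) * (1 - c^* * x%:C))
    = x%:C * (x%:C - c) / (1 - c * x%:C) by field; rewrite D0 D0'.
rewrite DE /c; field.
by rewrite d0 xC0 xC2.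
Qed.

(** A rotation makes the sum real. *)
Lemma geo_solve a b : cmod a < 1 -> cmod b < 1 ->
  exists o c (x : R), [/\ cmod o = 1, cmod c <= 1, 0 <= x < 1,
    geo_s o c x%:C = a + b & geo_p o c x%:C = a * b].
Proof.
move=> a1 b1; have [v [v1 vs]] := unimodular_align (a + b).
have vv := unimodular_conj v1.
have := sym_bidisc a1 b1; set s := a + b in vs *; set p := a * b => h.
have sE : s = v^* * (cmod s)%:C by rewrite -vs mulrA (mulrC _ v) vv mul1r.
have h' : cmod s * cmod (1 - v ^+ 2 * p) < 1 - cmod (v ^+ 2 * p) ^+ 2.
  rewrite cmodM cmodX v1 expr1n mul1r; apply: le_lt_trans h.
  have sC : s^*%R = v * (cmod s)%:C.
    by rewrite sE rmorphM /= conjCK -sE; congr (_ * (_ +i* _)); rewrite oppr0.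
  have -> : s - s^* * p = v^* * (cmod s)%:C * (1 - v ^+ 2 * p).
    rewrite sC mulrBr mulr1 -sE; congr (_ - _).
    by rewrite -vs; ring.
  by rewrite !cmodM cmod_conj v1 mul1r cmod_real ger0_norm ?cmod_ge0.
have p1 : cmod (v ^+ 2 * p) < 1.
  rewrite cmodM cmodX v1 expr1n mul1r cmodM; apply: le_lt_trans b1.
  by rewrite ler_piMl ?cmod_ge0// ltW.
have [om [c [x [om1 c1 x1 sx px]]]] := geo_solve_aligned (cmod_ge0 s) p1 h'.
exists (v^* * om), c, x; rewrite cmodM cmod_conj v1 om1 mulr1; split=> //.
  have -> : geo_s (v^* * om) c x%:C = v^* * geo_s om c x%:C by rewrite /geo_s; ring.
  by rewrite sx -sE.
have -> : geo_p (v^* * om) c x%:C = v^* ^+ 2 * geo_p om c x%:C by rewrite /geo_p; ring.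
have -> : v^* ^+ 2 * geo_p om c x%:C = v^* ^+ 2 * (v ^+ 2 * p) by rewrite px.
by rewrite mulrA -exprMn (mulrC _ v) vv expr1n mul1r.
Qed.

End SymmetrizedBidisc.

(** * Two by two matrices *)

Lemma ord2 (i : 'I_2) : i = 0 \/ i = 1.
Proof. by case: i => -[|[|//]] i; [left|right]; apply: val_inj. Qed.

Lemma trace2 (F : comNzRingType) (A : 'M[F]_2) : \tr A = A 0 0 + A 1 1.
Proof. by rewrite /mxtrace !big_ord_recl big_ord0 addr0; congr (_ + A _ _); apply: val_inj. Qed.

Lemma det2 (F : comNzRingType) (A : 'M[F]_2) : \det A = A 0 0 * A 1 1 - A 0 1 * A 1 0.
Proof.
rewrite (expand_det_row _ 0) !big_ord_recl big_ord0 addr0 /cofactor !det_mx11 !mxE /=.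
rewrite expr0 expr1 mul1r mulN1r mulrN.
by congr (_ * A _ _ - A _ _ * A _ _); apply: val_inj.
Qed.

Section TwoByTwo.
Variable F : fieldType.
Implicit Types (A : 'M[F]_2) (s p : F).

Lemma char_poly2 A a b : \tr A = a + b -> \det A = a * b ->
  char_poly A = ('X - a%:P) * ('X - b%:P).
Proof.
move=> tA dA; have -> : ('X - a%:P) * ('X - b%:P) = 'X^2 - (\tr A)%:P * 'X + (\det A)%:P.
  by rewrite tA dA !polyCD !polyCM; ring.
apply/polyP => -[|[|[|k]]].
- by rewrite char_poly_det expr2 mulrNN !mul1r !(coefXn, coefD, coefN, coefMX, coefC, coefCM) /= subr0 add0r.
- have := @char_poly_trace _ 2 A isT => /= ->.
  by rewrite !(coefXn, coefD, coefN, coefMX, coefC, coefCM) /= addr0 add0r.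
- have := char_poly_monic A; rewrite monicE /lead_coef size_char_poly /= => /eqP ->.
  by rewrite !(coefXn, coefD, coefN, coefMX, coefC, coefCM) /= subr0 addr0.
rewrite nth_default ?size_char_poly//.
by rewrite !(coefXn, coefD, coefN, coefMX, coefC, coefCM) /= subr0 addr0.
Qed.

Lemma trace_det2 A a b : char_poly A = ('X - a%:P) * ('X - b%:P) ->
  \tr A = a + b /\ \det A = a * b.
Proof.
move=> cA; have := @char_poly_trace _ 2 A isT; have := char_poly_det A.
rewrite cA expr2 mulrNN !mul1r mulrBl !mulrBr -!polyCM.
rewrite !(coefB, coefXM, coefMX, coefCM, coefX, coefC) /=.
rewrite !(mulr0, mulr1, subr0, sub0r) => <- E.
by split; [apply: oppr_inj; rewrite -E; ring|ring].
Qed.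

Definition companion2 s p : 'M[F]_2 :=
  \matrix_(i, j) (if i == 0 then (j == 1)%:R else if j == 0 then - p else s).

Lemma companion2_trace_det s p : \tr (companion2 s p) = s /\ \det (companion2 s p) = p.
Proof.
by rewrite trace2 det2 !mxE /=; split; ring.
Qed.

(** A non-scalar matrix has a row vector that is not an eigenvector. *)
Lemma nonscalar_companion2 A : ~~ is_scalar_mx A ->
  exists2 P, P \in unitmx & P *m A *m invmx P = companion2 (\tr A) (\det A).
Proof.
move=> nA.
have [v Hv] : exists v : F * F,
    v.1 * (v.1 * A 0 1 + v.2 * A 1 1) - v.2 * (v.1 * A 0 0 + v.2 * A 1 0) != 0.
  apply: contrapT => N.
  have H x y : x * (x * A 0 1 + y * A 1 1) - y * (x * A 0 0 + y * A 1 0) = 0.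
    by apply/eqP; apply: contrapT => h; apply: N; exists (x, y); apply/negP.
  have a01 : A 0 1 = 0 by have := H 1 0; rewrite !(mul1r, mul0r, addr0, subr0).
  have a10 : A 1 0 = 0.
    by have := H 0 1; rewrite !(mul1r, mul0r, add0r, sub0r) => /eqP; rewrite oppr_eq0 => /eqP.
  have a11 : A 1 1 = A 0 0.
    by have := H 1 1; rewrite a01 a10 !(mul1r, add0r, addr0) => /eqP; rewrite subr_eq0 => /eqP.
  move/negP: nA; apply; apply/is_scalar_mxP; exists (A 0 0).
  apply/matrixP => i j; rewrite !mxE.
  by case: (ord2 i) => ->; case: (ord2 j) => -> //=; rewrite ?mulr1n ?mulr0n.
case: v Hv => x y /= Hv.
pose w (j : 'I_2) := x * A 0 j + y * A 1 j.
pose P : 'M[F]_2 := \matrix_(i, j) if i == 0 then if j == 0 then x else y else w j.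
have uP : P \in unitmx by rewrite unitmxE unitfE det2 !mxE /=.
exists P => //; apply: (canLR (mulmxK uP)).
apply/matrixP => i j; rewrite !mxE !big_ord_recl !big_ord0 !addr0 !mxE /=.
rewrite (_ : lift ord0 ord0 = 1); last exact: val_inj.
rewrite (_ : ord0 = 0); last exact: val_inj.
rewrite trace2 det2 /w.
by case: (ord2 i) => ->; case: (ord2 j) => -> /=; ring.
Qed.

End TwoByTwo.

(** * Nilpotent base points in dimension two *)

Section NilpotentTwo.
Variable R : realType.
Notation C := R[i].
Implicit Types (A B N : 'M[C]_2).
Notation ball := (spectral_ball R 2).
Notation lemp := (lempert ball).

Lemma in_ball2 A (a b : C) : \tr A = a + b -> \det A = a * b ->
  cmod a < 1 -> cmod b < 1 -> ball A.
Proof.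
move=> tA dA a1 b1; have cA := char_poly2 tA dA.
apply/(@in_ball_prod _ _ _ (fun i : 'I_2 => if i == 0 then a else b)).
  by rewrite cA !big_ord_recl big_ord0 mulr1.
by move=> i; case: ifP.
Qed.

Lemma in_ball2_ex A : ball A ->
  exists a b : C, [/\ cmod a < 1, cmod b < 1, \tr A = a + b & \det A = a * b].
Proof.
have [d cA] := char_poly_split A.
move=> /(in_ball_prod cA) H; exists (d 0), (d 1).
have [|tA dA] := @trace_det2 _ A (d 0) (d 1).
  by rewrite cA !big_ord_recl big_ord0 mulr1; congr (_ * ('X - (d _)%:P)); apply: val_inj.
by split.
Qed.

Lemma mdiff_companion2 (s p : C -> C) z : cdiff s z -> cdiff p z ->
  mdiff (fun w => companion2 (s w) (p w)) z.
Proof.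
move=> ds dp i j.
apply: (@cdiff_ext _ (fun w => if i == 0 then (j == 1)%:R else if j == 0 then (-1) * p w else s w) _ _ 1) => //.
  by move=> w _; rewrite [RHS]mxE mulN1r.
case: (i == 0); first exact: cdiff_cst.
by case: (j == 0) => //; apply: cdiffM => //; exact: cdiff_cst.
Qed.

(** The extremal discs of the symmetrized bidisc, slowed down so as to reach their point
    at a later parameter. *)
Lemma disc_companion2 (o c : C) (x r : R) : cmod o = 1 -> cmod c <= 1 -> 0 <= x ->
  x <= r -> 0 < r -> r < 1 ->
  disc (companion2 0 0) (companion2 (geo_s o c x%:C) (geo_p o c x%:C)) r%:C.
Proof.
move=> o1 c1 x0 xr r0 r1; have rC : r%:C != 0 :> C by rewrite -cmod_gt0 cmod_real gtr0_norm.
split; first by rewrite cmod_real gtr0_norm.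
pose k : C := x%:C / r%:C.
have k1 : cmod k <= 1.
  by rewrite /k cmodM cmodV !cmod_real (ger0_norm x0) (gtr0_norm r0) ler_pdivrMr// mul1r.
exists (fun z => companion2 (geo_s o c (z * k)) (geo_p o c (z * k))); split.
- move=> z z1; have zk : cmod (z * k) < 1.
    by rewrite cmodM; apply: le_lt_trans z1; rewrite ler_piMr ?cmod_ge0.
  have [ds dp] := geo_cdiff o c1 zk.
  have dk : cdiff (fun z : C => z * k) z by apply: cdiffM; [exact: cdiff_id|exact: cdiff_cst].
  split.
    apply: mdiff_companion2.
      by apply: (@cdiff_comp _ (fun z : C => z * k) (geo_s o c)).
    by apply: (@cdiff_comp _ (fun z : C => z * k) (geo_p o c)).
  have [a [b [a1 b1 sE pE]]] := geo_in_bidisc o1 c1 zk.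
  have [tE dE] := companion2_trace_det (geo_s o c (z * k)) (geo_p o c (z * k)).
  by apply: (in_ball2 _ _ a1 b1); rewrite ?tE ?dE.
- by rewrite mul0r /geo_s /geo_p !mulr0 !mul0r.
- by rewrite /k mulrCA divff// mulr1.
Qed.

Lemma scalar_test (m w : C) : cmod w = 1 -> cmod m < 1 ->
  cmod (2 * w * (m * m) - (m + m)) = cmod m * cmod (2 - w * (m + m)).
Proof.
move=> w1 m1; rewrite -cmodM; have -> : m * (2 - w * (m + m)) = - (2 * w * (m * m) - (m + m)) by ring.
by rewrite cmodN.
Qed.

(** A scalar matrix is not similar to a companion matrix: the disc consists of upper
    triangular matrices whose off-diagonal entry decreases from 1 to 0. *)
Lemma disc_scalar2 (m : C) (r : R) : cmod m <= r -> 0 < r -> r < 1 ->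
  disc (companion2 0 0) (m%:M : 'M[C]_2) r%:C.
Proof.
move=> mr r0 r1; have rC : r%:C != 0 :> C by rewrite -cmod_gt0 cmod_real gtr0_norm.
split; first by rewrite cmod_real gtr0_norm.
pose f (z : C) : 'M[C]_2 := \matrix_(i, j)
  (if i == j then z * (m / r%:C) else if i == 0 then 1 - z / r%:C else 0).
exists f; split.
- move=> z z1; split.
    move=> i j; have dz (k : C) : cdiff (fun z : C => z * k) z.
      by apply: cdiffM; [exact: cdiff_id|exact: cdiff_cst].
    apply: (@cdiff_ext _ (fun z => if i == j then z * (m / r%:C) else if i == 0 then 1 - z / r%:C else 0) _ _ 1) => //.
      by move=> w _; rewrite [RHS]mxE.
    case: (i == j); first exact: dz.
    case: (i == 0); last exact: cdiff_cst.
    by apply: cdiffB; [exact: cdiff_cst|exact: dz].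
  have zm : cmod (z * (m / r%:C)) < 1.
    rewrite !cmodM cmodV cmod_real gtr0_norm//; apply: le_lt_trans z1.
    by rewrite ler_piMr ?cmod_ge0// ler_pdivrMr// mul1r.
  by apply: (in_ball2 _ _ zm zm); rewrite ?trace2 ?det2 !mxE /= ?mulr0 ?subr0.
- apply/matrixP => i j; rewrite !mxE !mul0r subr0.
  by case: (ord2 i) => ->; case: (ord2 j) => -> //=; rewrite oppr0.
apply/matrixP => i j; rewrite !mxE mulrCA !divff// mulr1 subrr.
by case: (i == j) => /=; rewrite ?mulr1n ?mulr0n ?if_same.
Qed.

Definition nilpotent2 N := [/\ ~~ is_scalar_mx N, \tr N = 0 & \det N = 0].

(** [x] is the value of the Lempert function at [(N, B)], by [disc_nilpotent2_ge]. *)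
Lemma disc_nilpotent2 N B : nilpotent2 N -> ball B -> exists (x : R) (w : C),
  [/\ 0 <= x < 1, cmod w = 1,
     cmod (2 * w * \det B - \tr B) = x * cmod (2 - w * \tr B) &
     forall r : R, x <= r -> 0 < r -> r < 1 -> disc N B r%:C].
Proof.
move=> [sN tN dN] OB; have [a [b [a1 b1 tB dB]]] := in_ball2_ex OB.
have [P uP PE] := nonscalar_companion2 sN; rewrite tN dN in PE.
have NE : N = invmx P *m companion2 0 0 *m invmx (invmx P).
  by rewrite invmxK -PE -!mulmxA mulVmx// mulmx1 mulKmx.
suff [x [w [x01 w1 E H]]] : exists (x : R) (w : C),
  [/\ 0 <= x < 1, cmod w = 1,
     cmod (2 * w * \det B - \tr B) = x * cmod (2 - w * \tr B) &
     forall r : R, x <= r -> 0 < r -> r < 1 -> disc (companion2 0 0) B r%:C].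
  exists x, w; split=> // r xr r0 r1; rewrite NE.
  apply: disc_conj_l; first by rewrite unitmx_inv.
    by rewrite -cmod_gt0 cmod_real gtr0_norm.
  exact: H.
have [/is_scalar_mxP[m Bm]|sB] := boolP (is_scalar_mx B).
  have tm : \tr B = m + m by rewrite trace2 Bm !mxE.
  have dm : \det B = m * m by rewrite det2 Bm !mxE /= mulr0n mulr0 subr0.
  have m1 : cmod m < 1.
    move/in_ballP: OB; apply; rewrite Bm.
    have := char_poly2 tm dm; rewrite Bm eigenvalue_root_char => ->.
    by rewrite rootM root_XsubC eqxx.
  exists (cmod m), 1; rewrite cmod_ge0 m1 cmod1; split=> //.
    by rewrite tm dm; apply: scalar_test; rewrite ?cmod1.
  by move=> r mr r0 r1; rewrite Bm; exact: disc_scalar2.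
have [om [c [x [om1 c1 /andP[x0 x1] sE pE]]]] := geo_solve a1 b1.
have xC : cmod (x%:C : C) < 1 by rewrite cmod_real ger0_norm.
have [w w1] := geo_extremal om1 c1 xC; rewrite sE pE -tB -dB cmod_real ger0_norm// => E.
exists x, w; rewrite x0 x1; split=> // r xr r0 r1.
have [Q uQ QE] := nonscalar_companion2 sB; 
have -> : B = invmx Q *m companion2 (\tr B) (\det B) *m invmx (invmx Q).
  by rewrite invmxK -QE -!mulmxA mulVmx// mulmx1 mulKmx.
apply: disc_conj_r; first by rewrite unitmx_inv.
  by rewrite -cmod_gt0 cmod_real gtr0_norm.
by rewrite tB dB -sE -pE; exact: disc_companion2.
Qed.

(** The Schwarz lemma for the test function of [sym_bidisc_test] along the disc. *)
Lemma disc_nilpotent2_ge N B (z w : C) : nilpotent2 N -> disc N B z -> cmod w = 1 ->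
  cmod (2 * w * \det B - \tr B) <= cmod z * cmod (2 - w * \tr B).
Proof.
move=> [sN tN dN] [z1 [f [Hf f0 fz]]] w1.
have den y : cmod y < 1 -> 2 - w * \tr (f y) != 0.
  move=> y1; have [a [b [a1 b1 -> _]]] := in_ball2_ex (Hf y y1).2.
  apply: contraTneq (ltrD a1 b1) => /eqP; rewrite subr_eq0 => /eqP E.
  have : cmod (2 : C) = 2 by exact: cmod_nat.
  rewrite E cmodM w1 mul1r => E2; rewrite -leNgt; apply: le_trans (ler_cmodD _ _).
  by rewrite E2.
have dtr y : cmod y < 1 -> cdiff (fun y => \tr (f y)) y.
  move=> y1; rewrite /mxtrace; apply: cdiff_sum => i _; exact: (Hf y y1).1.
have ddet y : cmod y < 1 -> cdiff (fun y => \det (f y)) y.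
  by move=> y1; apply: cdiff_det; exact: (Hf y y1).1.
pose h y := (2 * w * \det (f y) - \tr (f y)) / (2 - w * \tr (f y)).
have dh y : cmod y < 1 -> cdiff h y.
  move=> y1; apply: cdiffM.
    apply: cdiffB; last exact: dtr.
    by apply: cdiffM; [exact: cdiff_cst|exact: ddet].
  apply: cdiffV; first exact: den.
  apply: cdiffB; first exact: cdiff_cst.
  by apply: cdiffM; [exact: cdiff_cst|exact: dtr].
have h0 : h 0 = 0 by rewrite /h f0 tN dN mulr0 subr0 mul0r.
have h1 y : cmod y < 1 -> cmod (h y) <= 1.
  move=> y1; have := den y y1; rewrite /h; have [a [b [a1 b1 -> ->]]] := in_ball2_ex (Hf y y1).2.
  by move=> D; rewrite cmodM cmodV ler_pdivrMr ?cmod_gt0// mul1r sym_bidisc_test.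
have := schwarz ler01 dh h0 h1 z1; rewrite mul1r /h fz cmodM cmodV ler_pdivrMr//.
by rewrite cmod_gt0 -fz den.
Qed.

(** The Lempert function is the maximum over [|w| = 1] of
    [|2 w det B - tr B| / |2 - w tr B|]; in particular it depends on the trace and the
    determinant only. *)
Lemma lempert_nilpotent2 N B : nilpotent2 N -> ball B ->
  (exists2 w : C, cmod w = 1 & cmod (2 * w * \det B - \tr B) = lemp N B * cmod (2 - w * \tr B)) /\
  forall w : C, cmod w = 1 -> cmod (2 * w * \det B - \tr B) <= lemp N B * cmod (2 - w * \tr B).
Proof.
move=> nN OB; have [x [w [/andP[x0 x1] w1 E H]]] := disc_nilpotent2 nN OB.
have D w' : cmod w' = 1 -> 0 < cmod (2 - w' * \tr B).
  move=> w'1; have [a [b [a1 b1 -> _]]] := in_ball2_ex OB.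
  have := ler_cmod_dist 2 (w' * (a + b)); have := ler_cmodD a b.
  by rewrite cmodM w'1 mul1r (cmod_nat R 2); move: a1 b1; lra.
suff -> : lemp N B = x.
  split; first by exists w.
  move=> w' w'1; rewrite -ler_pdivrMr ?D//; apply/ler_addgt0Pr => e e0.
  pose r := Num.min (x + e) ((1 + x) / 2).
  have r0 : 0 < r by rewrite lt_min; apply/andP; split; lra.
  have r1 : r < 1 by rewrite gt_min; apply/orP; right; lra.
  have xr : x <= r by rewrite le_min; apply/andP; split; lra.
  have := disc_nilpotent2_ge nN (H r xr r0 r1) w'1.
  rewrite -ler_pdivrMr ?D// cmod_real gtr0_norm// => h; apply: le_trans h _.
  by rewrite /r ge_min lexx.
apply/eqP; rewrite eq_le; apply/andP; split.
  apply/ler_addgt0Pr => e e0.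
  pose r := Num.min (x + e) ((1 + x) / 2).
  have r0 : 0 < r by rewrite lt_min; apply/andP; split; lra.
  have r1 : r < 1 by rewrite gt_min; apply/orP; right; lra.
  have xr : x <= r by rewrite le_min; apply/andP; split; lra.
  apply: le_trans (lempert_le (H r xr r0 r1)) _.
  by rewrite cmod_real gtr0_norm// /r ge_min lexx.
have r0 : 0 < (1 + x) / 2 by lra.
have r1 : (1 + x) / 2 < 1 by lra.
have xr : x <= (1 + x) / 2 by lra.
apply: lempert_ge (H _ xr r0 r1) _ => z dz.
by have := disc_nilpotent2_ge nN dz w1; rewrite E ler_pM2r ?D.
Qed.

(** The two values are compared at a [w] that is extremal for [B']. *)
Lemma lempert_nilpotent2_lip N B B' (m : R) : nilpotent2 N -> ball B -> ball B' ->
  0 < m -> cmod (\tr B) <= 2 - m -> cmod (\tr B') <= 2 - m ->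
  (lemp N B' - lemp N B) * m <=
    2 * cmod (\det B' - \det B) + 2 * cmod (\tr B' - \tr B).
Proof.
move=> nN OB OB' m0 hB hB'; have [[w w1 E] _] := lempert_nilpotent2 nN OB'.
have [_ /(_ w w1) H] := lempert_nilpotent2 nN OB.
have l0 : 0 <= lemp N B.
  exact: lempert_ge0.
have l1 : lemp N B < 1.
  have [x [_ [/andP[x0 x1] _ _ dB]]] := disc_nilpotent2 nN OB.
  by apply: (@lempert_lt1 _ _ _ _ ((1 + x) / 2)%:C); apply: dB; lra.
have [|ll] := leP (lemp N B' - lemp N B) 0.
  move=> ll; apply: (@le_trans _ _ 0); first by rewrite mulr_le0_ge0// ltW.
  by rewrite addr_ge0// mulr_ge0// cmod_ge0.
have c2 : cmod (2 : C) = 2 by exact: cmod_nat.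
have mw : m <= cmod (2 - w * \tr B').
  by have := ler_cmod_dist 2 (w * \tr B'); rewrite c2 cmodM w1 mul1r; lra.
apply: le_trans (ler_wpM2l (ltW ll) mw) _.
have e1 : cmod (2 * w * \det B' - \tr B') <=
    cmod (2 * w * \det B - \tr B) + 2 * cmod (\det B' - \det B) + cmod (\tr B' - \tr B).
  have -> : 2 * w * \det B' - \tr B' =
     (2 * w * \det B - \tr B) + 2 * w * (\det B' - \det B) + - (\tr B' - \tr B) by ring.
  apply: le_trans (ler_cmodD _ _) _; rewrite cmodN lerD2r.
  by apply: le_trans (ler_cmodD _ _) _; rewrite !cmodM c2 w1 mulr1.
have e2 : cmod (2 - w * \tr B) <= cmod (2 - w * \tr B') + cmod (\tr B' - \tr B).
  have -> : 2 - w * \tr B = (2 - w * \tr B') + w * (\tr B' - \tr B) by ring.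
  by apply: le_trans (ler_cmodD _ _) _; rewrite cmodM w1 mul1r.
have e3 := ler_wpM2l l0 e2.
have e4 : lemp N B * cmod (\tr B' - \tr B) <= cmod (\tr B' - \tr B).
  by rewrite ler_piMl ?cmod_ge0// ltW.
move: H e1 e3 e4; rewrite E mulrDr mulrBl; lra.
Qed.

Lemma lcont_nilpotent2 N : nilpotent2 N -> lcont N.
Proof.
move=> nN B OB e e0; have [a [b [a1 b1 tB _]]] := in_ball2_ex OB.
pose m := (2 - cmod (\tr B)) / 2.
have m0 : 0 < m by rewrite /m tB; have := ler_cmodD a b; move: a1 b1; lra.
have T1 : tends (entry_dist B) (fun B' => \tr B') (\tr B).
  by apply: tends_sum => i _; exact: tends_entry.
have T2 : tends (entry_dist B) (fun B' => \det B') (\det B).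
  by apply: tends_det => i j; exact: tends_entry.
pose e' := Num.min m (e * m / 8).
have em : 0 < e * m by rewrite mulr_gt0.
have e'0 : 0 < e' by rewrite lt_min m0; lra.
have [d1 d10 H1] := T1 e' e'0; have [d2 d20 H2] := T2 e' e'0.
have d0 : 0 < Num.min d1 d2 by rewrite lt_min d10.
have [dl dl0 Hd] := entry_dist_lt B d0; exists dl => // B' OB' /Hd.
rewrite lt_min => /andP[/H1 h1 /H2 h2].
have e'm : e' <= m by rewrite ge_min lexx.
have e'e : e' <= e * m / 8 by rewrite ge_min lexx orbT.
have hB : cmod (\tr B) <= 2 - m by move: m0; rewrite /m; lra.
have hB' : cmod (\tr B') <= 2 - m.
  have := ler_cmod_dist (\tr B') (\tr B); move: h1 e'm; rewrite /m; lra.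
have L1 := lempert_nilpotent2_lip nN OB OB' m0 hB hB'.
have L2 := lempert_nilpotent2_lip nN OB' OB m0 hB' hB.
rewrite (cmodBC (\det B)) (cmodBC (\tr B)) in L2.
rewrite ltr_norml; apply/andP; split.
  rewrite ltrNl opprB -(ltr_pM2r m0); move: L2 h1 h2 e'e em; lra.
rewrite -(ltr_pM2r m0); move: L1 h1 h2 e'e em; lra.
Qed.

Lemma cyclic_nonscalar (A : 'M[C]_2) : cyclic_mx A -> ~~ is_scalar_mx A.
Proof.
move=> [v Hv]; apply/negP => /is_scalar_mxP[m Am].
have : (fullv <= <[v]>)%VS.
  rewrite -Hv; apply/span_subvP => _ /mapP[i _ ->].
  rewrite Am -rmorphXn mul_scalar_mx; exact: memvZ (memv_line v).
by move=> /dimvS; rewrite dimvf /= dim_vline /dim /=; case: (v != 0).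
Qed.

(** The transpose is similar to a companion matrix, whose first row is cyclic. *)
Lemma nonscalar_cyclic (A : 'M[C]_2) : ~~ is_scalar_mx A -> cyclic_mx A.
Proof.
move=> sA; have sAT : ~~ is_scalar_mx A^T.
  apply: contra sA => /is_scalar_mxP[m Am]; apply/is_scalar_mxP; exists m.
  by rewrite -[A]trmxK Am tr_scalar_mx.
have [P uP PE] := nonscalar_companion2 sAT.
have r1 : row 1 P = row 0 P *m A^T.
  rewrite -row_mul; have -> : P *m A^T = companion2 (\tr A^T) (\det A^T) *m P.
    by rewrite -PE mulmxKV.
  apply/rowP => j; rewrite !mxE !big_ord_recl big_ord0 !mxE /= mul0r mul1r add0r addr0.
  by congr (P _ _); apply: val_inj.
pose v := (row 0 P)^T; exists v; apply/eqP; rewrite eqEsubv subvf /=.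
apply/subvP => x _.
have -> : x = ((x^T *m invmx P) 0 0) *: (A ^+ 0 *m v) + ((x^T *m invmx P) 0 1) *: (A ^+ 1 *m v).
  rewrite expr0 expr1 mul1mx; have -> : A *m v = (row 1 P)^T by rewrite r1 trmx_mul trmxK.
  rewrite -!linearZ -linearD /= -[LHS]trmxK -[x^T in LHS](mulmxKV uP); congr trmx.
  move: (x^T *m invmx P) => y.
  apply/rowP => j; rewrite !mxE !big_ord_recl big_ord0 addr0.
  by congr (y _ _ * P _ _ + y _ _ * P _ _); apply: val_inj.
apply: memvD; apply: memvZ; apply: memv_span.
  exact: mem_head.
by rewrite inE mem_seq1 eqxx orbT.
Qed.

Lemma mobius_scalar n (t m : C) : is_scalar_mx (mobius_mx t (m%:M : 'M[C]_n)).
Proof.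
apply/is_scalar_mxP; exists ((m - t) * (1 - t^* * m)^-1).
by rewrite /mobius_mx scale_scalar_mx -!raddfB /= invmx_scalar -scalar_mxM.
Qed.

Lemma lcont_cyclic2 (A : 'M[C]_2) : ball A -> cyclic_mx A -> two_equal_eigenvalues A -> lcont A.
Proof.
move=> OA /cyclic_nonscalar sA [a cA].
have cA' : char_poly A = \prod_(i < 2) ('X - a%:P).
  by rewrite big_const_ord /= mulr1 -expr2.
have a1 : cmod a < 1 by exact: ((in_ball_prod cA').1 OA 0).
apply: (lcont_mobius a1) => //; apply: lcont_nilpotent2.
have := char_poly_mobius a1 OA cA'; rewrite big_const_ord /= mulr1.
rewrite {1}/mobius subrr mul0r {1}/mobius subrr mul0r => /trace_det2[].
rewrite addr0 mulr0 => tN dN; split=> //.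
apply/negP => /is_scalar_mxP[m Em]; move/negP: sA; apply.
by rewrite -(mobius_mxK a1 OA) Em mobius_scalar.
Qed.

End NilpotentTwo.

(** * Base points with several eigenvalues *)

Section Reach.
Variable R : realType.
Notation C := R[i].

(** The center need not be 0: at a point of continuity a disc to a nilpotent matrix is as
    good as a disc to 0, by [lcont_le_diag]. *)
Definition reach n (A : 'M[C]_n) (r : R) := exists f : C -> 'M[C]_n,
  [/\ forall z, cmod z < 1 -> mdiff f z /\ spectral_ball R n (f z),
      char_poly (f 0) = 'X^n & f r%:C = A].

Lemma reach_conj n (A P : 'M[C]_n) r : P \in unitmx ->
  reach A r -> reach (P *m A *m invmx P) r.
Proof.
move=> uP [f [Hf f0 fr]]; exists (fun z => P *m f z *m invmx P); split; last by rewrite fr.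
  move=> z z1; have [df fz] := Hf z z1; split; last by apply: in_ball_char_poly fz; rewrite char_poly_conj.
  apply: mdiffM; last exact: mdiff_cst.
  by apply: mdiffM => //; exact: mdiff_cst.
by rewrite char_poly_conj.
Qed.

Lemma reach_conjE n (A P : 'M[C]_n) r : P \in unitmx ->
  reach (P *m A *m invmx P) r -> reach A r.
Proof.
move=> uP; have uP' : invmx P \in unitmx by rewrite unitmx_inv.
by move=> /(reach_conj uP'); rewrite invmxK -!mulmxA mulVmx// mulmx1 mulKmx.
Qed.

Lemma reach_block n1 n2 (A1 : 'M[C]_n1) (D : 'M[C]_(n2, n1)) (A2 : 'M[C]_n2) r :
  reach A1 r -> reach A2 r -> reach (block_mx A1 0 D A2 : 'M[C]_(n1 + n2)) r.
Proof.
move=> [f [Hf f0 fr]] [g [Hg g0 gr]]; exists (fun z => block_mx (f z) 0 D (g z)); split.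
- move=> z z1; have [df fz] := Hf z z1; have [dg gz] := Hg z z1; split.
    move=> i j; case: (split_ordP i) => i' ->; case: (split_ordP j) => j' ->.
    + by apply: (@cdiff_ext _ (fun w => f w i' j') _ _ 1) => // w _; rewrite block_mxEul.
    + by apply: (@cdiff_ext _ (fun w => (0 : 'M[C]_(n1, n2)) i' j') _ _ 1) => // [w _|];
        [rewrite block_mxEur|exact: cdiff_cst].
    + by apply: (@cdiff_ext _ (fun w => D i' j') _ _ 1) => // [w _|];
        [rewrite block_mxEdl|exact: cdiff_cst].
    + by apply: (@cdiff_ext _ (fun w => g w i' j') _ _ 1) => // w _; rewrite block_mxEdr.
  apply/in_ballP => a; rewrite eigenvalue_root_char char_poly_block rootM.
  rewrite -!eigenvalue_root_char => /orP[]; first by move/in_ballP: fz; apply.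
  by move/in_ballP: gz; apply.
- by rewrite char_poly_block f0 g0 -exprD.
- by rewrite fr gr.
Qed.

Lemma reach0 (A : 'M[C]_0) r : reach A r.
Proof.
exists (fun=> A); split=> // [z z1|]; last by rewrite expr0 /char_poly det_mx00.
split; first exact: mdiff_cst.
by apply/in_ballP => a; rewrite eigenvalue_root_char /char_poly det_mx00 rootC oner_eq0.
Qed.

Lemma reach1 (A : 'M[C]_1) (r : R) : 0 < r -> cmod (A 0 0) <= r -> reach A r.
Proof.
move=> r0 Ar; have rC : r%:C != 0 :> C by rewrite -cmod_gt0 cmod_real gtr0_norm.
have cE (M : 'M[C]_1) : char_poly M = \prod_(i < 1) ('X - (M 0 0)%:P).
  by rewrite char_poly_trig ?mx11_is_trig// !big_ord1.
exists (fun z => (z / r%:C) *: A); split.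
- move=> z z1; split.
    apply: mdiffZ; last exact: mdiff_cst.
    by apply: cdiffM; [exact: cdiff_id|exact: cdiff_cst].
  apply/(in_ball_prod (cE _)) => _; rewrite mxE !cmodM cmodV cmod_real gtr0_norm//.
  apply: le_lt_trans z1; rewrite -mulrA ler_piMr ?cmod_ge0//.
  by rewrite ler_pdivrMl// mulr1.
- by rewrite cE big_ord1 mxE !mul0r subr0.
- by rewrite divff// scale1r.
Qed.

(** The difference of the squares is affine and decreasing in the real part of [w]; at
    [w = 1] it has the factor [(T - t) (1 - T)]. *)
Lemma ray_test (w : C) (t T : R) : cmod w = 1 -> 0 <= t -> t < T -> T < 1 ->
  cmod (2 * w * (t * T)%:C - (t + T)%:C) < T * cmod (2 - w * (t + T)%:C).
Proof.
move=> w1 t0 tT T1; have T0 : 0 < T by exact: le_lt_trans tT.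
rewrite -(@ltr_pXn2r _ 2)// ?nnegrE ?mulr_ge0 ?cmod_ge0 ?(ltW T0)// exprMn !sqr_cmodE.
have : complex.Re w ^+ 2 + complex.Im w ^+ 2 = 1 by rewrite -sqr_cmodE w1 expr1n.
have : complex.Re w <= 1 by rewrite -w1 ler_Re_cmod.
case: w {w1} => k q /= k1 kq; rewrite -subr_gt0.
rewrite (_ : _ - _ = (T * (2 - (t + T)) - (t + T - 2 * (t * T))) *
    (T * (2 - (t + T)) + (t + T - 2 * (t * T))) + 4 * (t + T) * (T * (T - t)) * (1 - k)
   + (T ^+ 2 * (t + T) ^+ 2 - 4 * (t * T) ^+ 2) * (k ^+ 2 + q ^+ 2 - 1)); last by ring.
rewrite kq subrr mulr0 addr0 ltr_wpDr ?mulr_ge0 ?subr_ge0 ?addr_ge0 ?(ltW T0) ?(ltW tT)//.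
rewrite (_ : T * (2 - (t + T)) - (t + T - 2 * (t * T)) = (T - t) * (1 - T)); last by ring.
rewrite (_ : T * (2 - (t + T)) + (t + T - 2 * (t * T)) =
   T * ((1 - T) + (1 - t)) + (t * (1 - T) + T * (1 - t))); last by ring.
have t1 : t < 1 by exact: lt_trans T1.
have T1' : 0 < 1 - T by rewrite subr_gt0.
have t1' : 0 < 1 - t by rewrite subr_gt0.
have tT' : 0 < T - t by rewrite subr_gt0.
have h1 : 0 < T * (1 - T + (1 - t)) by rewrite mulr_gt0// addr_gt0.
have h2 : 0 <= t * (1 - T) by rewrite mulr_ge0// ltW.
have h3 : 0 < T * (1 - t) by rewrite mulr_gt0.
by apply: mulr_gt0; [exact: mulr_gt0|lra].
Qed.

(** Two points on a ray: the pair is reached before the outer one alone. *)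
Lemma reach2 (om : C) (t T : R) : cmod om = 1 -> 0 <= t -> t < T -> T < 1 ->
  exists2 x : R, x < T & forall (A : 'M[C]_2) (r : R), is_trig_mx A ->
    A 0 0 = om * t%:C -> A 1 1 = om * T%:C -> x <= r -> 0 < r -> r < 1 -> reach A r.
Proof.
move=> om1 t0 tT T1; set a := om * t%:C; set b := om * T%:C.
have T0 : 0 < T by exact: le_lt_trans tT.
have ca : cmod a = t by rewrite cmodM om1 mul1r cmod_real ger0_norm.
have cb : cmod b = T by rewrite cmodM om1 mul1r cmod_real gtr0_norm.
have a1 : cmod a < 1 by rewrite ca (lt_trans tT).
have b1 : cmod b < 1 by rewrite cb.
have [u [c [x [u1 c1 /andP[x0 x1] sE pE]]]] := geo_solve a1 b1.
have xC : cmod (x%:C : C) < 1 by rewrite cmod_real ger0_norm.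
exists x.
  have [w w1] := geo_extremal u1 c1 xC; rewrite sE pE cmod_real ger0_norm// => E.
  have W1 : cmod (w * om) = 1 by rewrite cmodM w1 om1 mulr1.
  have := ray_test W1 t0 tT T1.
  have -> : cmod (2 * (w * om) * (t * T)%:C - (t + T)%:C) = cmod (2 * w * (a * b) - (a + b)).
    rewrite -[LHS]mul1r -om1 -cmodM; congr cmod.
    by rewrite /a /b rmorphM rmorphD /=; ring.
  have wE : w * om * (t + T)%:C = w * (a + b) by rewrite /a /b rmorphD /=; ring.
  by rewrite wE E ltr_pM2r// cmod_gt0 subr_eq0; apply/eqP => E2;
    move: b1 a1 (ler_cmodD a b) (cmod_nat R 2); rewrite E2 cmodM w1 mul1r; lra.
move=> A r /is_trig_mxP tA A0 A1 xr r0 r1.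
have A01 : A 0 1 = 0 by exact: tA.
have sA : ~~ is_scalar_mx A.
  apply/negP => /is_scalar_mxP[m Am]; have : a = b by rewrite -A0 -A1 Am !mxE.
  by move/(congr1 (@cmod R)); rewrite ca cb => /eqP; rewrite lt_eqF.
have [Q uQ QE] := nonscalar_companion2 sA; apply: (reach_conjE uQ); rewrite QE.
have -> : \tr A = a + b by rewrite trace2 A0 A1.
have -> : \det A = a * b by rewrite det2 A0 A1 A01 mul0r subr0.
have [_ [f [Hf f0 fr]]] := disc_companion2 u1 c1 x0 xr r0 r1.
exists f; split=> //; last by rewrite fr sE pE.
rewrite f0; have [t0E d0E] := companion2_trace_det (0 : C) 0.
by rewrite (@char_poly2 _ _ 0 0) ?t0E ?d0E ?addr0 ?mulr0// polyC0 subr0 -expr2.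
Qed.

Lemma trig_block n1 n2 (T : 'M[C]_(n1 + n2)) : is_trig_mx T ->
  [/\ T = block_mx (ulsubmx T) 0 (dlsubmx T) (drsubmx T),
     is_trig_mx (ulsubmx T) & is_trig_mx (drsubmx T)].
Proof.
move=> tT; have := tT; rewrite -{1}[T]submxK is_trig_block_mx// => /and3P[/eqP E H1 H2].
by rewrite -E submxK.
Qed.

(** The diagonal blocks are treated separately, those of size 2 coming first. *)
Lemma reach_trig (a b : C) (r : R) : 0 < r ->
  (forall A : 'M[C]_2, is_trig_mx A -> A 0 0 = a -> A 1 1 = b -> reach A r) ->
  forall k n (T : 'M[C]_n), is_trig_mx T -> (k.*2 <= n)%N ->
  (forall i : 'I_n, (i < k.*2)%N -> T i i = if odd i then b else a) ->
  (forall i : 'I_n, (k.*2 <= i)%N -> cmod (T i i) <= r) -> reach T r.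
Proof.
move=> r0 H2; elim=> [|k IH] n T tT kn Hab Hr.
  elim: n T tT kn Hab Hr => [|n IH] T tT _ _ Hr; first exact: reach0.
  have [TE _ t2] := @trig_block 1 n T tT; rewrite TE; apply: (@reach_block 1 n).
    by apply: reach1 => //; rewrite !mxE; exact: Hr.
  by apply: IH => // i _; rewrite !mxE; exact: Hr.
case: n T tT kn Hab Hr => [|[|n]] T tT kn Hab Hr //.
have [TE t1 t2] := @trig_block 2 n T tT; rewrite TE; apply: (@reach_block 2 n).
  by apply: H2 => //; rewrite !mxE Hab.
apply: IH => // [i ik|i ik]; rewrite !mxE.
  by rewrite Hab /= ?negbK// doubleS !ltnS.
by apply: Hr; rewrite doubleS /= !ltnS.
Qed.

Lemma pair_up (T : eqType) (a b : T) (s : seq T) : a != b ->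
  (count_mem b s <= count_mem a s)%N ->
  exists k rest, perm_eq s (flatten (nseq k [:: a; b]) ++ rest) /\ b \notin rest.
Proof.
move=> ab; move E : (count_mem b s) => k; elim: k s E => [|k IH] s E ka.
  by exists 0%N, s; split=> //; rewrite -has_pred1 has_count E.
have bs : b \in s by rewrite -has_pred1 has_count E.
have as' : a \in s by rewrite -has_pred1 has_count (leq_trans _ ka).
have p1 := perm_to_rem as'.
have br : b \in rem a s by move: bs; rewrite (perm_mem p1) inE eq_sym (negPf ab).
have p2 : perm_eq s [:: a, b & rem b (rem a s)].
  by apply: perm_trans p1 _; rewrite perm_cons perm_to_rem.
have /seq.permP C := p2.
have [||k' [rest [p3 nb]]] := IH (rem b (rem a s)).
- by have := C (pred1 b); rewrite E /= eqxx (negPf ab) add0n add1n => -[].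
- by move: ka; rewrite C /= eqxx eq_sym (negPf ab) add0n add1n.
exists k'.+1, rest; split=> //; apply: perm_trans p2 _ => /=.
by rewrite !perm_cons.
Qed.

Lemma size_pairs (T : Type) (a b : T) k : size (flatten (nseq k [:: a; b])) = k.*2.
Proof. by elim: k => //= k ->; rewrite doubleS. Qed.

Lemma nth_pairs (T : Type) (x a b : T) k i : (i < k.*2)%N ->
  nth x (flatten (nseq k [:: a; b])) i = if odd i then b else a.
Proof. by elim: k i => // k IH [|[|i]]//= ik; rewrite IH ?negbK. Qed.

(** Each eigenvalue [om T] is paired with an eigenvalue [om t] and reached before [T] by
    [reach2]; the other eigenvalues are so by the discs [z x / r]. *)
Lemma reach_ray n (A : 'M[C]_n) (d : 'I_n -> C) (om : C) (t T : R) :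
  cmod om = 1 -> 0 <= t -> t < T -> T < 1 ->
  char_poly A = \prod_i ('X - (d i)%:P) ->
  leq (count [pred i | d i == om * T%:C] (enum 'I_n))
      (count [pred i | d i == om * t%:C] (enum 'I_n)) ->
  (forall i, d i != om * T%:C -> cmod (d i) < T) ->
  exists2 r : R, 0 < r < T & reach A r.
Proof.
move=> om1 t0 tT T1 cA cnt small; have T0 : 0 < T by exact: le_lt_trans tT.
have [x xT H2] := reach2 om1 t0 tT T1.
set a := om * t%:C in cnt H2 *; set b := om * T%:C in cnt small H2 *.
have ab : a != b.
  apply/negP => /eqP /(congr1 (@cmod R)); rewrite !cmodM om1 !mul1r !cmod_real.
  by rewrite ger0_norm// gtr0_norm// => /eqP; rewrite lt_eqF.
pose s := [seq d i | i <- enum 'I_n].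
have ss : size s = n by rewrite size_map size_enum_ord.
have [|k [rest [ps nb]]] := @pair_up C a b s ab.
  rewrite /s (count_map d (pred1 b)) (count_map d (pred1 a)); exact: cnt.
set s' := _ ++ rest in ps.
have ss' : size s' = n by rewrite -(perm_size ps).
have kn : (k.*2 <= n)%N by rewrite -ss' size_cat size_pairs leq_addr.
pose d' (i : 'I_n) := nth 0 s' i.
have cA' : char_poly A = \prod_i ('X - (d' i)%:P).
  rewrite cA -(big_enum _ _ _ (fun i => 'X - (d i)%:P)) /=.
  rewrite -(big_map d xpredT (fun x => 'X - x%:P)) (perm_big _ ps) /=.
  by rewrite (big_nth 0) ss' big_mkord.
have [P [uP tP dP]] := triangularize cA'.
pose r := Num.max (Num.max x (T / 2)) (\big[Num.max/0]_(y <- rest) cmod y).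
have rT : r < T.
  rewrite !gt_max xT /=; apply/andP; split; first by move: T0; lra.
  rewrite big_seq; elim/big_ind: _ => // [y z yT zT|y yr]; first by rewrite gt_max yT.
  have : y \in s by rewrite (perm_mem ps) mem_cat yr orbT.
  move=> /mapP[i _ yE]; rewrite yE; apply: small.
  by rewrite -yE; apply: contraNneq nb => <-.
have r0 : 0 < r by rewrite !lt_max; apply/orP; left; apply/orP; right; rewrite divr_gt0.
exists r; first by rewrite r0.
apply: (reach_conjE uP); apply: (@reach_trig a b r r0 _ k) => //.
- move=> B tB B0 B1; apply: H2 => //; last exact: lt_trans T1.
  by rewrite !le_max lexx.
- by move=> i ik; rewrite dP /d' /s' nth_cat size_pairs ik nth_pairs.
move=> i ik; rewrite dP /d' /s' nth_cat size_pairs ltnNge ik /=.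
have : nth 0 rest (i - k.*2) \in rest.
  by apply: mem_nth; move: (ltn_ord i); rewrite -{2}ss' size_cat size_pairs => ?; rewrite ltn_subLR.
by move=> h; rewrite le_max; apply/orP; right; exact: (le_bigmax_seq _ _ xpredT _ h).
Qed.

(** Compose with the involution of the disc that exchanges 0 and [a]. *)
Lemma disc_rev n (A B : 'M[C]_n) (a : C) : disc A B a -> disc B A a.
Proof.
move=> [a1 [f [Hf f0 fa]]]; split=> //.
pose m (z : C) := (a - z) / (1 - a^* * z).
have mE z : m z = - mobius a z by rewrite /m /mobius -[RHS]mulNr opprB.
exists (fun z => f (m z)); split.
- move=> z z1; have mz : cmod (m z) < 1 by rewrite mE cmodN cmod_mobius_lt1.
  have [df fz] := Hf _ mz; split=> // i j.
  apply: (@cdiff_comp _ m (fun z => f z i j)); last exact: df.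
  apply: cdiffM.
    by apply: cdiffB; [exact: cdiff_cst|exact: cdiff_id].
  apply: cdiffV; first exact: mobius_den_neq0.
  apply: cdiffB; first exact: cdiff_cst.
  by apply: cdiffM; [exact: cdiff_cst|exact: cdiff_id].
- by rewrite /m mulr0 !subr0 divr1 fa.
- by rewrite /m subrr mul0r f0.
Qed.

(** By continuity the nilpotent matrix of [reach_ray] could be replaced by 0, and 0 would
    be joined to [A] at a parameter less than the spectral radius [T]. *)
Lemma ray_not_lcont n (A : 'M[C]_n) (d : 'I_n -> C) (om : C) (t T : R) :
  cmod om = 1 -> 0 <= t -> t < T -> T < 1 ->
  char_poly A = \prod_i ('X - (d i)%:P) -> spectral_ball R n A ->
  leq (count [pred i | d i == om * T%:C] (enum 'I_n))
      (count [pred i | d i == om * t%:C] (enum 'I_n)) ->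
  (forall i, d i != om * T%:C -> cmod (d i) < T) ->
  (exists i, d i = om * T%:C) -> ~ lcont A.
Proof.
move=> om1 t0 tT T1 cA OA cnt small [i0 di0] lA.
have [r /andP[r0 rT] [f [Hf f0 fr]]] := reach_ray om1 t0 tT T1 cA cnt small.
have r1 : r < 1 by exact: lt_trans T1.
have rC : r%:C != 0 :> C by rewrite -cmod_gt0 cmod_real gtr0_norm.
have dA : disc A (f 0) r%:C.
  by apply: disc_rev; split; [rewrite cmod_real gtr0_norm|exists f].
have c0 : char_poly (f 0) = \prod_(i < n) ('X - (0 : C)%:P).
  by rewrite f0 polyC0 subr0 big_const_ord iter_mulr_1.
have := lcont_le_diag lA c0 rC dA; rewrite (_ : diag_mx _ = 0); last first.
  by apply/matrixP => i j; rewrite !mxE mul0rn.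
rewrite cmod_real gtr0_norm// => ub.
have [b db] := disc_from_0_ex OA.
have : T <= lempert (spectral_ball R n) A 0.
  apply: (lempert_ge (disc_rev db)) => z /disc_rev[z1 [g [Hg g0 gz]]].
  have -> : T = cmod (d i0).
    by rewrite di0 cmodM om1 mul1r cmod_real ger0_norm// (le_trans t0)// ltW.
  by apply: (spectral_schwarz Hg g0 z1); rewrite gz; exact: eigenvalue_diag.
move=> h; have := le_trans h ub; rewrite leNgt rT//.
Qed.

Lemma mobius_inj (t x y : C) : cmod t < 1 -> cmod x < 1 -> cmod y < 1 ->
  mobius t x = mobius t y -> x = y.
Proof.
move=> t1 x1 y1; have Dx := mobius_den_neq0 t1 x1; have Dy := mobius_den_neq0 t1 y1.
move=> /eqP; rewrite /mobius eqr_div// => /eqP E.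
have : (x - y) * (1 - t * t^*) = (x - t) * (1 - t^* * y) - (y - t) * (1 - t^* * x) by ring.
rewrite E subrr => /eqP; rewrite mulf_eq0 subr_eq0 => /orP[/eqP //|].
rewrite -sqr_cmod subr_eq0 => /eqP /(congr1 (@cmod R)).
rewrite cmod1 cmod_real ger0_norm ?exprn_ge0 ?cmod_ge0// => /esym/eqP.
by rewrite lt_eqF// expr_lt1 ?cmod_ge0.
Qed.

Lemma real_complex_mobius (b t : R) :
  ((b + t) / (1 + t * b))%:C = (b%:C + t%:C) / (1 + t%:C * b%:C).
Proof. by rewrite rmorphM fmorphV !rmorphD rmorph1 rmorphM. Qed.

Lemma mobius_ray (om y : C) (t : R) : cmod om = 1 ->
  mobius (- (om * t%:C)) (om * y) = om * ((y + t%:C) / (1 + t%:C * y)).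
Proof.
move=> /unimodular_conj oo.
have tconj : (t%:C : C)^*%R = t%:C by congr (_ +i* _); rewrite oppr0.
have -> : mobius (- (om * t%:C)) (om * y) = (om * y + om * t%:C) / (1 + om * om^* * t%:C * y).
  rewrite /mobius; have -> : (- (om * t%:C))^*%R = - (om^* * t%:C).
    by rewrite rmorphN rmorphM; congr (- (_ * _)); exact: tconj.
  by rewrite opprK; congr (_ / _); ring.
by rewrite oo mul1r -mulrDr -mulrA [y + _]addrC.
Qed.

(** After the Moebius transformation moving 0 to [om t] the point [om be], farthest from
    0, is strictly farthest. *)
Lemma mobius_farthest (om x : C) (t be : R) : cmod om = 1 -> 0 < t -> t < 1 ->
  0 < be -> be < 1 -> cmod x <= be -> x != om * be%:C ->
  cmod (mobius (- (om * t%:C)) x) < (be + t) / (1 + t * be).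
Proof.
move=> om1 t0 t1 be0 be1 xb xn; have oo := unimodular_conj om1.
pose y := om^* * x.
have xE : x = om * y by rewrite mulrA oo mul1r.
have yb : cmod y <= be by rewrite cmodM cmod_conj om1 mul1r.
have yn : y != be%:C by apply: contraNneq xn => E; rewrite xE E.
rewrite xE mobius_ray// cmodM om1 mul1r cmodM cmodV.
have D : 1 + t%:C * y != 0.
  have ty : cmod (- (t%:C * y)) < 1.
    rewrite cmodN cmodM cmod_real gtr0_norm//.
    by apply: (@le_lt_trans _ _ (t * be)); [rewrite ler_pM2l|rewrite mulr_ilt1 ?ltW].
  by rewrite -subr_eq0 subr0 -[t%:C * y]opprK subr_eq0; apply: contraTneq ty => <-; rewrite cmod1 ltxx.
have B0 : 0 < 1 + t * be by rewrite addr_gt0// mulr_gt0.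
rewrite ltr_pdivrMr ?cmod_gt0// mulrAC ltr_pdivlMr//.
rewrite -(@ltr_pXn2r _ 2)// ?nnegrE ?mulr_ge0 ?cmod_ge0 ?(ltW B0) ?addr_ge0 ?(ltW be0) ?(ltW t0)//.
rewrite !exprMn !sqr_cmodE.
have : complex.Re y ^+ 2 + complex.Im y ^+ 2 <= be ^+ 2.
  by rewrite -sqr_cmodE ler_pXn2r ?nnegrE ?cmod_ge0 ?(ltW be0).
have : complex.Re y <= be by apply: le_trans yb; exact: ler_Re_cmod.
clear - yn t0 t1 be0 be1; case: y yn => p q /= yn pb mb.
rewrite -subr_gt0.
rewrite (_ : _ - _ = (1 - t ^+ 2) * ((1 + 2 * t * be + t ^+ 2) * (be ^+ 2 - (p ^+ 2 + q ^+ 2)) +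
  2 * t * (1 - be ^+ 2) * (be - p))); last by ring.
have t2 : 0 < 1 - t ^+ 2 by rewrite subr_gt0 expr_lt1// ltW.
have b2 : 0 < 1 - be ^+ 2 by rewrite subr_gt0 expr_lt1// ltW.
have k1 : 0 < 1 + 2 * t * be + t ^+ 2 by rewrite !addr_gt0 ?mulr_gt0 ?exprn_gt0.
have k2 : 0 < 2 * t * (1 - be ^+ 2) by rewrite !mulr_gt0.
apply: mulr_gt0 => //; have [mlt|] := ltP (p ^+ 2 + q ^+ 2) (be ^+ 2).
  apply: ltr_wpDr; first by rewrite mulr_ge0 ?(ltW k2)// subr_ge0.
  by rewrite mulr_gt0// subr_gt0.
move=> mge; apply: ltr_wpDl; first by rewrite mulr_ge0 ?(ltW k1)// subr_ge0.
rewrite mulr_gt0// subr_gt0 lt_neqAle pb andbT; apply: contraNneq yn => pE.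
have : q ^+ 2 <= 0 by move: mb; rewrite pE; lra.
rewrite pE => q2; have : q ^+ 2 = 0 by apply/eqP; rewrite eq_le q2 sqr_ge0.
by move=> /eqP; rewrite expf_eq0 /= => /eqP ->.
Qed.

(** Move an eigenvalue of maximal multiplicity to 0, choose one that is farthest from it,
    and move 0 towards it along the ray, which makes it strictly farthest. *)
Lemma two_eigenvalues_not_lcont n (A : 'M[C]_n) (d : 'I_n -> C) :
  spectral_ball R n A -> char_poly A = \prod_i ('X - (d i)%:P) ->
  (exists i j, d i != d j) -> ~ lcont A.
Proof.
move=> OA cA [i [j dij]] lA; have d1 := (in_ball_prod cA).1 OA.
pose cnt x := count [pred k | d k == x] (enum 'I_n).
have [i0 _ max0] := @arg_maxnP _ i xpredT (fun k => cnt (d k)) isT.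
set a := d i0 in max0.
pose e k := mobius a (d k).
have a1 : cmod a < 1 by exact: d1.
have [i1 _ max1] := @Order.TotalTheory.arg_maxP _ _ _ i xpredT (fun k => cmod (e k)) isT.
have e0 k : e k = 0 -> d k = a.
  move=> ek; apply: (mobius_inj a1) => //.
  by rewrite [LHS]ek /mobius subrr mul0r.
have e1 k : cmod (e k) < 1 by exact: cmod_mobius_lt1.
have b0 : 0 < cmod (e i1).
  rewrite lt_neqAle cmod_ge0 andbT eq_sym; apply: contra dij => /eqP E.
  have z k : d k = a.
    apply: e0; apply/eqP; rewrite -cmod_eq0 eq_le cmod_ge0 andbT -E; exact: max1.
  by rewrite !z.
set be := cmod (e i1) in b0.
have beC : be%:C != 0 :> C by rewrite -cmod_gt0 cmod_real gtr0_norm.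
pose om := e i1 / be%:C.
have om1 : cmod om = 1 by rewrite cmodM cmodV cmod_real gtr0_norm// divff// lt0r_neq0.
have eE : e i1 = om * be%:C by rewrite divfK.
have be1 : be < 1 by exact: e1.
pose t : R := 2^-1; pose T := (be + t) / (1 + t * be).
have t0 : 0 < t by rewrite invr_gt0.
have t1 : t < 1 by rewrite invf_lt1// ltr1n.
have B0 : 0 < 1 + t * be by rewrite addr_gt0// mulr_gt0.
have tT : t < T.
  rewrite ltr_pdivlMr// -subr_gt0 (_ : _ - _ = be * (1 - t ^+ 2)); last by ring.
  by rewrite mulr_gt0// subr_gt0 expr_lt1// ltW.
have T1 : T < 1.
  rewrite ltr_pdivrMr// mul1r -subr_gt0 (_ : _ - _ = (1 - be) * (1 - t)); last by ring.
  by rewrite mulr_gt0// subr_gt0.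
have ta1 : cmod (- (om * t%:C)) < 1 by rewrite cmodN cmodM om1 mul1r cmod_real gtr0_norm.
pose g k := mobius (- (om * t%:C)) (e k).
have g0 : mobius (- (om * t%:C)) 0 = om * t%:C.
  by rewrite -[X in mobius _ X](mulr0 om) mobius_ray// mulr0 add0r addr0 divr1.
have gb : g i1 = om * T%:C.
  rewrite /g eE mobius_ray//; congr (om * _).
  by rewrite real_complex_mobius.
have gK k l : g k = g l -> d k = d l.
  by move=> /(mobius_inj ta1 (e1 k) (e1 l)) /(mobius_inj a1 (d1 k) (d1 l)).
have OA1 := mobius_mx_in_ball a1 OA; have OA2 := mobius_mx_in_ball ta1 OA1.
have cA1 := char_poly_mobius a1 OA cA.
have cA2 := char_poly_mobius ta1 OA1 cA1.
have gi0 : g i0 = om * t%:C by rewrite -g0 /g; congr (mobius _ _); rewrite /e /mobius subrr mul0r.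
apply: (@ray_not_lcont _ _ g om t T om1 (ltW t0) tT T1 cA2 OA2).
- have -> : count [pred k | g k == om * T%:C] (enum 'I_n) = cnt (d i1).
    apply: eq_count => k /=; apply/eqP/eqP => [|dk]; last by rewrite -gb /g /e dk.
    by rewrite -gb => /gK.
  have -> : count [pred k | g k == om * t%:C] (enum 'I_n) = cnt a.
    apply: eq_count => k /=; apply/eqP/eqP => [|dk]; last by rewrite -gi0 /g /e dk.
    by rewrite -gi0 => /gK.
  exact: max0.
- move=> k gk; apply: mobius_farthest => //; first exact: max1.
  by apply: contraNneq gk => ek; rewrite -gb /g ek eE.
- by exists i1.
by apply/(lcont_mobiusE ta1 OA1)/(lcont_mobiusE a1 OA).
Qed.

End Reach.

(** * Jacobi's formula *)

Section Jacobi.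
Variable R : realType.
Notation C := R[i].
Implicit Types (P Q : C -> {poly C}) (z : C).

Definition pderiv P z (D : {poly C}) := forall k, cderiv (fun w => (P w)`_k) z D`_k.

Lemma cderiv_sum (I : Type) (r : seq I) (F : I -> C -> C) (D : I -> C) z :
  (forall i, cderiv (F i) z (D i)) ->
  cderiv (fun w => \sum_(i <- r) F i w) z (\sum_(i <- r) D i).
Proof.
move=> H; elim: r => [|i r IH].
  rewrite big_nil (_ : (fun w => _) = (fun=> 0)); first exact: cderiv_cst.
  by apply/funext => w; rewrite big_nil.
rewrite big_cons (_ : (fun w => _) = (fun w => F i w + \sum_(i <- r) F i w)).
  exact: cderivD.
by apply/funext => w; rewrite big_cons.
Qed.

Lemma pderiv_cst (p : {poly C}) z : pderiv (fun=> p) z 0.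
Proof. by move=> k; rewrite coef0; exact: cderiv_cst. Qed.

Lemma pderiv_sum (I : Type) (r : seq I) (F : I -> C -> {poly C}) (D : I -> {poly C}) z :
  (forall i, pderiv (F i) z (D i)) ->
  pderiv (fun w => \sum_(i <- r) F i w) z (\sum_(i <- r) D i).
Proof.
move=> H k; rewrite coef_sum (_ : (fun w => _) = (fun w => \sum_(i <- r) (F i w)`_k)).
  by apply: cderiv_sum => i; exact: H.
by apply/funext => w; rewrite coef_sum.
Qed.

Lemma pderivM P Q z D E : pderiv P z D -> pderiv Q z E ->
  pderiv (fun w => P w * Q w) z (D * Q z + P z * E).
Proof.
move=> dP dQ k; rewrite coefD !coefM -big_split /=.
rewrite (_ : (fun w => _) = (fun w => \sum_(i < k.+1) (P w)`_i * (Q w)`_(k - i))).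
  by apply: cderiv_sum => i; exact: cderivM.
by apply/funext => w; rewrite coefM.
Qed.

Lemma pderiv_prod n (F : 'I_n -> C -> {poly C}) (D : 'I_n -> {poly C}) z :
  (forall i, pderiv (F i) z (D i)) ->
  pderiv (fun w => \prod_i F i w) z (\sum_i \prod_j (if j == i then D j else F j z)).
Proof.
elim: n F D => [|n IH] F D H.
  rewrite big_ord0 (_ : (fun w => _) = (fun=> 1)); first exact: pderiv_cst.
  by apply/funext => w; rewrite big_ord0.
rewrite (_ : (fun w => _) = (fun w => F ord0 w * \prod_i F (lift ord0 i) w)).
  rewrite big_ord_recl.
  have := pderivM (H ord0) (IH (fun i => F (lift ord0 i)) (fun i => D (lift ord0 i)) (fun i => H _)).
  congr (pderiv _ _ (_ + _)).
    by rewrite big_ord_recl eqxx; congr (_ * _); apply: eq_bigr => i _.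
  rewrite mulr_sumr; apply: eq_bigr => i _; rewrite big_ord_recl /=; congr (_ * _).
by apply/funext => w; rewrite big_ord_recl.
Qed.

(** The derivative of a determinant is the sum of the determinants with one row
    differentiated, which are expanded along that row. *)
Lemma pderiv_det n (F : C -> 'M[{poly C}]_n) (D : 'M[{poly C}]_n) z :
  (forall i j, pderiv (fun w => F w i j) z (D i j)) ->
  pderiv (fun w => \det (F w)) z (\sum_i \sum_j D i j * cofactor (F z) i j).
Proof.
move=> H; have -> : \sum_i \sum_j D i j * cofactor (F z) i j =
    \sum_i \det (\matrix_(j, k) if j == i then D j k else F z j k).
  apply: eq_bigr => i _; rewrite (expand_det_row _ i); apply: eq_bigr => j _.
  rewrite mxE eqxx /cofactor; congr (_ * (_ * \det _)).
  apply/matrixP => k l; rewrite !mxE.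
  by case: eqP => // E; have := neq_lift i k; rewrite E eqxx.
have -> : \sum_i \det (\matrix_(j, k) if j == i then D j k else F z j k) =
    \sum_(s : 'S_n) ((-1) ^+ s * (\sum_i \prod_j (if j == i then D j (s j) else F z j (s j)))).
  rewrite exchange_big; apply: eq_bigr => s _; rewrite mulr_sumr; apply: eq_bigr => i _.
  by congr (_ * _); apply: eq_bigr => j _; rewrite mxE.
rewrite /determinant; apply: pderiv_sum => s.
have := pderivM (pderiv_cst ((-1) ^+ s) z) (@pderiv_prod n (fun i w => F w i (s i)) (fun i => D i (s i)) z (fun i => H _ _)).
by rewrite mul0r add0r.
Qed.

(** Jacobi's formula for the coefficients of the characteristic polynomial. *)
Lemma pderiv_char_poly n (F : C -> 'M[C]_n) (D : 'M[C]_n) z :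
  (forall i j, cderiv (fun w => F w i j) z (D i j)) ->
  pderiv (fun w => char_poly (F w)) z
    (- \sum_i \sum_j (D i j)%:P * cofactor (char_poly_mx (F z)) i j).
Proof.
move=> H; rewrite -sumrN; have -> : \sum_i - \sum_j (D i j)%:P * cofactor (char_poly_mx (F z)) i j =
   \sum_i \sum_j (map_mx (fun x => - x%:P) D) i j * cofactor (char_poly_mx (F z)) i j.
  by apply: eq_bigr => i _; rewrite -sumrN; apply: eq_bigr => j _; rewrite mxE mulNr.
rewrite /char_poly; apply: (@pderiv_det n (fun w => char_poly_mx (F w))) => i j k.
rewrite mxE coefN coefC.
rewrite (_ : (fun w => _) = (fun w => (('X : {poly C}) *+ (i == j))`_k + (- (k == 0)%:R) * F w i j)).
  have := cderivD (cderiv_cst (('X : {poly C}) *+ (i == j))`_k z) (cderivM (cderiv_cst (- (k == 0)%:R) z) (H i j)).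
  by rewrite mul0r !add0r; case: (k == 0) => /=; rewrite ?mulN1r// oppr0 mul0r.
apply/funext => w; rewrite !mxE coefB coefC; case: (k == 0) => /=; rewrite ?mulN1r//.
by rewrite subr0 oppr0 mul0r addr0.
Qed.

End Jacobi.

(** * Discs ending at a diagonal matrix with a double eigenvalue *)

Section CriticalValue.
Variable R : realType.
Notation C := R[i].

(** The entries of the identity [M adj M = det M] for a diagonal [M]. *)
Lemma cofactor_diag n (d : 'I_n -> C) i j :
  ('X - (d i)%:P) * cofactor (char_poly_mx (diag_mx (\row_k d k))) j i =
    char_poly (diag_mx (\row_k d k)) *+ (i == j).
Proof.
set M := char_poly_mx _.
have /matrixP/(_ i j) := mul_mx_adj M; rewrite !mxE => <-.
rewrite (bigD1 i)//= big1 ?addr0 => [|k ki].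
  by rewrite !mxE eqxx mulr1n.
by rewrite !mxE !(eq_sym i) (negPf ki) !mulr0n polyC0 subr0 mul0r.
Qed.

(** Dividing [p] by [X - d] lowers the multiplicity of a root by one at most; likewise for
    the root 0 in [factor_coef0]. *)
Lemma factor_multiple_root (p r : {poly C}) (d x : C) : ('X - d%:P) * r = p ->
  p.[x] = 0 -> p^`().[x] = 0 -> r.[x] = 0.
Proof.
move=> <-; rewrite derivM derivXsubC mul1r !hornerE => /eqP.
rewrite mulf_eq0 => /orP[/eqP ->|/eqP ->//]; by rewrite mul0r addr0.
Qed.

Lemma factor_coef0 (p r : {poly C}) (d : C) N : ('X - d%:P) * r = p ->
  (forall k, (k < N)%N -> p`_k = 0) -> forall k, (k.+1 < N)%N -> r`_k = 0.
Proof.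
move=> pE p0; have E k : p`_k.+1 = r`_k - d * r`_k.+1.
  by rewrite -pE mulrBl coefB coefXM coefCM.
have E0 : p`_0 = - (d * r`_0) by rewrite -pE mulrBl coefB coefXM coefCM sub0r.
have [d0 k kN|d0] := eqVneq d 0.
  by have := E k; rewrite p0// d0 mul0r subr0.
elim=> [|k IH] kN.
  move: E0; rewrite p0; last exact: ltn_trans kN.
  by move=> /esym/eqP; rewrite oppr_eq0 mulf_eq0 (negPf d0) => /eqP.
have := E k; rewrite p0 ?(ltnW kN)// IH ?(ltnW kN)// sub0r => /esym/eqP.
by rewrite oppr_eq0 mulf_eq0 (negPf d0) => /eqP.
Qed.

(** If [A ^ m = 0] then [X ^ m = (X - A) S] for this polynomial matrix [S], so that the
    adjugate of [X - A] is [X ^ (n - m) S]. *)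
Definition resolvent n (A : 'M[C]_n.+1) m : 'M[{poly C}]_n.+1 :=
  \sum_(i < m) 'X^(m.-1 - i) *: map_mx polyC (A ^+ i).

Lemma resolventE n (A : 'M[C]_n.+1) m : A ^+ m = 0 ->
  char_poly_mx A *m resolvent A m = ('X^m)%:M.
Proof.
move=> Am; set x : 'M[{poly C}]_n.+1 := 'X%:M; pose y := map_mx polyC A.
have xy : GRing.comm x y by apply: comm_scalar_mx.
have := subrXX_comm m xy.
have -> : y ^+ m = 0 by rewrite -rmorphXn Am rmorph0.
rewrite subr0 -rmorphXn /= => ->; congr (_ *m _).
apply: eq_bigr => i _; rewrite -!rmorphXn /= [RHS]mul_scalar_mx.
by congr (_ *: _).
Qed.

Lemma adj_nilpotent n (A : 'M[C]_n.+1) m : A ^+ m = 0 -> char_poly A = 'X^(n.+1) ->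
  (m <= n.+1)%N -> \adj (char_poly_mx A) = 'X^(n.+1 - m) *: resolvent A m.
Proof.
move=> Am cA mn; have Xm0 : 'X^m != 0 :> {poly C} by rewrite expf_neq0// polyX_eq0.
have := congr1 (mulmx (\adj (char_poly_mx A))) (resolventE Am).
rewrite mulmxA mul_adj_mx mul_scalar_mx mul_mx_scalar -/(char_poly A) cA => E.
apply/matrixP => i j; apply: (mulfI Xm0).
have := congr1 (fun M : 'M[{poly C}]_n.+1 => M i j) E; rewrite !mxE => <-.
by rewrite mulrA -exprD subnKC.
Qed.

Lemma char_poly_coef_bound n (A : 'M[C]_n) k : spectral_ball R n A ->
  cmod (char_poly A)`_k <= 2 ^+ n.
Proof.
have [d cA] := char_poly_split A; move=> /(in_ball_prod cA) H; rewrite cA.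
by apply: (coef_prod_bound _ ler01) => i; exact: ltW.
Qed.

(** At the diagonal end of the disc the derivative of the characteristic polynomial
    vanishes at the double eigenvalue [mu], because [mu - D] has two zero columns.  The
    coefficients vanish at the other end, those of degree less than [n - m] to second
    order ([adj_nilpotent]); so their derivatives at [a] are nearly their values divided
    by [a], with a factor 2 for these degrees.  The sum of the values times the powers of
    [mu], with these factors, is of modulus [mu ^ n] by assumption, although it should
    nearly vanish. *)
Lemma critical_value_bound n (A : 'M[C]_n.+1) (d : 'I_n.+1 -> C) m s (mu eta : R) (a : C) :
  let p := \prod_i ('X - (d i)%:P) in
  A ^+ m = 0 -> char_poly A = 'X^(n.+1) -> (m <= n.+1)%N ->
  0 < mu -> mu <= 1 -> p.[mu%:C] = 0 -> p^`().[mu%:C] = 0 ->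
  (forall k, (k + s < n.+1)%N -> p`_k = 0) ->
  cmod (\sum_(k < n.+1 | (k < n.+1 - m)%N) p`_k * mu%:C ^+ k - mu%:C ^+ n.+1) = mu ^+ n.+1 ->
  disc A (diag_mx (\row_i d i)) a -> a != 0 -> cmod a < 1 / 4 ->
  cmod a ^+ 2 <= eta * mu ^+ m -> cmod a ^+ 3 <= eta * mu ^+ s.+1 ->
  1 <= eta * (128 * 2 ^+ n.+1 * n.+1%:R).
Proof.
move=> p Am cA mn mu0 mu1 pmu p'mu plow phigh [a1 [f [Hf f0 fa]]] an0 a4 ae2 ae3.
set B := diag_mx _ in fa; pose N := n.+1; pose M : R := 2 ^+ N.
have M0 : 0 <= M by exact: exprn_ge0.
have eta0 : 0 <= eta.
  have : 0 <= eta * mu ^+ m by apply: le_trans ae2; rewrite exprn_ge0// cmod_ge0.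
  by rewrite pmulr_lge0// exprn_gt0.
have cB : char_poly B = p.
  rewrite char_poly_trig ?diag_mx_is_trig//.
  by apply: eq_bigr => i _; rewrite !mxE eqxx mulr1n.
pose c k w := (char_poly (f w))`_k.
have dc k z : cmod z < 1 -> cdiff (c k) z.
  by move=> z1; exact: (pdiff_char_poly (Hf z z1).1).
have cM k z : cmod z < 1 -> cmod (c k z) <= M.
  by move=> z1; exact: char_poly_coef_bound (Hf z z1).2.
have c0 k : (k < N)%N -> c k 0 = 0 by move=> kN; rewrite /c f0 cA coefXn ltn_eqF.
have df z : cmod z < 1 -> exists D : 'M[C]_N, forall i j, cderiv (fun w => f w i j) z (D i j).
  move=> z1; have H i j := cid ((Hf z z1).1 i j).
  exists (\matrix_(i, j) sval (H i j)) => i j; rewrite mxE; exact: svalP (H i j).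
have z01 : cmod (0 : C) < 1 by rewrite cmod0.
have dc0 k : (k < N - m)%N -> cderiv (c k) 0 0.
  move=> kN; have [D HD] := df 0 z01; have := pderiv_char_poly HD k.
  rewrite f0 coefN coef_sum big1 ?oppr0// => i _; rewrite coef_sum big1// => j _.
  have -> : cofactor (char_poly_mx A) i j = (\adj (char_poly_mx A)) j i by rewrite mxE.
  by rewrite (adj_nilpotent Am cA mn) mxE mulrCA coefXnM kN.
have [D HD] := df a a1.
pose q := - \sum_i (D i i)%:P * cofactor (char_poly_mx B) i i.
have dca k : cderiv (c k) a q`_k.
  have := pderiv_char_poly HD k; rewrite fa.
  suff -> : \sum_i \sum_j (D i j)%:P * cofactor (char_poly_mx B) i j =
     \sum_i (D i i)%:P * cofactor (char_poly_mx B) i i by [].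
  apply: eq_bigr => i _; rewrite (bigD1 i)//= big1 ?addr0// => j ji.
  have /eqP := cofactor_diag d j i; rewrite (negPf ji) mulr0n mulf_eq0 polyXsubC_eq0 /=.
  by move=> /eqP ->; rewrite mulr0.
have rE i : ('X - (d i)%:P) * cofactor (char_poly_mx B) i i = p.
  by rewrite cofactor_diag eqxx mulr1n.
have p0 : p != 0 by apply/monic_neq0/monic_prod => i _; exact: monicXsubC.
have sp : size p = N.+1 by rewrite -cB size_char_poly.
have rs i : (size (cofactor (char_poly_mx B) i i) <= N)%N.
  have r0 : cofactor (char_poly_mx B) i i != 0.
    by apply: contraNneq p0 => r0; rewrite -(rE i) r0 mulr0.
  have := sp; rewrite -(rE i) size_monicM ?monicXsubC//.
  by rewrite size_XsubC add2n /= => /succn_inj ->.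
have qs : (size q <= N)%N.
  rewrite size_polyN; apply: leq_trans (size_sum _ _ _) _; apply/bigmax_leqP => i _.
  by rewrite mul_polyC; apply: leq_trans (size_scale_leq _ _) _.
have qmu : q.[mu%:C] = 0.
  rewrite hornerN horner_sum big1 ?oppr0// => i _.
  by rewrite hornerM (factor_multiple_root (rE i))// mulr0.
have qlow k : (k + s.+1 < N)%N -> q`_k = 0.
  move=> kN; rewrite coefN coef_sum big1 ?oppr0// => i _.
  rewrite coefCM (@factor_coef0 p _ (d i) (N - s) (rE i)) ?mulr0//.
    by move=> l lN; apply: plow; rewrite addnC -ltn_subRL.
  by rewrite ltn_subRL addnS addnC -addnS.
pose wt k : C := if (k < N - m)%N then 2 else 1.
have ca k : c k a = p`_k by rewrite /c fa cB.
have err k : (k < N)%N ->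
    cmod (a * q`_k - wt k * p`_k) * mu ^+ k <= eta * (128 * M) * mu ^+ N.
  move=> kN; have mk : 0 <= mu ^+ k by rewrite exprn_ge0// ltW.
  have rhs0 : 0 <= eta * (128 * M) * mu ^+ N.
    by rewrite !mulr_ge0// exprn_ge0// ltW.
  have small l : (N <= l + k)%N -> eta * (128 * M) * mu ^+ l * mu ^+ k <= eta * (128 * M) * mu ^+ N.
    move=> Nl; rewrite -mulrA -exprD ler_wpM2l ?mulr_ge0//.
    by apply: ler_wiXn2l; rewrite ?(ltW mu0).
  rewrite /wt; case: ltnP => km.
    have [ks|ks] := ltnP (k + s.+1) N.
      rewrite qlow// plow ?(leq_ltn_trans _ ks)// ?leq_add2l//.
      by rewrite !mulr0 subr0 cmod0 mul0r.
    apply: le_trans (small s.+1 _); last by rewrite addnC.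
    rewrite ler_wpM2r// -ca.
    apply: le_trans (deriv_at_double_zero M0 (dc k) (c0 k kN) (dc0 k km) (cM k) an0 a4 (dca k)) _.
    have -> : eta * (128 * M) * mu ^+ s.+1 = 128 * M * (eta * mu ^+ s.+1) by ring.
    by rewrite ler_wpM2l// mulr_ge0.
  have a2 : cmod a < 1 / 2 by move: a4; lra.
  apply: le_trans (small m _); last by rewrite leq_subLR in km.
  rewrite ler_wpM2r// mul1r -ca.
  apply: le_trans (deriv_at_simple_zero M0 (dc k) (c0 k kN) (cM k) an0 a2 (dca k)) _.
  apply: (@le_trans _ _ (128 * M * cmod a ^+ 2)).
    by rewrite ler_wpM2r ?exprn_ge0 ?cmod_ge0// ler_wpM2r// ler_nat.
  have -> : eta * (128 * M) * mu ^+ m = 128 * M * (eta * mu ^+ m) by ring.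
  by rewrite ler_wpM2l// mulr_ge0.
have tot : mu ^+ N <= \sum_(k < N) cmod (a * q`_k - wt k * p`_k) * mu ^+ k.
  rewrite -phigh; have -> : \sum_(k < N | (k < N - m)%N) p`_k * mu%:C ^+ k - mu%:C ^+ N =
     - \sum_(k < N) (a * q`_k - wt k * p`_k) * mu%:C ^+ k.
    have E1 : \sum_(k < N) a * q`_k * mu%:C ^+ k = 0.
      transitivity (a * q.[mu%:C]); last by rewrite qmu mulr0.
      rewrite (horner_coef_wide _ qs) mulr_sumr.
      by apply: eq_bigr => k _; rewrite mulrA.
    have E2 : \sum_(k < N) p`_k * mu%:C ^+ k = - mu%:C ^+ N.
      apply/eqP; rewrite -subr_eq0 opprK; apply/eqP; rewrite -[RHS]pmu.
      rewrite (@horner_coef_wide _ N.+1) ?sp// [RHS]big_ord_recr /=; congr (_ + _).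
      have : p \is monic by apply/monic_prod => i _; exact: monicXsubC.
      by rewrite monicE lead_coefE sp => /eqP -> ; rewrite mul1r.
    rewrite -[X in _ - X]opprK -E2 opprK big_mkcond /= -big_split /= -sumrN.
    apply/eqP; rewrite -subr_eq0 -sumrB; apply/eqP; rewrite -[RHS]E1; apply: eq_bigr => k _.
    by rewrite /wt; case: ifP => _; ring.
  rewrite cmodN; apply: le_trans (ler_cmod_sum _ _ _) _; apply: ler_sum => k _.
  by rewrite cmodM cmodX cmod_real gtr0_norm.
have muN : 0 < mu ^+ N by rewrite exprn_gt0.
rewrite -(ler_pM2r muN) mul1r; apply: le_trans tot _.
apply: (@le_trans _ _ (\sum_(k < N) eta * (128 * M) * mu ^+ N)).
  by apply: ler_sum => k _; exact: err.
by rewrite sumr_const card_ord /M /N -[leLHS]mulr_natr le_eqVlt; apply/orP; left; apply/eqP; ring.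
Qed.

End CriticalValue.

(** * Low rank perturbations of nilpotent matrices *)

(** Both sides are [c ^ k] times the determinant of the block matrix with rows [(c, P)] and
    [(U, 1)]. *)
Lemma det_sylvester (F : comNzRingType) n k (c : F) (P : 'M[F]_(n, k)) (U : 'M[F]_(k, n)) :
  c ^+ k * \det (c%:M - P *m U) = c ^+ n * \det (c%:M - U *m P).
Proof.
pose M : 'M[F]_(n + k) := block_mx c%:M P U 1%:M.
have E1 : M *m block_mx 1%:M 0 (- U) 1%:M = block_mx (c%:M - P *m U) P 0 1%:M.
  by rewrite mulmx_block !mulmx1 !mulmx0 !add0r mulmxN mul1mx subrr.
have E2 : block_mx 1%:M 0 (- U) c%:M *m M = block_mx c%:M P 0 (c%:M - U *m P).
  rewrite mulmx_block !mul1mx !mul0mx !addr0 mulmx1 mul_mx_scalar mul_scalar_mx.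
  by rewrite scalerN addNr mulNmx addrC.
have := congr1 determinant E1; rewrite det_mulmx det_lblock det_ublock !det1 !mulr1 => D1.
have := congr1 determinant E2; rewrite det_mulmx det_lblock det_ublock det1 mul1r !det_scalar D1.
by [].
Qed.

Section RankUpdates.
Variable R : realType.
Notation C := R[i].
Notation pmx := (map_mx (@polyC C)).

(** The product of [X - A - z P U] and the resolvent is [X ^ m - z P (U S)], to which
    Sylvester's identity applies. *)
Lemma char_poly_update n k m (A : 'M[C]_n.+1) (P : 'M[C]_(n.+1, k)) (U : 'M[C]_(k, n.+1)) z :
  A ^+ m = 0 -> char_poly A = 'X^(n.+1) ->
  'X^(m * k) * char_poly (A + z *: (P *m U)) =
  'X^(n.+1) * \det ('X^m%:M - z%:P *: (pmx U *m resolvent A m *m pmx P)).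
Proof.
move=> Am cA; set S := resolvent A m; have MS := resolventE Am.
have dS : 'X^(n.+1) * \det S = 'X^(m * n.+1).
  by rewrite -cA /char_poly -det_mulmx MS det_scalar -exprM.
have E : char_poly_mx (A + z *: (P *m U)) *m S = 'X^m%:M - (z%:P *: pmx P) *m (pmx U *m S).
  rewrite /char_poly_mx map_mxD opprD addrA mulmxDl -/(char_poly_mx A) MS; congr (_ + _).
  by rewrite map_mxZ map_mxM mulNmx -!scalemxAl mulmxA.
have := congr1 determinant E; rewrite det_mulmx -/(char_poly _) => D.
have X0 : 'X^(m * n.+1) != 0 :> {poly C} by rewrite expf_neq0// polyX_eq0.
apply: (mulfI X0).
have := det_sylvester 'X^m (z%:P *: pmx P) (pmx U *m S).
rewrite -D -!exprM -scalemxAr => H.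
transitivity ('X^(n.+1) * ('X^(m * k) * (char_poly (A + z *: (P *m U)) * \det S))); last first.
  by rewrite H mulrCA.
by rewrite -dS; ring.
Qed.

Lemma resolvent_entry n m k l (A : 'M[C]_n.+1) (U : 'M[C]_(k, n.+1)) (P : 'M[C]_(n.+1, l)) i j :
  (pmx U *m resolvent A m *m pmx P) i j =
  \sum_(e < m) ((U *m A ^+ e *m P) i j)%:P * 'X^(m.-1 - e).
Proof.
rewrite /resolvent mulmx_sumr mulmx_suml summxE; apply: eq_bigr => e _.
by rewrite -scalemxAr -scalemxAl -!map_mxM !mxE mulrC.
Qed.

(** The rows [v], [v A], ..., [v A ^ m] are independent, and [p] is the last vector of a
    dual family. *)
Lemma jordan_chain n m (A : 'M[C]_n.+1) : A ^+ m.+1 = 0 -> A ^+ m != 0 ->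
  exists (v : 'rV[C]_n.+1) (p : 'cV[C]_n.+1),
    forall i, (v *m A ^+ i *m p) 0 0 = (i == m)%:R.
Proof.
move=> Am1 Am0; have Az i : (m < i)%N -> A ^+ i = 0.
  by move=> mi; rewrite -(subnKC mi) exprD Am1 mul0r.
have [i0 vi] : exists i, row i (A ^+ m) != 0.
  apply/existsP; apply: contraNT Am0; rewrite negb_exists => /forallP H.
  apply/eqP/row_matrixP => i; rewrite row0; apply/eqP; have := H i; by rewrite negbK.
pose v : 'rV[C]_n.+1 := delta_mx 0 i0.
have vE i : v *m A ^+ i = row i0 (A ^+ i) by rewrite -rowE.
pose W : 'M[C]_(m.+1, n.+1) := \matrix_(i < m.+1) (v *m A ^+ i).
have fW : row_free W.
  apply: inj_row_free => x xW; apply/eqP; apply: contraT => xn0.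
  have [k xk] : exists k, x 0 k != 0.
    by apply/existsP; apply: contraNT xn0; rewrite negb_exists => /forallP H;
      apply/eqP/rowP => k; rewrite mxE; apply/eqP; have := H k; rewrite negbK.
  have [l xl lmin] := @arg_minnP _ k (fun k => x 0 k != 0) (fun k : 'I_m.+1 => nat_of_ord k) xk.
  have := congr1 (fun y => y *m A ^+ (m - l)) xW; rewrite mul0mx => E.
  suff : x 0 l *: row i0 (A ^+ m) = 0.
    by move/eqP; rewrite scaler_eq0 (negPf xl) (negPf vi).
  rewrite -[RHS]E [x *m W]mulmx_sum_row mulmx_suml (bigD1 l)//= big1 ?addr0.
    rewrite rowK -scalemxAl -mulmxA -[A ^+ l *m _]exprD subnKC ?vE//; by rewrite -ltnS.
  move=> {k xk} k kl; rewrite rowK -scalemxAl -mulmxA -[A ^+ k *m _]exprD.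
  have [kx|kx] := boolP (x 0 k != 0); last by rewrite negbK in kx; rewrite (eqP kx) scale0r.
  rewrite Az ?mulmx0 ?scaler0//; have lk := lmin k kx.
  have : (l < k)%N by rewrite ltn_neqAle lk andbT eq_sym.
  have lm : (l <= m)%N by rewrite -ltnS.
  by rewrite addnC -ltn_subLR ?leq_subr// subKn.
exists v, (col ord_max (pinvmx W)) => i.
have [im|im] := ltnP i m.+1; last first.
  by rewrite Az// mulmx0 mul0mx mxE gtn_eqF.
have := congr1 (fun M : 'M[C]_m.+1 => M (Ordinal im) ord_max) (mulmxVp fW).
rewrite mxE mxE -val_eqE /= => <-; rewrite mxE; apply: eq_bigr => j _.
by rewrite [in RHS]mxE [col _ _ _ _]mxE.
Qed.

(** The perturbation is chosen for its characteristic polynomial; [T z] contains the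
    eigenvalues other than 0. *)
Lemma disc_update n k e (A : 'M[C]_n.+1) (P : 'M[C]_(n.+1, k)) (U : 'M[C]_(k, n.+1))
    (T : C -> {poly C}) (a : C) :
  (forall z, 'X^e * char_poly (A + z *: (P *m U)) = 'X^(n.+1) * T z) ->
  (forall z x, cmod z < 1 -> root (T z) x -> cmod x < 1) -> cmod a < 1 ->
  disc A (A + a *: (P *m U)) a.
Proof.
move=> cT rT a1; split=> //; exists (fun z => A + z *: (P *m U)); split=> //; last first.
  by rewrite scale0r addr0.
move=> z z1; split.
  apply: mdiffD; first exact: mdiff_cst.
  by apply: mdiffZ; [exact: cdiff_id|exact: mdiff_cst].
apply/in_ballP => x; rewrite eigenvalue_root_char => rx.
have [->|x0] := eqVneq x 0; first by rewrite cmod0.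
have : root ('X^(n.+1) * T z) x by rewrite -cT rootM rx orbT.
rewrite rootM => /orP[|]; last exact: rT.
by rewrite /root hornerXn expf_eq0 (negPf x0).
Qed.

(** [P] and [U] come from the vectors of [jordan_chain], with [U = c0 v + c1 v A], for
    which two terms of the resolvent survive. *)
Lemma chain_update n m (A : 'M[C]_n.+1) (c0 c1 : C) : A ^+ m.+2 = 0 -> A ^+ m.+1 != 0 ->
  char_poly A = 'X^(n.+1) -> exists (P : 'M[C]_(n.+1, 1)) (U : 'M[C]_(1, n.+1)),
    forall z, 'X^(m.+2) * char_poly (A + z *: (P *m U)) =
      'X^(n.+1) * ('X^(m.+2) - z%:P * (c0%:P + c1%:P * 'X)).
Proof.
move=> Am2 Am1 cA; have [v [p vp]] := jordan_chain Am2 Am1.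
pose u := c0 *: v + c1 *: (v *m A); exists p, u => z.
have := char_poly_update p u z Am2 cA; rewrite muln1 => ->; congr (_ * _).
have E e : (u *m A ^+ e *m p) 0 0 = c0 * (e == m.+1)%:R + c1 * (e == m)%:R.
  rewrite /u !mulmxDl mxE -!scalemxAl -[v *m A *m _]mulmxA -[A *m _]exprS.
  by rewrite mxE vp [X in _ + X]mxE vp eqSS.
have : (pmx u *m resolvent A m.+2 *m pmx p) 0 0 = c0%:P + c1%:P * 'X.
  rewrite resolvent_entry big_ord_recr big_ord_recr /= big1 => [|e _]; last first.
    rewrite E (ltn_eqF (ltn_ord e)) ltn_eqF; first by rewrite !mulr0 addr0 polyC0 mul0r.
    exact: leq_trans (ltn_ord e) (leqnSn m).
  rewrite !E !eqxx (ltn_eqF (ltnSn m)) (gtn_eqF (ltnSn m)) /= subnn subSnn.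
  by rewrite !mulr0 !mulr1 add0r addr0 add0r addrC.
move: (_ *m pmx p) => G EG.
by rewrite det_mx11 !mxE EG mulr1n.
Qed.

(** If [|x| >= 1] then [|c0 + c1 x| <= |x|], whence [|x| ^ (m + 2) < |x|]. *)
Lemma chain_root (m : nat) (c0 c1 z x : C) : cmod c0 + cmod c1 <= 1 -> cmod z < 1 ->
  root ('X^(m.+2) - z%:P * (c0%:P + c1%:P * 'X)) x -> cmod x < 1.
Proof.
move=> c01 z1; rewrite /root !hornerE subr_eq0 => /eqP E; rewrite ltNge; apply/negP => x1.
have x0 : 0 < cmod x by exact: lt_le_trans x1.
have h1 : cmod x <= cmod x ^+ m.+2.
  by rewrite exprS ler_peMr ?(ltW x0)// exprn_ege1.
have := congr1 (@cmod R) E; rewrite cmodX cmodM => E'.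
have h2 : cmod (c0 + c1 * x) <= cmod x.
  apply: le_trans (ler_cmodD _ _) _; rewrite cmodM.
  apply: (@le_trans _ _ ((cmod c0 + cmod c1) * cmod x)); last by rewrite ler_piMl ?(ltW x0).
  by rewrite mulrDl lerD2r ler_peMr// cmod_ge0.
have h3 : cmod z * cmod (c0 + c1 * x) < cmod x.
  have [->|zn0] := eqVneq z 0; first by rewrite cmod0 mul0r.
  apply: (@le_lt_trans _ _ (cmod z * cmod x)); first by rewrite ler_wpM2l ?cmod_ge0.
  by rewrite gtr_pMl.
by move: h1; rewrite E' leNgt h3.
Qed.

(** Since [A ^ 2 = 0] the rank is at most the nullity; so in dimension at least 3 the
    nullity is at least 2, and [v A] does not span the kernel. *)
Lemma square_zero_vectors n (A : 'M[C]_n.+3) : A ^+ 2 = 0 -> A != 0 ->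
  exists (v w : 'rV[C]_n.+3), [/\ w *m A = 0 &
   row_free (\matrix_(i < 3) (if i == 0 then v else if i == 1 then v *m A else w))].
Proof.
move=> A2 A0; have [i0 vi] : exists i, row i A != 0.
  apply/existsP; apply: contraNT A0; rewrite negb_exists => /forallP H.
  by apply/eqP/row_matrixP => i; rewrite row0; apply/eqP; have := H i; rewrite negbK.
pose v : 'rV[C]_n.+3 := delta_mx 0 i0.
have vE : v *m A = row i0 A by rewrite -rowE.
have AA : A *m A = 0 by rewrite -[RHS]A2 expr2.
have : ~~ (kermx A <= v *m A)%MS.
  apply/negP => /mxrankS h; have h1 : (\rank (v *m A) <= 1)%N by exact: rank_leq_row.
  have h2 : (\rank A <= \rank (kermx A))%N by apply: mxrankS; rewrite sub_kermx AA.
  have := leq_trans h h1; have := leq_trans h2 (leq_trans h h1); rewrite mxrank_ker.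
  by case: (\rank A) => [|[|]].
move=> /row_subPn[k kv]; set w := row k _ in kv.
have wA : w *m A = 0 by rewrite -row_mul mulmx_ker row0.
exists v, w; split=> //; apply: inj_row_free => x.
rewrite mulmx_sum_row !big_ord_recl big_ord0 !rowK /= addr0.
set x0 := x 0 ord0; set x1 := x 0 _; set x2 := x 0 (lift ord0 (lift ord0 ord0)) => E.
have x00 : x0 = 0.
  have := congr1 (fun y => y *m A) E; rewrite !mulmxDl -!scalemxAl wA -mulmxA AA mulmx0.
  rewrite !scaler0 !addr0 mul0mx vE => /eqP; rewrite scaler_eq0 (negPf vi) orbF.
  by move=> /eqP.
have x20 : x2 = 0.
  apply/eqP; apply: contraNT kv => x2n.
  have -> : w = (- x2^-1 * x1) *: (v *m A).
    apply: (scalerI x2n); rewrite scalerA mulrA mulrN divff// mulN1r scaleNr.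
    by apply/eqP; rewrite -subr_eq0 opprK addrC; move: E; rewrite x00 scale0r add0r => ->.
  exact: scalemx_sub.
have x10 : x1 = 0.
  move: E; rewrite x00 x20 !scale0r add0r addr0 vE => /eqP.
  by rewrite scaler_eq0 (negPf vi) orbF => /eqP.
apply/rowP => j; rewrite mxE; case: j => -[|[|[|//]]] j.
- by rewrite -[RHS]x00; congr (x _ _); apply: val_inj.
- by rewrite -[RHS]x10; congr (x _ _); apply: val_inj.
- by rewrite -[RHS]x20; congr (x _ _); apply: val_inj.
Qed.

(** On the vectors [v], [v A], [w] and their duals the 2 by 2 matrix of [char_poly_update]
    is [[c1, c0 X], [1, 0]]. *)
Lemma square_zero_update n (A : 'M[C]_n.+3) (c0 c1 : C) : A ^+ 2 = 0 -> A != 0 ->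
  char_poly A = 'X^(n.+3) -> exists (P : 'M[C]_(n.+3, 2)) (U : 'M[C]_(2, n.+3)),
    forall z, 'X^4 * char_poly (A + z *: (P *m U)) =
      'X^(n.+3) * ('X^4 - (z * c1)%:P * 'X^2 - (z ^+ 2 * c0)%:P * 'X).
Proof.
move=> A2 A0 cA; have [v [w [wA fW]]] := square_zero_vectors A2 A0.
set W := \matrix_(i < 3) _ in fW; pose F := pinvmx W.
have WF : W *m F = 1%:M by exact: mulmxVp.
have rF i : row i W *m F = delta_mx 0 i by rewrite -row_mul WF row1.
have vF : v *m F = delta_mx 0 0 by rewrite -rF rowK.
have vAF : v *m A *m F = delta_mx 0 1 by rewrite -rF rowK.
have wF : w *m F = delta_mx 0 2 by rewrite -rF rowK.
pose U : 'M[C]_(2, n.+3) := \matrix_(i < 2) (if i == 0 then c1 *: v + c0 *: w else v).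
pose P : 'M[C]_(n.+3, 2) := \matrix_(i, j) F i (if j == 0 then 1 else 2).
have rP (y : 'rV[C]_n.+3) j : (y *m P) 0 j = (y *m F) 0 (if j == 0 then 1 else 2).
  by rewrite !mxE; apply: eq_bigr => k _; rewrite mxE.
exists P, U => z; have := char_poly_update P U z A2 cA => ->; congr (_ * _).
have rE e i j : (U *m A ^+ e *m P) i j =
    ((if i == 0 then c1 *: v + c0 *: w else v) *m A ^+ e *m F) 0 (if j == 0 then 1 else 2).
  rewrite -rP; transitivity (row i (U *m A ^+ e *m P) 0 j); first by rewrite [RHS]mxE.
  by rewrite !row_mul rowK.
have E0 i j : (U *m A ^+ 0 *m P) i j = ((i == 0) && (j == 1))%:R * c0.
  rewrite rE expr0 mulmx1; case: (ord2 i) => ->; case: (ord2 j) => -> /=;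
  by rewrite ?mulmxDl -?scalemxAl vF ?wF !mxE /= ?mulr0 ?mulr1 ?add0r ?mul0r ?mul1r.
have uAF : (c1 *: v + c0 *: w) *m A *m F = c1 *: delta_mx 0 1.
  by rewrite mulmxDl -!scalemxAl wA scaler0 addr0 -scalemxAl vAF.
have E1 i j : (U *m A ^+ 1 *m P) i j = (j == 0)%:R * (if i == 0 then c1 else 1).
  rewrite rE expr1; case: (ord2 i) => ->; case: (ord2 j) => -> /=;
  by rewrite ?uAF ?vAF !mxE /= ?mulr0 ?mulr1 ?mul0r ?mul1r.
have G i j : (pmx U *m resolvent A 2 *m pmx P) i j =
    (((i == 0) && (j == 1))%:R * c0)%:P * 'X + ((j == 0)%:R * (if i == 0 then c1 else 1))%:P.
  by rewrite resolvent_entry !big_ord_recl big_ord0 /= addr0 E0 E1 expr1 expr0 mulr1.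
move: (_ *m pmx P) G => H G.
rewrite det2 !mxE !G /= !(mul0r, mul1r, mulr0n, mulr1n, polyC0, mulr0, add0r, addr0, subr0).
have -> : 1%:P = 1 :> {poly C} by [].
by rewrite !polyCM; ring.
Qed.

End RankUpdates.

(** * Nilpotent base points in dimension at least three *)

Section Nilpotent.
Variable R : realType.
Notation C := R[i].

Lemma square_zero_root (c0 c1 z x : C) : cmod c0 + cmod c1 <= 1 -> cmod z < 1 ->
  root ('X^4 - (z * c1)%:P * 'X^2 - (z ^+ 2 * c0)%:P * 'X) x -> cmod x < 1.
Proof.
move=> c01 z1; have -> : 'X^4 - (z * c1)%:P * 'X^2 - (z ^+ 2 * c0)%:P * 'X =
    'X * ('X^3 - z%:P * ((z * c0)%:P + c1%:P * 'X)) by rewrite !polyCM; ring.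
rewrite rootM rootX => /orP[/eqP ->|]; first by rewrite cmod0.
apply: (@chain_root _ 1) => //; apply: le_trans c01; rewrite lerD2r cmodM.
by rewrite ler_piMl ?cmod_ge0// ltW.
Qed.

(** Interpolate linearly between a triangular form of [A] and the diagonal matrix. *)
Lemma nilpotent_diag_disc n (A : 'M[C]_n) (d : 'I_n -> C) : char_poly A = 'X^n ->
  (forall i, cmod (d i) < 1) -> exists b, disc A (diag_mx (\row_i d i)) b.
Proof.
move=> cA d1; pose m := \big[Num.max/0]_i cmod (d i).
have m1 : m < 1 by apply: bigmax_lt => // i _.
have m0 : 0 <= m by exact: bigmax_ge_id.
pose r := (m + 1) / 2; have r0 : 0 < r by rewrite /r; lra.
have r1 : r < 1 by rewrite /r; lra.
have dr i : cmod (d i) <= r.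
  have : cmod (d i) <= m by exact: (le_bigmax _ (fun i => cmod (d i)) i).
  by rewrite /r; lra.
have rC : r%:C != 0 :> C by rewrite -cmod_gt0 cmod_real gtr0_norm.
have cA0 : char_poly A = \prod_(i < n) ('X - (0 : C)%:P).
  by rewrite cA polyC0 subr0 big_const_ord iter_mulr_1.
have [P [uP tP dP]] := triangularize cA0; set T := P *m A *m invmx P in tP dP.
set D := diag_mx _.
suff dT : disc T D r%:C.
  have uP' : invmx P \in unitmx by rewrite unitmx_inv.
  exists r%:C; have := disc_conj_l uP' rC dT; rewrite invmxK.
  by rewrite /T -!mulmxA mulVmx// mulmx1 mulKmx.
split; first by rewrite cmod_real gtr0_norm.
exists (fun z => T + (z / r%:C) *: (D - T)); split; last 2 first.
- by rewrite mul0r scale0r addr0.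
- by rewrite divff// scale1r addrC subrK.
move=> z z1; split.
  apply: mdiffD; first exact: mdiff_cst.
  apply: mdiffZ; last exact: mdiff_cst.
  by apply: cdiffM; [exact: cdiff_id|exact: cdiff_cst].
set X := _ + _; have XE i j : X i j = T i j + z / r%:C * (d i *+ (i == j) - T i j).
  by rewrite /X /D !mxE.
have tX : is_trig_mx X.
  apply/is_trig_mxP => i j ij; move/is_trig_mxP: tP => /(_ i j ij) T0.
  by rewrite XE T0 -val_eqE ltn_eqF// mulr0n subrr mulr0 addr0.
apply/(in_ball_prod (char_poly_trig tX)) => i.
rewrite XE dP eqxx mulr1n subr0 add0r !cmodM cmodV cmod_real gtr0_norm//.
apply: le_lt_trans z1; rewrite -mulrA ler_piMr ?cmod_ge0//.
by rewrite ler_pdivrMl// mulr1.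
Qed.

(** The monic polynomial of degree [M + 1] without terms of degrees 2 to [M] that has a
    double root at [x]. *)
Definition double_root_poly M (x : C) : {poly C} :=
  'X^(M.+1) - (M.+1%:R * x ^+ M)%:P * 'X + (M%:R * x ^+ M.+1)%:P.

Lemma double_rootP M (x : C) (q : {poly C}) :
  (q * double_root_poly M x).[x] = 0 /\ (q * double_root_poly M x)^`().[x] = 0.
Proof.
have T0 : (double_root_poly M x).[x] = 0.
  by rewrite /double_root_poly !hornerE exprS -natr1; ring.
have T1 : (double_root_poly M x)^`().[x] = 0.
  rewrite /double_root_poly derivD derivB derivXn mul_polyC derivZ derivX derivC !hornerE hornerMn hornerXn /=.
  by rewrite -mulr_natl; ring.
by rewrite derivM hornerD !hornerM T0 T1 !mulr0 addr0.
Qed.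

(** Continuity passes from [B] to the diagonal matrix with its eigenvalues, to which there
    are discs with parameters less than [2 alpha]; [critical_value_bound] applies to them. *)
Lemma lcont_critical n (A B : 'M[C]_n.+1) m M (mu eta alpha : R) :
  lcont A -> A ^+ m = 0 -> char_poly A = 'X^(n.+1) -> (m <= n.+1)%N -> (M <= n)%N ->
  0 < mu -> mu <= 1 ->
  char_poly B = 'X^(n - M) * double_root_poly M mu%:C ->
  cmod (\sum_(k < n.+1 | (k < n.+1 - m)%N) (char_poly B)`_k * mu%:C ^+ k - mu%:C ^+ n.+1)
    = mu ^+ n.+1 ->
  0 < alpha -> alpha < 1 / 8 -> disc A B alpha%:C ->
  4 * alpha ^+ 2 <= eta * mu ^+ m -> 8 * alpha ^+ 3 <= eta * mu ^+ M.+2 ->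
  1 <= eta * (128 * 2 ^+ n.+1 * n.+1%:R).
Proof.
move=> lA Am cA mn Mn mu0 mu1 cB phigh al0 al8 dAB h2 h3.
have [d cd] := char_poly_split B.
have alC : alpha%:C != 0 :> C by rewrite -cmod_gt0 cmod_real gtr0_norm.
have ub := lcont_le_diag lA cd alC dAB; rewrite cmod_real gtr0_norm// in ub.
have d1 := (in_ball_prod cd).1 (disc_ball dAB).2.
have [b db] := nilpotent_diag_disc cA d1.
have lt2 : lempert (spectral_ball R n.+1) A (diag_mx (\row_i d i)) < 2 * alpha by move: ub; lra.
have [a da a2] := lempert_lt db lt2.
have [pmu p'mu] := double_rootP M mu%:C 'X^(n - M); rewrite -cB cd in pmu p'mu.
have muC : mu%:C != 0 :> C by rewrite -cmod_gt0 cmod_real gtr0_norm.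
have a0 : a != 0.
  apply/eqP => aE; move: da => [_ [f [_ f0]]]; rewrite aE f0 => AD.
  have : root (char_poly A) mu%:C.
    rewrite AD char_poly_trig ?diag_mx_is_trig// /root -[X in _ == X]pmu; apply/eqP.
    by congr (horner _ _); apply: eq_bigr => i _; rewrite !mxE eqxx mulr1n.
  by rewrite cA /root hornerXn expf_eq0 (negPf muC).
apply: (@critical_value_bound _ n A d m M.+1 mu eta a) => //.
- move=> k kM; rewrite -cd cB coefXnM; case: ifP => //.
  by rewrite ltn_subRL addnC -ltnS -addnS kM.
- by rewrite -cd.
- by apply: lt_trans a2 _; move: al8; lra.
- apply: le_trans h2; have -> : 4 * alpha ^+ 2 = (2 * alpha) ^+ 2 by ring.
  by rewrite ler_pXn2r ?nnegrE ?cmod_ge0 ?(ltW a2)// mulr_ge0// ltW.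
- apply: le_trans h3; have -> : 8 * alpha ^+ 3 = (2 * alpha) ^+ 3 by ring.
  by rewrite ler_pXn2r ?nnegrE ?cmod_ge0 ?(ltW a2)// mulr_ge0// ltW.
Qed.

(** The target has the double eigenvalue [mu] and is reached at [alpha], of the order of
    [mu ^ (m + 2)], by a perturbation of rank 1. *)
Lemma order3_not_lcont n m (A : 'M[C]_n.+1) : A ^+ m.+3 = 0 -> A ^+ m.+2 != 0 ->
  (m.+3 <= n.+1)%N -> char_poly A = 'X^(n.+1) -> ~ lcont A.
Proof.
move=> A3 A2 mn cA lA; pose L : R := 128 * 2 ^+ n.+1 * n.+1%:R.
have L1 : 1 <= L.
  rewrite /L mulr_ege1 ?ler1n// mulr_ege1 ?ler1n//; first by rewrite exprn_ege1// ler1n.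
(* The factor K makes |c0| + |c1| <= 1 below; the bound of the critical value holds
   with eta = 8 K ^ 3 mu, and mu is such that eta L = 1 / 2. *)
pose K : R := 2 * m.+3%:R; have K1 : 1 <= K by rewrite mulr_ege1// ler1n.
pose mu := (16 * K ^+ 3 * L)^-1.
have D0 : 0 < 16 * K ^+ 3 * L by rewrite !mulr_gt0 ?exprn_gt0// (lt_le_trans ltr01).
have mu0 : 0 < mu by rewrite invr_gt0.
have K0 : 0 < K by exact: lt_le_trans K1.
have L0 : 0 < L by exact: lt_le_trans L1.
have Kmu : K * mu <= 1 / 16.
  rewrite /mu ler_pdivrMr// (_ : _ * (_ * _) = K * (K ^+ 2 * L)); last by field.
  by rewrite ler_peMr ?(ltW K0)// mulr_ege1// exprn_ege1.
have mu1 : mu <= 1.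
  by apply: le_trans (_ : K * mu <= 1); [rewrite ler_peMl// ltW|move: Kmu; lra].
pose alpha := K * mu ^+ m.+2.
have al0 : 0 < alpha by rewrite mulr_gt0// exprn_gt0.
have muX k : mu ^+ k.+1 <= mu by rewrite exprS ler_piMr ?(ltW mu0)// exprn_ile1 ?(ltW mu0).
have al8 : alpha < 1 / 8.
  have : alpha <= K * mu by rewrite ler_pM2l.
  by move: Kmu; lra.
pose c0 : C := - (m.+2%:R * mu / K)%:C; pose c1 : C := (2^-1 : R)%:C.
have c01 : cmod c0 + cmod c1 <= 1.
  rewrite cmodN !cmod_real !ger0_norm ?divr_ge0 ?mulr_ge0 ?(ltW mu0) ?(ltW K0)//.
  have : m.+2%:R * mu / K <= 1 / 2.
    rewrite ler_pdivrMr// (_ : 1 / 2 * K = m.+3%:R); last by rewrite /K; field.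
    apply: (@le_trans _ _ m.+2%:R); last by rewrite ler_nat.
    by rewrite ler_piMr.
  lra.
have [P [U cPU]] := @chain_update _ n m.+1 A c0 c1 A3 A2 cA.
have al1 : cmod (alpha%:C : C) < 1 by rewrite cmod_real gtr0_norm//; move: al8; lra.
have dB := disc_update cPU (fun z x => @chain_root _ m.+1 c0 c1 z x c01) al1.
set B := A + _ in dB.
have cB : char_poly B = 'X^(n - m.+2) * double_root_poly m.+2 mu%:C.
  have X0 : 'X^(m.+3) != 0 :> {poly C} by rewrite expf_neq0// polyX_eq0.
  apply: (mulfI X0); rewrite [LHS]cPU mulrA -exprD addSn subnKC//; congr (_ * _).
  have -> : 'X^(m.+3) - alpha%:C%:P * (c0%:P + c1%:P * 'X) =
      'X^(m.+3) - (alpha%:C * c1)%:P * 'X - (alpha%:C * c0)%:P by rewrite !polyCM; ring.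
  rewrite /double_root_poly -polyCN; congr (_ - _%:P * _ + _%:P).
    rewrite -rmorphM (_ : alpha * 2^-1 = m.+3%:R * mu ^+ m.+2); last by rewrite /alpha /K; field.
    by rewrite rmorphM rmorph_nat rmorphXn.
  rewrite /c0 mulrN opprK -rmorphM (_ : alpha * _ = m.+2%:R * mu ^+ m.+3).
    by rewrite rmorphM rmorph_nat rmorphXn.
  by rewrite /alpha [mu ^+ m.+3]exprS; field; rewrite lt0r_neq0.
have phigh : cmod (\sum_(k < n.+1 | (k < n.+1 - m.+3)%N) (char_poly B)`_k * mu%:C ^+ k -
    mu%:C ^+ n.+1) = mu ^+ n.+1.
  rewrite big1 ?sub0r => [|k kn]; first by rewrite cmodN cmodX cmod_real gtr0_norm.
  by rewrite subSS in kn; rewrite cB coefXnM kn mul0r.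
have K23 : K ^+ 2 <= K ^+ 3 by rewrite [leRHS]exprS ler_peMl// exprn_ge0// ltW.
have h2 : 4 * alpha ^+ 2 <= 8 * K ^+ 3 * mu * mu ^+ m.+3.
  have -> : 4 * alpha ^+ 2 = 4 * K ^+ 2 * (mu ^+ m.+1 * mu ^+ m.+3).
    by rewrite /alpha !exprS; ring.
  have m1 : 0 <= mu ^+ m.+1 by exact: exprn_ge0 (ltW mu0).
  have m3 : 0 <= mu ^+ m.+3 by exact: exprn_ge0 (ltW mu0).
  have k2 : 0 <= 4 * K ^+ 2 by exact: mulr_ge0 _ (exprn_ge0 _ (ltW K0)).
  rewrite -[leRHS]mulrA; apply: ler_pM => //.
  - exact: mulr_ge0.
  - by move: k2 K23; lra.
  - exact: ler_wpM2r.
have h3 : 8 * alpha ^+ 3 <= 8 * K ^+ 3 * mu * mu ^+ m.+4.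
  have -> : 8 * alpha ^+ 3 = 8 * K ^+ 3 * (mu ^+ m.+1 * mu ^+ m.+1 * mu ^+ m.+4).
    by rewrite /alpha !exprS; ring.
  rewrite -[leRHS]mulrA; apply: ler_wpM2l; first by rewrite mulr_ge0// exprn_ge0// ltW.
  rewrite ler_wpM2r ?exprn_ge0 ?(ltW mu0)//; apply: le_trans (muX m).
  by rewrite ler_piMr ?exprn_ge0 ?(ltW mu0)// exprn_ile1// ltW.
have := @lcont_critical n A B m.+3 m.+2 mu _ alpha lA A3 cA mn mn mu0 mu1 cB phigh al0 al8 dB h2 h3.
rewrite -/L (_ : 8 * K ^+ 3 * mu * L = 1 / 2); last by rewrite /mu; field; rewrite !lt0r_neq0.
lra.
Qed.

(** The perturbation of rank 1 would reach the target at a parameter of the order of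
    [mu], which is too large.  That of rank 2 reaches it at [mu ^ (3 / 2)]: here
    [mu = tau ^ 2] and [alpha = 2 tau ^ 3]. *)
Lemma order2_not_lcont n (A : 'M[C]_n.+3) : A ^+ 2 = 0 -> A != 0 ->
  char_poly A = 'X^(n.+3) -> ~ lcont A.
Proof.
move=> A2 A0 cA lA; pose L : R := 128 * 2 ^+ n.+3 * n.+3%:R.
have L1 : 1 <= L.
  rewrite /L mulr_ege1 ?ler1n// mulr_ege1 ?ler1n//; first by rewrite exprn_ege1// ler1n.
(* The bound of the critical value will hold with eta = 64 tau, and eta L = 1 / 2. *)
pose tau := (128 * L)^-1.
have L0 : 0 < L by exact: lt_le_trans L1.
have tau0 : 0 < tau by rewrite invr_gt0 mulr_gt0.
have taus : tau <= 1 / 128.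
  have e : tau * L = 1 / 128 by rewrite /tau; field; rewrite lt0r_neq0.
  by rewrite -e ler_peMr// ltW.
have tau1 : tau <= 1 by lra.
have tX k : tau ^+ k.+1 <= tau by rewrite exprS ler_piMr ?(ltW tau0)// exprn_ile1 ?(ltW tau0).
pose mu := tau ^+ 2; have mu0 : 0 < mu by exact: exprn_gt0.
have mu1 : mu <= 1 by rewrite exprn_ile1// ltW.
pose alpha := 2 * tau ^+ 3.
have al0 : 0 < alpha by rewrite mulr_gt0// exprn_gt0.
have al8 : alpha < 1 / 8 by have := tX 2; rewrite /alpha; move: taus; lra.
pose c0 : C := - (2^-1 : R)%:C; pose c1 : C := (3 / 2 * tau)%:C.
have c01 : cmod c0 + cmod c1 <= 1.
  rewrite cmodN !cmod_real !ger0_norm ?mulr_ge0 ?(ltW tau0)//.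
  by move: taus; lra.
have [P [U cPU]] := @square_zero_update _ n A c0 c1 A2 A0 cA.
have al1 : cmod (alpha%:C : C) < 1 by rewrite cmod_real gtr0_norm//; move: al8; lra.
have dB := disc_update cPU (fun z x => @square_zero_root c0 c1 z x c01) al1.
set B := A + _ in dB.
have cB : char_poly B = 'X^n * double_root_poly 2 mu%:C.
  have X0 : 'X^4 != 0 :> {poly C} by rewrite expf_neq0// polyX_eq0.
  apply: (mulfI X0); rewrite [LHS]cPU [RHS]mulrA -exprD.
  have -> : 'X^4 - (alpha%:C * c1)%:P * 'X^2 - (alpha%:C ^+ 2 * c0)%:P * 'X =
      'X * ('X^3 - (alpha%:C * c1)%:P * 'X - (alpha%:C ^+ 2 * c0)%:P) by ring.
  rewrite [LHS]mulrA -exprSr; congr (_ * _).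
  rewrite /double_root_poly -polyCN; congr (_ - _%:P * _ + _%:P).
    rewrite -rmorphM (_ : alpha * _ = 3%:R * mu ^+ 2); last by rewrite /alpha /mu; field.
    by rewrite rmorphM rmorph_nat rmorphXn.
  rewrite /c0 mulrN opprK -rmorphXn -rmorphM (_ : alpha ^+ 2 * _ = 2%:R * mu ^+ 3).
    by rewrite rmorphM rmorph_nat rmorphXn.
  by rewrite /alpha /mu; field.
have phigh : cmod (\sum_(k < n.+3 | (k < n.+3 - 2)%N) (char_poly B)`_k * mu%:C ^+ k -
    mu%:C ^+ n.+3) = mu ^+ n.+3.
  have nn : (n < n.+3)%N by rewrite ltnW// ltnW.
  rewrite (bigD1 (Ordinal nn)) /= ?subSS ?subn0 ?ltnSn// big1 ?addr0 => [|k /andP[kn kd]].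
    have -> : (char_poly B)`_n = 2%:R * mu%:C ^+ 3.
      rewrite cB coefXnM ltnn subnn /double_root_poly !coefE /=.
      by rewrite mulr0 subr0 add0r.
    have -> : 2%:R * mu%:C ^+ 3 * mu%:C ^+ n - mu%:C ^+ n.+3 = mu%:C ^+ n.+3.
      by rewrite -mulrA -exprD add3n mulr_natl mulr2n addrK.
    by rewrite cmodX cmod_real gtr0_norm.
  rewrite cB coefXnM; have -> : (k < n)%N; last by rewrite mul0r.
  by rewrite ltn_neqAle -ltnS kn andbT.
have h2 : 4 * alpha ^+ 2 <= 64 * tau * mu ^+ 2.
  have -> : 4 * alpha ^+ 2 = 16 * (tau ^+ 2 * mu ^+ 2) by rewrite /alpha /mu; ring.
  rewrite -[leRHS]mulrA; apply: ler_pM => //; first by rewrite mulr_ge0 ?exprn_ge0 ?(ltW tau0) ?(ltW mu0).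
    by rewrite ler_nat.
  by apply: ler_wpM2r; [exact: exprn_ge0 (ltW mu0)|exact: (tX 1%N)].
have h3 : 8 * alpha ^+ 3 <= 64 * tau * mu ^+ 4.
  have -> : 8 * alpha ^+ 3 = 64 * tau * mu ^+ 4 by rewrite /alpha /mu; ring.
  exact: lexx.
have cB' : char_poly B = 'X^(n.+2 - 2) * double_root_poly 2 mu%:C by rewrite !subSS subn0.
have := @lcont_critical n.+2 A B 2 2 mu _ alpha lA A2 cA isT isT mu0 mu1 cB' phigh al0 al8 dB h2 h3.
rewrite -/L (_ : 64 * tau * L = 1 / 2); last by rewrite /tau; field; rewrite !lt0r_neq0.
lra.
Qed.

Lemma nilpotent_not_lcont n (A : 'M[C]_n.+3) : A != 0 -> char_poly A = 'X^(n.+3) -> ~ lcont A.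
Proof.
move=> A0 cA; have An : A ^+ n.+3 = 0.
  have := Cayley_Hamilton A; rewrite cA rmorphXn /= horner_mx_X. exact.
have ex : exists m, A ^+ m == 0 by exists n.+3; rewrite An.
case: (ex_minnP ex) => -[|[|[|m]]] /eqP Am mmin.
- by move: A0; rewrite -[A]mulr1 -(expr0 A) Am mulr0 eqxx.
- by move: A0; rewrite -[A]expr1 Am eqxx.
- exact: order2_not_lcont.
apply: (order3_not_lcont Am) => //.
  by apply/negP => /mmin; rewrite ltnn.
by apply: mmin; rewrite An.
Qed.

End Nilpotent.

(** * The theorem *)

Section Main.
Variable R : realType.
Notation C := R[i].

Lemma lcont_single_eigenvalue n (A : 'M[C]_n) (a : C) : spectral_ball R n A ->
  char_poly A = ('X - a%:P) ^+ n -> lcont A ->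
  is_scalar_mx A \/ (n = 2%N /\ cyclic_mx A /\ two_equal_eigenvalues A).
Proof.
move=> OA cA lA; have [sA|sA] := boolP (is_scalar_mx A); [by left|right].
have cA' : char_poly A = \prod_(i < n) ('X - a%:P) by rewrite big_const_ord iter_mulr_1.
case: n A OA cA lA sA cA' => [|[|[|n]]] A OA cA lA sA cA'.
- by move/negP: sA; case; apply/is_scalar_mxP; exists 0; apply/matrixP => -[].
- by move/negP: sA; case; rewrite [A]mx11_scalar scalar_mx_is_scalar.
- by split=> //; split; [exact: nonscalar_cyclic|exists a].
have a1 : cmod a < 1 := (in_ball_prod cA').1 OA 0.
have cN := char_poly_mobius a1 OA cA'.
rewrite /mobius subrr mul0r big_const_ord iter_mulr_1 polyC0 subr0 in cN.
case: (@nilpotent_not_lcont R n _ _ cN); last by apply/(lcont_mobiusE a1 OA).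
apply: contra sA => /eqP N0; rewrite -(mobius_mxK a1 OA) N0.
by rewrite -(raddf0 (@scalar_mx C n.+3)) mobius_scalar.
Qed.
End Main.

Theorem theorem8p2 (R : realType) (n : nat) (hn : (0 < n)%N)
    (A : 'M[R[i]]_n) (hA : A \in spectral_ball R n) :
  {within spectral_ball R n, continuous (lempert (spectral_ball R n) A)} <->
  is_scalar_mx A \/ (n = 2%N /\ cyclic_mx A /\ two_equal_eigenvalues A).
Proof.
have OA : spectral_ball R n A by rewrite inE in hA.
rewrite lcontP; split=> [lA|[/is_scalar_mxP[a Aa]|[n2 [cA eA]]]].
- have [d cd] := char_poly_split A.
  have de i j : d i = d j.
    by apply/eqP/negPn/negP => dij; apply: (two_eigenvalues_not_lcont OA cd) lA; exists i, j.
  apply: (@lcont_single_eigenvalue _ _ _ (d (Ordinal hn)) OA _ lA).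
  rewrite cd (eq_bigr (fun=> 'X - (d (Ordinal hn))%:P)) => [|i _]; last by rewrite (de i (Ordinal hn)).
  by rewrite big_const_ord iter_mulr_1.
- by rewrite Aa in OA *; exact: lcont_scalar.
by subst n; exact: lcont_cyclic2.
Qed.
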